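(* Let $\Omega\subset\mathbb{R}^n$, $n\ge2$, be a domain satisfying the exterior ball condition with radius $r_e$, let $w\in\partial\Omega$ and $0<r<r_e$. Let $p$ be a bounded Lipschitz continuous variable exponent. Assume that $u$ is a positive $p(\cdot)$-harmonic function in $\Omega\cap B(w,r)$ vanishing continuously on $\partial\Omega\cap B(w,r)$ (that is, $u=0$ on $\partial\Omega\cap B(w,r)$). Then there exist constants $c$ and $\tilde c$ such that if $\tilde r=r/\tilde c$, then $$u(x)\le c\,\frac{d(x,\partial\Omega)}{r}\qquad\text{for } x\in\Omega\cap B(w,\tilde r).$$ The constant $c$ depends only on $\sup_{B(w,2\tilde r)\cap\Omega}u$, $r_e$ and $n,p^+,p^-,\|\nabla p\|_{L^\infty}$, while $\tilde c$ depends only on $r_e$, $p^-$ and $\|\nabla p\|_{L^\infty}$.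
   Context: $B(x,r)$ is the open Euclidean ball, and $d(x,\partial\Omega)$ is the Euclidean distance from $x$ to $\partial\Omega$. A bounded variable exponent is a measurable function $p$ with $1<p^-\le p(x)\le p^+<\infty$, where $p^-=\operatorname{ess\,inf}p$ and $p^+=\operatorname{ess\,sup}p$; without loss of generality exponents are defined on all of $\mathbb{R}^n$ (Lipschitz exponents extend to $\mathbb{R}^n$ with the same constant). $L^{p(\cdot)}$ is the space of measurable $u$ with $\int|u/\mu|^{p(x)}dx<\infty$ for some $\mu>0$; $W^{1,p(\cdot)}$ consists of $u\in L^{p(\cdot)}$ with distributional gradient in $L^{p(\cdot)}$. A continuous function $u\in W^{1,p(\cdot)}_{loc}(U)$ on an open set $U$ is $p(\cdot)$-harmonic if $\int_U|\nabla u|^{p(x)-2}\nabla u\cdot\nabla\phi\,dx=0$ for all $\phi\in C_0^\infty(U)$. Exterior ball condition with radius $r_e>0$: for every $w\in\partial\Omega$ there is $\eta^e\in\mathbb{R}^n\setminus\Omega$ with $B(\eta^e,r_e)\subset\mathbb{R}^n\setminus\Omega$ and $\partial B(\eta^e,r_e)\cap\partial\Omega=\{w\}$. *)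

(* Defs.v *)
From HB Require Import structures.
From mathcomp Require Import all_boot all_order all_algebra.
From mathcomp Require Import all_classical all_reals all_analysis ess_sup_inf.
Set Implicit Arguments.
Unset Strict Implicit.
Unset Printing Implicit Defensive.
Import Order.TTheory GRing.Theory Num.Theory.
Import numFieldNormedType.Exports.

Local Open Scope classical_set_scope.
Local Open Scope ring_scope.

(* R^n is 'rV[R]_n.  The library norm on 'rV[R]_n is the sup norm: it is used
   only through the topology; balls, distances, Lipschitz constants and |grad|
   below are Euclidean. *)

(* The sigma-algebra on 'rV[T]_n is the one generated by the coordinates; for
   T = R it is the Borel sigma-algebra. *)
Section measurable_rV.
Context {d} {T : measurableType d}.
Variable n : nat.

Let coord (i : 'I_n) (x : 'rV[T]_n) : T := x ord0 i.

Let rV_set0 : g_sigma_preimage coord set0.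
Proof. exact: sigma_algebra0. Qed.

Let rV_setC A : g_sigma_preimage coord A -> g_sigma_preimage coord (~` A).
Proof. exact: sigma_algebraC. Qed.

Let rV_bigcup (F : (set 'rV[T]_n)^nat) :
  (forall i, g_sigma_preimage coord (F i)) ->
  g_sigma_preimage coord (\bigcup_i (F i)).
Proof. exact: sigma_algebra_bigcup. Qed.

HB.instance Definition _ := @isMeasurable.Build (measure_tuple_display d)
  'rV[T]_n (g_sigma_preimage coord) rV_set0 rV_setC rV_bigcup.

End measurable_rV.

Lemma measurable_rVcoord d (T : measurableType d) n (i : 'I_n) :
  measurable_fun [set: 'rV[T]_n] (fun x : 'rV[T]_n => x ord0 i).
Proof.
move=> _ Y mY; rewrite setTI; apply: sub_sigma_algebra => /=.
rewrite -bigcup_seq/=; exists i => /=; first by rewrite mem_index_enum.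
by exists Y => //; rewrite setTI.
Qed.

Lemma measurable_fun_rV d1 d2 (T1 : measurableType d1) (T2 : measurableType d2)
    n (f : T1 -> 'rV[T2]_n) :
  (forall i, measurable_fun [set: T1] (fun x => f x ord0 i)) ->
  measurable_fun [set: T1] f.
Proof.
move=> mf _ A mA; rewrite setTI.
suff : g_sigma_preimage (fun (i : 'I_n) (x : 'rV[T2]_n) => x ord0 i) `<=`
       [set A | measurable (f @^-1` A)] by exact.
apply: smallest_sub.
  split=> /=.
  - by rewrite preimage_set0; exact: measurable0.
  - by move=> B mB; rewrite setTD preimage_setC; exact: measurableC.
  - by move=> F mF; rewrite preimage_bigcup; exact: bigcup_measurable.
rewrite -bigcup_seq/=; apply: bigcup_sub => i _ B [C mC <-] /=.
by rewrite setTI -[X in measurable X]setTI; exact: mf.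
Qed.

Lemma sigma_finite_product d1 d2 (T1 : measurableType d1)
    (T2 : measurableType d2) (R : realType)
    (m1 : {sigma_finite_measure set T1 -> \bar R})
    (m2 : {sigma_finite_measure set T2 -> \bar R}) :
  sigma_finite [set: T1 * T2] (m1 \x m2)%E.
Proof.
have /sigma_finiteP[F [TF ndF Foo]] := sigma_finiteT m1.
have /sigma_finiteP[G [TG ndG Goo]] := sigma_finiteT m2.
exists (fun n => F n `*` G n).
  rewrite -setXTT TF TG; apply/seteqP; split=> -[x y] /=.
    move=> [[i _ Fix] [k _ Gky]]; exists (maxn i k) => //; split=> /=.
    - by move: Fix; exact/subsetPset/ndF/leq_maxl.
    - by move: Gky; exact/subsetPset/ndG/leq_maxr.
  by move=> [i _ []/= ? ?]; split; exists i.
move=> k; have [? ?] := Foo k; have [? ?] := Goo k.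
split; first exact: measurableX.
by rewrite product_measure1E// lte_mul_pinfty// ge0_fin_numE.
Qed.

Section lebesgue_rV.
Context {R : realType}.

Definition rVcons n (x : R * 'rV[R]_n) : 'rV[R]_n.+1 :=
  \row_i oapp (x.2 ord0) x.1 (unlift ord0 i).

Definition rVuncons n (v : 'rV[R]_n.+1) : R * 'rV[R]_n :=
  (v ord0 ord0, \row_i v ord0 (lift ord0 i)).

Lemma rVconsK n : cancel (@rVcons n) (@rVuncons n).
Proof.
move=> [t v]; rewrite /rVuncons /rVcons mxE unlift_none/=; congr pair.
by apply/rowP => i; rewrite !mxE liftK.
Qed.

Lemma measurable_rVcons n : measurable_fun setT (@rVcons n).
Proof.
apply: measurable_fun_rV => i; under eq_fun do rewrite mxE.
case: unliftP => [j _|_] /=; last exact: measurable_fst.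
apply: (measurableT_comp (f := fun v : 'rV[R]_n => v ord0 j)) => //.
exact: measurable_rVcoord.
Qed.

Lemma measurable_rVuncons n : measurable_fun setT (@rVuncons n).
Proof.
apply: measurable_fun_pair; first exact: measurable_rVcoord.
apply: measurable_fun_rV => i; under eq_fun do rewrite mxE.
exact: measurable_rVcoord.
Qed.

Section rVcons_measure.
Variables (n : nat) (m : {sigma_finite_measure set 'rV[R]_n -> \bar R}).

Definition rVcons_measure : set 'rV[R]_n.+1 -> \bar R :=
  pushforward (lebesgue_measure \x m)%E (@rVcons n).

HB.instance Definition _ := Measure.copy rVcons_measure
  (measure_function_pushforward__canonical__measure_function_Measure
     (lebesgue_measure \x m)%E (@measurable_rVcons n)).

Let rVcons_measure_sigma_finite : sigma_finite setT rVcons_measure.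
Proof.
have [F FT Foo] := sigma_finite_product (@lebesgue_measure R) m.
exists (fun k => @rVuncons n @^-1` F k).
  by rewrite -preimage_bigcup -FT preimage_setT.
move=> k; have [mF Fk] := Foo k; split.
  by rewrite -[X in measurable X]setTI; exact: measurable_rVuncons.
rewrite /rVcons_measure /pushforward.
rewrite (_ : _ @^-1` _ = F k)//; apply/seteqP.
by split=> x /=; rewrite rVconsK.
Qed.

HB.instance Definition _ := Measure_isSigmaFinite.Build _ _ _ rVcons_measure
  rVcons_measure_sigma_finite.

End rVcons_measure.

(* n-fold product measure, through the isomorphism
   rVcons : R * 'rV[R]_n -> 'rV[R]_n.+1. *)
Fixpoint lebesgue_rV n : {sigma_finite_measure set 'rV[R]_n -> \bar R} :=
  match n with
  | 0 => dirac (0 : 'rV[R]_0)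
  | n'.+1 => rVcons_measure (lebesgue_rV n')
  end.

Lemma lebesgue_rV_box n (A : 'I_n -> set R) : (forall i, measurable (A i)) ->
  lebesgue_rV n [set x | forall i, A i (x ord0 i)] =
  (\prod_(i < n) lebesgue_measure (A i))%E.
Proof.
elim: n A => [|n IH] A mA /=.
  by rewrite big_ord0 diracE mem_set//= => -[].
pose B : set 'rV[R]_n := [set x | forall i, A (lift ord0 i) (x ord0 i)].
have mB : measurable B.
  rewrite [X in measurable X](_ : _ =
      \big[setI/setT]_(i < n) ((fun x : 'rV[R]_n => x ord0 i) @^-1`
        (A (lift ord0 i)))).
    apply: bigsetI_measurable => i _.
    by rewrite -[X in measurable X]setTI; exact: measurable_rVcoord.
  rewrite -bigcap_seq; apply/seteqP; split=> x /= h i => [_|]; first exact: h.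
  by apply: h => /=; rewrite mem_index_enum.
rewrite big_ord_recl -IH; last by move=> i; exact: mA.
rewrite -(product_measure1E (@lebesgue_measure R) (lebesgue_rV n) (mA _) mB).
rewrite /rVcons_measure /pushforward; congr (product_measure1 _ _ _).
apply/seteqP; split=> -[t v] /=; rewrite /rVcons.
- move=> h; split=> [|i] /=.
    by have := h ord0; rewrite mxE unlift_none.
  by have := h (lift ord0 i); rewrite mxE liftK.
- move=> [/= h0 h] i; rewrite mxE; case: unliftP => [j ->|->] //=.
Qed.

End lebesgue_rV.

Section euclidean.
Context {R : realType} {n : nat}.
Implicit Types (x y w : 'rV[R]_n) (A Omega : set 'rV[R]_n).

Definition dot x y : R := \sum_(i < n) x ord0 i * y ord0 i.

Definition enorm x : R := Num.sqrt (dot x x).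

Definition eball x (r : R) : set 'rV[R]_n := [set y | enorm (y - x) < r].

Definition boundary A : set 'rV[R]_n := closure A `\` A°.

Definition edist_set x A : R := inf [set enorm (x - y) | y in A].

Definition domain Omega := [/\ Omega !=set0, open Omega & connected Omega].

Definition exterior_ball_condition Omega (re : R) :=
  0 < re /\
  forall w, boundary Omega w ->
    exists eta, [/\ ~ Omega eta, eball eta re `<=` ~` Omega &
      boundary (eball eta re) `&` boundary Omega = [set w]].

Definition elipschitz (p : 'rV[R]_n -> R) :=
  exists L : R, forall x y, `|p x - p y| <= L * enorm (x - y).

End euclidean.

Section test_functions.
Context {R : realType} {n : nat}.
Implicit Types (f phi u : 'rV[R]_n -> R) (U : set 'rV[R]_n).

Definition partial (i : 'I_n) f : 'rV[R]_n -> R :=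
  fun x => 'D_(delta_mx ord0 i) f x.

Definition grad f : 'rV[R]_n -> 'rV[R]_n := fun x => \row_i partial i f x.

(* All iterated partial derivatives exist and are continuous; derivable is
   needed because 'D_v f x is a total function. *)
Definition smooth f := forall s : seq 'I_n,
  continuous (foldr partial f s) /\
  forall i x, derivable (foldr partial f s) x (delta_mx ord0 i).

(* C_0^oo(U): the support of phi is compact in U iff phi vanishes off some
   compact subset of U. *)
Definition test_function U phi :=
  smooth phi /\
  exists K, [/\ compact K, K `<=` U & forall x, ~ K x -> phi x = 0].

Definition loc_integrable U f := forall K, compact K -> K `<=` U ->
  (lebesgue_rV n).-integrable K (EFin \o f).

Definition distributional_gradient U u (Du : 'rV[R]_n -> 'rV[R]_n) :=
  [/\ loc_integrable U u,
      forall i, loc_integrable U (fun x => Du x ord0 i) &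
      forall phi, test_function U phi -> forall i,
        \int[lebesgue_rV n]_(x in U) (u x * partial i phi x) =
        - \int[lebesgue_rV n]_(x in U) (Du x ord0 i * phi x)].

End test_functions.

Section variable_exponent.
Context {R : realType} {n : nat}.
Implicit Types (p u : 'rV[R]_n -> R) (U : set 'rV[R]_n).
Let mu := lebesgue_rV n : {measure set 'rV[R]_n -> \bar R}.

Definition pminus p : \bar R := ess_inf mu (EFin \o p).

Definition pplus p : \bar R := ess_sup mu (EFin \o p).

Definition bounded_exponent p :=
  [/\ measurable_fun setT p, (1 < pminus p)%E & (pplus p < +oo)%E].

Definition Lp_var p U u :=
  measurable_fun U u /\
  exists2 m : R, 0 < m & (\int[mu]_(x in U) (`|u x / m| `^ p x)%:E < +oo)%E.

Definition Lp_var_loc p U u :=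
  forall K, compact K -> K `<=` U -> Lp_var p K u.

(* W^{1,p(.)}_loc(U), with the distributional gradient Du on U as an explicit
   argument since it is determined only up to a null set. *)
Definition W1p_var_loc p U u (Du : 'rV[R]_n -> 'rV[R]_n) :=
  [/\ distributional_gradient U u Du, Lp_var_loc p U u &
      forall i, Lp_var_loc p U (fun x => Du x ord0 i)].

(* When Du x = 0 the integrand is 0, since dot 0 _ = 0. *)
Definition p_harmonic p U u :=
  {within U, continuous u} /\
  exists2 Du, W1p_var_loc p U u Du &
    forall phi, test_function U phi ->
      \int[mu]_(x in U)
        (enorm (Du x) `^ (p x - 2) * dot (Du x) (grad phi x)) = 0.

Definition Linfty_norm (V : 'rV[R]_n -> 'rV[R]_n) : \bar R :=
  'N[mu]_+oo[EFin \o enorm \o V]%E.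

(* u is a total function: its values outside closure Omega `&` B are
   irrelevant. *)
Definition vanishes_continuously (Omega B : set 'rV[R]_n) u :=
  {within closure Omega `&` B, continuous u} /\
  forall y, boundary Omega y -> B y -> u y = 0.

End variable_exponent.

(* Main.v *)
From HB Require Import structures.
From mathcomp Require Import all_boot all_order all_algebra.
From mathcomp Require Import all_classical all_reals all_analysis measurable_realfun ess_sup_inf.
From mathcomp Require Import ring lra.
Require Import Defs.
Import Order.TTheory GRing.Theory Num.Theory.
Import numFieldNormedType.Exports.
Set Implicit Arguments.
Unset Strict Implicit.
Unset Printing Implicit Defensive.
Local Open Scope classical_set_scope.
Local Open Scope ring_scope.

(** The estimate is a comparison of u with an explicit barrier at each boundary
    point w0 close to x0.  The exterior ball at w0 is shrunk to a ball of centre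
    y0 and radius rho, comparable to r, which is disjoint from Omega and has w0
    on its boundary ([shrink_ball]).  The barrier
      v = a (1 - exp (- k (|x - y0|^2 / rho^2 - 1))),   a = 2 S,
    is nonnegative outside this ball, at least S at distance 2 rho from y0, and
    at most 3 a k |x0 - w0| / rho at x0.  If u <= v in Omega near w0, the
    theorem follows by taking the infimum over w0.

    For a large slope parameter k the barrier is a strict supersolution between
    the spheres of radius rho and 2 rho.  In the divergence of
    |dv|^(p(x) - 2) dv the good term is of order - 2 k (p - 1).  The bad ones are
    the dimension and the derivative of the exponent, at most L rho times the
    logarithm of the slope.  This logarithm grows linearly in k, but it is
    multiplied by L rho, which by the choice of ct is at most (p^- - 1) / 20; and
    rho |ln rho| is bounded.  So k can be chosen in terms of n, S, r_e, p^- and L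
    alone ([steepness_suffices], [bar_div_le]).  Since p is only Lipschitz, the
    supersolution inequality holds in the weak sense and is obtained by
    mollifying p ([barrier_supersolution]).

    The comparison principle ([comparison]) tests the equation of u and the
    inequality of v with the square of the positive part of u_d - v - 2 e, where u_d is a mollification of u: this
    function is of class C^1 with compact support, and the weak equation extends
    from smooth to C^1 test functions ([weak_form_C1]).  Monotonicity of the flux
    contradicts strictness of the supersolution once grad u_d may be replaced by
    grad u in the limit.  That is the delicate point with a variable exponent.
    It rests on a pointwise bound of |f_d|^p(x) by the mollification of |f|^p(.)
    ([moll_modular]), valid because p is Lipschitz, and on a truncation argument
    ([moll_pairing]).

    What these arguments need from analysis on R^n is derived from the
    definition of Lebesgue measure as an iterated product: translation invariance,
    integration by parts, density of continuous functions in L^1, and mollifiers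
    with kernels that are products of one-dimensional bumps. *)

(** * Lebesgue measure on R^n *)

Section lebesgue_rV_theory.
Context {R : realType} {n : nat}.
Local Notation mu := (@lebesgue_rV R n).
Implicit Types (x y a : 'rV[R]_n) (A B : set 'rV[R]_n).

Definition box (F : 'I_n -> set R) : set 'rV[R]_n :=
  [set x | forall i, F i (x ord0 i)].

Definition cube (k : nat) := box (fun=> [set` `[- k%:R : R, k%:R]]).

Lemma measurable_box (F : 'I_n -> set R) :
  (forall i, measurable (F i)) -> measurable (box F).
Proof.
move=> mF; rewrite [X in measurable X](_ : _ =
    \big[setI/setT]_(i < n) ((fun x : 'rV[R]_n => x ord0 i) @^-1` (F i))).
  apply: bigsetI_measurable => i _.
  by rewrite -[X in measurable X]setTI; exact: measurable_rVcoord.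
rewrite -bigcap_seq; apply/seteqP; split=> x /= h i => [_|]; first exact: h.
by apply: h => /=; rewrite mem_index_enum.
Qed.

Lemma ball_rVE x (e : R) : 0 < e -> ball x e = box (fun i => ball (x ord0 i) e).
Proof.
move=> e0; apply/seteqP; split=> y /=; first by move=> [_ h] i; exact: h.
by move=> h; split => // i j; rewrite (ord1 i); exact: h.
Qed.

Lemma ler_rV_norm x i : `|x ord0 i| <= `|x|.
Proof.
rewrite [leRHS]/Num.norm/= mx_normrE.
by apply: (@le_bigmax_cond _ _ _ _ (ord0, i) xpredT (fun k => `|x k.1 k.2|)).
Qed.

Lemma rV_norm_ler x (e : R) : 0 <= e -> (forall i, `|x ord0 i| <= e) -> `|x| <= e.
Proof.
move=> e0 h; rewrite [leLHS]/Num.norm/= mx_normrE.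
by apply: bigmax_le => // -[i j] _ /=; rewrite (ord1 i).
Qed.

Lemma measurable_rV_ball x (e : R) : 0 < e -> measurable (ball x e).
Proof.
move=> e0; rewrite ball_rVE//; apply: measurable_box => i.
by apply: open_measurable; exact: ball_open.
Qed.

(** Every open set is a countable union of sup-norm balls with rational centres
    and radii 1 / k, and such balls are boxes. *)
Lemma measurable_rV_open A : open A -> measurable A.
Proof.
move=> oA.
pose c (q : 'rV[rat]_n) : 'rV[R]_n := map_mx ratr q.
pose B (qk : 'rV[rat]_n * nat) := ball (c qk.1) (qk.2.+1%:R^-1 : R).
have -> : A = \bigcup_qk (if `[< B qk `<=` A >] then B qk else set0).
  apply/seteqP; split=> [x Ax|x [qk _]]; last by case: asboolP => // h /h.
  have /nbhs_ballP[e /= e0 eA] := open_nbhs_nbhs (conj oA Ax).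
  have e20 : 0 < e / 2 by rewrite divr_gt0.
  have [k _ /(_ k (leqnn k)) /= ke] := near_infty_natSinv_lt (PosNum e20).
  have k0 : (0 : R) < k.+1%:R^-1 by rewrite invr_gt0.
  have qP i : exists q : rat, ball (x ord0 i) (k.+1%:R^-1 : R) (ratr q).
    have /rat_in_itvoo[q] : x ord0 i < x ord0 i + k.+1%:R^-1 by rewrite ltrDl.
    rewrite in_itv/= => /andP[q1 q2]; exists q; rewrite ball_itv/= in_itv/=.
    by rewrite q2 andbT (le_lt_trans _ q1)// gerBl ltW.
  have [q qE] := choice qP.
  have Bx : B (\row_i q i, k) x.
    rewrite /B ball_rVE// => i /=; apply: ball_sym; rewrite !mxE.
    exact: qE.
  exists (\row_i q i, k) => //; case: asboolP => // -[].
  move=> y By; apply: eA; rewrite [e]splitr.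
  apply: (ball_triangle (y := c (\row_i q i))).
    by apply: ball_sym; apply: le_ball Bx; exact: ltW.
  by apply: le_ball By; exact: ltW.
apply: countable_bigcupT_measurable => [|qk]; first exact: countableP.
by case: asboolP => // _; apply: measurable_rV_ball; rewrite invr_gt0.
Qed.

Lemma measurable_rV_closed A : closed A -> measurable A.
Proof. by move=> /closed_openC/measurable_rV_open/measurableC; rewrite setCK. Qed.

Lemma measurable_rV_compact A : compact A -> measurable A.
Proof. by move=> cA; apply: measurable_rV_closed; apply: compact_closed. Qed.

Lemma measurable_rV_continuous (f : 'rV[R]_n -> R) :
  continuous f -> measurable_fun setT f.
Proof.
move=> /continuousP cf; apply: (measurability _ (RGenOpens.measurableE R)).
move=> _ [_ [a [b ->] <-]]; rewrite setTI; apply: measurable_rV_open.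
by apply: cf; exact: interval_open.
Qed.

(** Boxes are stable under intersection, so that this description of the
    sigma-algebra lets a measure on R^n be recognized by its values on boxes. *)
Lemma measurable_rVE : measurable = <<s [set box F | F in
  [set F : 'I_n -> set R | forall i, measurable (F i)] ]>>.
Proof.
apply/seteqP; split=> A.
  apply: smallest_sub; first exact: smallest_sigma_algebra.
  rewrite -bigcup_seq; apply: bigcup_sub => i _ _ [Y mY <-].
  apply: sub_sigma_algebra; exists (fun j => if j == i then Y else setT).
    by move=> j /=; case: ifP.
  rewrite setTI; apply/seteqP; split=> x /=; first by move/(_ i); rewrite eqxx.
  by move=> Yx j; case: eqP => // ->.
apply: smallest_sub; first exact: sigma_algebra_measurable.
by move=> _ [F mF <-]; exact: measurable_box.
Qed.

Lemma lebesgue_measure_translate (c : R) (A : set R) : measurable A ->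
  lebesgue_measure ((fun t => t + c) @^-1` A) = lebesgue_measure A.
Proof.
move=> mA.
have mc : measurable_fun setT (fun t : measurableTypeR R => t + c : measurableTypeR R).
  exact: measurable_funD.
pose m := measure_function_pushforward__canonical__measure_function_Measure
  (@lebesgue_measure R) mc.
rewrite [RHS](@lebesgue_measure_unique R m)// => _ [[x y] _ <-].
rewrite /m /= /pushforward (_ : _ @^-1` _ = `]x - c, y - c]%classic).
  rewrite !lebesgue_measure_itv/= !lte_fin ltrD2r; case: ifPn => // _.
  by rewrite -!EFinD; congr EFin; ring.
by apply/seteqP; split=> t /=; rewrite !in_itv/= ltrBlDr lerBrDr.
Qed.

Lemma lebesgue_rV_cube (k : nat) :
  (mu (cube k) < +oo)%E.
Proof.
rewrite lebesgue_rV_box// ltey_eq prode_fin_num// => i _.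
by rewrite lebesgue_measure_itv/=; case: ifP => // _; rewrite -EFinB.
Qed.

Lemma measurable_rV_translate a : measurable_fun setT (fun x => x + a).
Proof.
apply: measurable_fun_rV => i; under eq_fun do rewrite mxE.
by apply: measurable_funD => //; exact: measurable_rVcoord.
Qed.

(** Both sides are measures in A, and they agree on boxes by translation
    invariance in each coordinate. *)
Lemma lebesgue_rV_translate a A : measurable A ->
  mu ((fun x => x + a) @^-1` A) = mu A.
Proof.
move=> mA; pose m := measure_function_pushforward__canonical__measure_function_Measure
  mu (measurable_rV_translate a).
apply/esym; apply: (measure_unique _ cube
  measurable_rVE _ _ _ mu m) => //.
- move=> _ _ [F mF <-] [G mG <-]; exists (fun i => F i `&` G i).
    by move=> i /=; exact: measurableI.
  by apply/seteqP; split=> x /=; [move=> h; split=> i; have [] := h i|move=> [h1 h2] i].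
- by move=> k; exists (fun=> [set` `[- k%:R : R, k%:R]]).
- rewrite -subTset => x _; exists (Num.truncn (`|x|)).+1 => // i /=.
  rewrite in_itv/= -ler_norml (le_trans (ler_rV_norm _ _))// ltW//.
  exact: truncnS_gt.
- move=> _ [F mF <-].
  rewrite /m /= /pushforward (_ : _ @^-1` _ =
    box (fun i => (fun t => t + a ord0 i) @^-1` F i)).
    have mF' i : measurable ((fun t => t + a ord0 i) @^-1` F i).
      by rewrite -[X in measurable X]setTI; apply: (measurable_funD (f := id)).
    rewrite !lebesgue_rV_box//.
    by apply: eq_bigr => i _; rewrite lebesgue_measure_translate.
  by apply/seteqP; split=> x /= h i; have := h i; rewrite mxE.
- by move=> k; exact: lebesgue_rV_cube.
Qed.

Lemma lebesgue_rV_bounded A (M : R) : measurable A ->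
  (forall x, A x -> `|x| <= M) -> (mu A < +oo)%E.
Proof.
move=> mA AM; have kM := truncnS_gt M.
apply: le_lt_trans (lebesgue_rV_cube (Num.truncn M).+1).
apply: le_measure; rewrite ?inE//; first by apply: measurable_box => i.
move=> x /AM xM i /=; rewrite in_itv/= -ler_norml.
by rewrite (le_trans (ler_rV_norm _ _))// (le_trans xM)// ltW.
Qed.

Lemma lebesgue_rV_compact A : compact A -> (mu A < +oo)%E.
Proof.
move=> cA; have [M [_ MA]] := compact_bounded cA.
apply: (@lebesgue_rV_bounded _ (M + 1)); first exact: measurable_rV_compact.
by move=> x Ax; apply: MA => //; rewrite ltrDl.
Qed.

Lemma lebesgue_rV_open_gt0 A : open A -> A !=set0 -> (0 < mu A)%E.
Proof.
move=> oA [x Ax]; have /nbhs_ballP[e /= e0 eA] := open_nbhs_nbhs (conj oA Ax).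
apply: (@lt_le_trans _ _ (mu (ball x e))).
  rewrite ball_rVE// lebesgue_rV_box; last by move=> i; apply: open_measurable; exact: ball_open.
  have E i : lebesgue_measure (ball (x ord0 i) e) = (e *+ 2)%:E.
    by rewrite lebesgue_measure_ball// ltW.
  under eq_bigr do rewrite E.
  by rewrite prodEFin lte_fin prodr_gt0// => i _; rewrite mulrn_wgt0.
by apply: le_measure => //; rewrite inE; [exact: measurable_rV_ball|exact: measurable_rV_open].
Qed.

Lemma ge0_integral_translate a (f : 'rV[R]_n -> \bar R) :
  measurable_fun setT f -> (forall x, 0 <= f x)%E ->
  (\int[mu]_x f (x + a)%R = \int[mu]_x f x)%E.
Proof.
move=> mf f0.
have ma := measurable_rV_translate a.
rewrite -(@ge0_integral_pushforward _ _ _ _ _ _ ma mu setT f)//.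
by apply: eq_measure_integral => A mA _; exact: lebesgue_rV_translate.
Qed.

Lemma integral_translate a (f : 'rV[R]_n -> \bar R) : measurable_fun setT f ->
  (\int[mu]_x f (x + a)%R = \int[mu]_x f x)%E.
Proof.
move=> mf; rewrite integralE [RHS]integralE; congr (_ - _)%E.
  have mfp := measurable_funepos mf.
  rewrite -(ge0_integral_translate a mfp)//.
  by apply: eq_integral => x _; rewrite !funeposE.
have mfn := measurable_funeneg mf.
rewrite -(ge0_integral_translate a mfn)//.
by apply: eq_integral => x _; rewrite !funenegE.
Qed.

Lemma Rintegral_translate a (f : 'rV[R]_n -> R) : measurable_fun setT f ->
  \int[mu]_x f (x + a) = \int[mu]_x f x.
Proof.
move=> mf; rewrite /Rintegral (integral_translate a (f := EFin \o f))//.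
exact/measurable_EFinP.
Qed.

Lemma integrable_translate a (f : 'rV[R]_n -> R) :
  mu.-integrable setT (EFin \o f) ->
  mu.-integrable setT (EFin \o (fun x => f (x + a))).
Proof.
move=> /integrableP[mf fi]; apply/integrableP; split.
  by apply: (measurableT_comp mf); exact: measurable_rV_translate.
rewrite (integral_translate a (f := fun x => `|(f x)%:E|%E))//.
exact: measurableT_comp.
Qed.
End lebesgue_rV_theory.

(** * Smooth bump functions *)

Lemma is_deriveX_fun (R : numFieldType) (V : normedModType R) (f : V -> R) n x v
    (df : R) : is_derive x v f df ->
  is_derive x v (fun y => f y ^+ n) ((n%:R * f x ^+ n.-1) *: df).
Proof.
move=> fdf; rewrite (_ : (fun _ => _) = f ^+ n); first exact: is_deriveX.
by apply/funext => y; rewrite exprfctE.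
Qed.

Section bump1.
Context {R : realType}.
Implicit Types (P : {poly R}) (k : nat) (t : R).

(** The derivatives of exp (- 1 / (t (1 - t))) on ]0, 1[ are all of this form.
    One formula for the first derivative therefore gives smoothness. *)
Definition bump_rat P k t : R :=
  P.[t] * (t * (1 - t)) ^- k * expR (- (t * (1 - t))^-1).

Definition bump1 P k t : R := if 0 < t < 1 then bump_rat P k t else 0.

Definition bump_deriv P k : {poly R} :=
  P^`() * ('X * (1 - 'X)) ^+ 2 - k%:R *: (P * (1 - 'X *+ 2) * ('X * (1 - 'X)))
  + P * (1 - 'X *+ 2).

Lemma is_derive_bump_rat P k t : 0 < t < 1 ->
  is_derive t 1 (bump_rat P k) (bump_rat (bump_deriv P k) k.+2 t).
Proof.
move=> /andP[t0 t1]; have q0 : t * (1 - t) != 0.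
  by rewrite mulf_neq0 ?gt_eqF// subr_gt0.
pose Q : R -> R := fun t => t * (1 - t).
have dQ : is_derive t 1 Q (1 - t *+ 2).
  have -> : Q = horner ('X * (1 - 'X)).
    by apply/funext => y; rewrite /Q !hornerE.
  apply: is_derive_eq.
  by rewrite !derivM derivB derivX derivC !hornerE; ring.
have dQk : is_derive t 1 (fun t => (Q t ^+ k)^-1)
    (- (Q t ^+ k) ^- 2 *: ((k%:R * Q t ^+ k.-1) *: (1 - t *+ 2))).
  apply: (@is_deriveV _ (fun t => Q t ^+ k)); first by rewrite expf_neq0.
  exact: is_deriveX_fun.
have dQV : is_derive t 1 (fun t => (Q t)^-1) (- Q t ^- 2 *: (1 - t *+ 2)).
  exact: is_deriveV.
have dE : is_derive t 1 (fun t => expR (- (Q t)^-1))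
   (expR (- (Q t)^-1) * (- (- Q t ^- 2 *: (1 - t *+ 2)))).
  apply: (is_derive1_comp (f := expR) (g := fun t => - (Q t)^-1)).
have dP := is_derive_poly P t.
apply: is_derive_eq.
rewrite /bump_rat /bump_deriv /Q /GRing.scale/=.
have -> : (P^`() * ('X * (1 - 'X)) ^+ 2 - k%:R *: (P * (1 - 'X *+ 2) * ('X * (1 - 'X)))
  + P * (1 - 'X *+ 2)).[t] = P^`().[t] * (t * (1 - t)) ^+ 2
    - k%:R * (P.[t] * (1 - t *+ 2) * (t * (1 - t))) + P.[t] * (1 - t *+ 2).
  by rewrite !hornerE.
move: (t * (1 - t)) q0 => q q0; move: (P^`().[t]) (P.[t]) (1 - t *+ 2) (expR _) => a b c e.
case: k {dQk} => [|k]; first by field.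
rewrite -pred_Sn !exprS -natr1; have : q ^+ k != 0 by rewrite expf_neq0.
by move: (q ^+ k) => qk qk0; field; rewrite q0 qk0.
Qed.

(** With q = t (1 - t), the factor exp (- 1 / q) beats q^-k because the power
    series of the exponential gives (1 / q)^(k + 2) / (k + 2)! <= exp (1 / q). *)
Lemma bump1_flat P k : exists2 C : R, 0 <= C &
  forall t, `|bump1 P k t| <= C * t ^+ 2 /\ `|bump1 P k t| <= C * (t - 1) ^+ 2.
Proof.
have [M PM] : exists M : R, forall x, 0 <= x <= 1 -> `|P.[x]| <= M.
  by have [M PM] := poly_itv_bound P 0 1; exists M.
have M0 : 0 <= M by rewrite (le_trans (normr_ge0 P.[0]))// PM// lexx ler01.
exists (M * k.+2`!%:R) => [|t]; first by rewrite mulr_ge0.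
rewrite /bump1; case: ifPn => [/andP[t0 t1]|_]; last first.
  by rewrite normr0; split; rewrite (mulr_ge0 (mulr_ge0 M0 (ler0n _ _))) ?sqr_ge0.
set q := t * (1 - t).
have q0 : 0 < q by rewrite mulr_gt0// subr_gt0.
have Ee : q ^- k * expR (- q^-1) <= k.+2`!%:R * q ^+ 2.
  have qk2 : 0 < q ^+ k.+2 by rewrite exprn_gt0.
  rewrite mulrC ler_pdivrMr ?exprn_gt0// -mulrA -exprD addnC.
  rewrite expRN -ler_pdivrMl ?ltr0n ?fact_gt0//.
  rewrite ler_pdivrMr ?expR_gt0// addn2.
  have q1 : 0 <= q^-1 by rewrite invr_ge0 ltW.
  apply: (@le_trans _ _ (q ^+ k.+2 * (q^-1 ^+ k.+2 / k.+2`!%:R))).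
    by rewrite mulrA -exprMn divff ?gt_eqF// expr1n mul1r.
  rewrite ler_pM2l//; apply: le_trans (expR_ge1Dxn k.+1 q1).
  by rewrite ler_wpDl.
have H : `|bump_rat P k t| <= M * k.+2`!%:R * q ^+ 2.
  rewrite /bump_rat -/q -mulrA normrM -mulrA ler_pM//.
    by apply: PM; rewrite !ltW.
  by rewrite ger0_norm// mulr_ge0 ?invr_ge0 ?exprn_ge0 ?expR_ge0// ltW.
have q2 x : 0 <= x -> q <= x -> M * k.+2`!%:R * q ^+ 2 <= M * k.+2`!%:R * x ^+ 2.
  by move=> x0 qx; rewrite ler_wpM2l ?mulr_ge0// lerXn2r// nnegrE ltW.
split; apply: (le_trans H).
  by apply: q2; [exact: ltW|rewrite ler_piMr ?ltW// gtrBl].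
rewrite -(sqrrN (t - 1)) opprB.
by apply: q2; [rewrite subr_ge0 ltW|rewrite ler_piMl ?subr_ge0 ?ltW].
Qed.

Lemma gt_nbhs (a x : R) : a < x -> \forall y \near x, a < y.
Proof.
move=> ax; have : x \in `]a, +oo[ by rewrite in_itv/= andbT.
by move=> /near_in_itvoy; apply: filterS => y; rewrite in_itv/= andbT.
Qed.

Lemma lt_nbhs (a x : R) : x < a -> \forall y \near x, y < a.
Proof.
move=> ax; have : x \in `]-oo, a[ by rewrite in_itv/=.
by move=> /near_in_itvNyo; apply: filterS => y; rewrite in_itv/=.
Qed.

(** A function dominated by a square has derivative 0 at the centre of the square;
    this glues smooth pieces along a point where they vanish to second order. *)
Lemma is_derive_flat (f : R -> R) (a C : R) : 0 <= C ->
  (forall t, `|f t| <= C * (t - a) ^+ 2) -> is_derive a 1 f 0.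
Proof.
move=> C0 H.
have fa : f a = 0 by apply/normr0_eq0/le_anti; rewrite (le_trans (H a)) ?normr_ge0// subrr expr0n mulr0.
have : (fun h : R => h^-1 *: (f (h *: 1 + a) - f a)) h @[h --> 0^'] --> (0 : R).
  rewrite fa; apply/cvgr0Pnorm_lt => e e0.
  near=> h.
  have h0 : h != 0 by near: h; exact: nbhs_dnbhs_neq.
  rewrite subr0 normrZ normfV scaler1 ltr_pdivrMl ?normr_gt0//.
  rewrite (le_lt_trans (H _))// addrK -real_normK ?num_real// expr2 mulrA.
  rewrite mulrC ltr_pM2l ?normr_gt0//.
  rewrite (@le_lt_trans _ _ ((C + 1) * `|h|)) ?ler_wpM2r ?lerDl// mulrC -ltr_pdivlMr ?ltr_pwDr//.
  near: h; apply: dnbhs0_lt.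
  by rewrite divr_gt0// ltr_pwDr.
move=> cf; apply: DeriveDef; first by apply/cvg_ex; exists 0.
exact/cvg_lim.
Unshelve. all: by end_near. Qed.

Lemma is_derive_bump1 P k t : is_derive t 1 (bump1 P k) (bump1 (bump_deriv P k) k.+2 t).
Proof.
have [C C0 HC] := bump1_flat P k.
have [t0|t0|->] := ltgtP t 0.
- rewrite /bump1 ifF; last by apply/negbTE; rewrite negb_and -leNgt ltW.
  apply: (@near_eq_is_derive R R R (cst 0)).
  near=> y; rewrite /bump1 ifF//; apply/negbTE; rewrite negb_and -leNgt.
  by apply/orP; left; apply: ltW; near: y; exact: lt_nbhs.
- have [t1|t1|->] := ltgtP t 1.
  + rewrite {2}/bump1 t0 t1/=.
    apply: (@near_eq_is_derive _ _ _ (bump_rat P k)); last by apply: is_derive_bump_rat; rewrite t0.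
    near=> y; rewrite /bump1 ifT//; apply/andP; split; near: y.
      exact: gt_nbhs.
    exact: lt_nbhs.
  + rewrite /bump1 ifF; last by apply/negbTE; rewrite negb_and -!leNgt (ltW t1) orbT.
    apply: (@near_eq_is_derive R R R (cst 0)).
    near=> y; rewrite /bump1 ifF//; apply/negbTE; rewrite negb_and -!leNgt.
    apply/orP; right; apply: ltW; near: y; exact: gt_nbhs.
  + rewrite /bump1 ltxx andbF.
    by apply: (is_derive_flat C0) => y; have [] := HC y.
- rewrite /bump1 ltxx/=.
  by apply: (is_derive_flat C0) => y; rewrite subr0; have [] := HC y.
Unshelve. all: by end_near. Qed.

Lemma continuous_bump1 P k : continuous (bump1 P k).
Proof.
move=> t; apply: differentiable_continuous; apply/derivable1_diffP.
by have [] := is_derive_bump1 P k t.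
Qed.

Lemma bump1_out P k t : ~~ (0 < t < 1) -> bump1 P k t = 0.
Proof. by rewrite /bump1 => /negbTE ->. Qed.

End bump1.

(** * Uniformity on compact sets *)

Section compactness.
Context {R : realType} {V : normedModType R}.
Implicit Types (K U : set V) (f : V -> R).

Lemma continuous_atP f x : {for x, continuous f} <->
  forall e, 0 < e -> exists2 d : R, 0 < d & forall y, `|y - x| < d -> `|f y - f x| < e.
Proof.
split=> [cf e e0|cf].
  have /cvgrPdist_lt /(_ _ e0) /nbhs_ballP[d /= d0 dP] := cf; exists d => // y xy.
  by rewrite distrC; apply: dP; rewrite -ball_normE/= distrC.
apply/cvgrPdist_lt => e /cf[d d0 dP]; apply/nbhs_ballP; exists d => //= y.
by rewrite -ball_normE/= distrC => /dP; rewrite distrC.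
Qed.

Lemma compact_open_margin K U : compact K -> open U -> K `<=` U ->
  exists2 d : R, 0 < d & forall x y, K x -> `|y - x| < d -> U y.
Proof.
move=> cK oU KU.
have : \forall d \near (0 : R)^'+, K `<=` (fun x => forall y, `|y - x| < d -> U y).
  move/compact_near_coveringP: cK; apply => x Kx.
  have /nbhs_ballP[e /= e0 eU] := open_nbhs_nbhs (conj oU (KU _ Kx)).
  exists (ball x (e / 2), [set d | d < e / 2]) => /=.
    split; first by apply: nbhsx_ballx; rewrite divr_gt0.
    by apply: nbhs_right_lt; rewrite divr_gt0.
  move=> [x' d] /= [xx' de] y yx'; apply: eU; rewrite [e]splitr.
  apply: ball_triangle xx' _; rewrite -ball_normE/= distrC.
  by rewrite (lt_trans yx').
move=> H; near (0 : R)^'+ => d; exists d => // x y Kx.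
by move: x Kx y; near: d.
Unshelve. all: by end_near. Qed.

(** Unlike in Heine's theorem the second point y may leave K, which is why
    continuity is required at the points of K and not within K. *)
Lemma heine_at K f : compact K -> (forall x, K x -> {for x, continuous f}) ->
  forall e, 0 < e -> exists2 d : R, 0 < d &
    forall x y, K x -> `|y - x| < d -> `|f y - f x| < e.
Proof.
move=> cK cf e e0.
have : \forall d \near (0 : R)^'+, K `<=` (fun x => forall y, `|y - x| < d -> `|f y - f x| < e).
  move/compact_near_coveringP: (cK); apply => x Kx.
  have e20 : 0 < e / 2 by rewrite divr_gt0.
  have /cvgrPdist_lt /(_ _ e20) /nbhs_ballP[d /= d0 dU] := cf x Kx.
  exists (ball x (d / 2), [set t | t < d / 2]) => /=.
    split; first by apply: nbhsx_ballx; rewrite divr_gt0.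
    by apply: nbhs_right_lt; rewrite divr_gt0.
  move=> [x' t] /= [xx' de] y yx'.
  have fx' : `|f x - f x'| < e / 2.
    by apply: dU => //; apply: le_ball xx'; rewrite ler_pdivrMr// ler_peMr ?ler1n// ltW.
  have fy : `|f x - f y| < e / 2.
    apply: dU => //; rewrite [d]splitr; apply: ball_triangle xx' _.
    by rewrite -ball_normE/= distrC (lt_trans yx').
  rewrite -(subrK (f x) (f y)) -addrA (splitr e) (le_lt_trans (ler_normD _ _))//.
  by rewrite ltrD// distrC.
move=> H; near (0 : R)^'+ => d; exists d => // x y Kx.
by move: x Kx y; near: d.
Unshelve. all: by end_near. Qed.

Lemma compact_support_unif_continuous K f : compact K -> continuous f ->
  (forall x, ~ K x -> f x = 0) ->
  forall e, 0 < e -> exists2 d : R, 0 < d &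
    forall x y, `|y - x| < d -> `|f y - f x| < e.
Proof.
move=> cK cf f0 e e0.
have [d d0 dP] := heine_at cK (fun x _ => cf x) e0.
exists d => // x y xy; have [Kx|Kx] := pselect (K x); first exact: dP.
have [Ky|Ky] := pselect (K y); first by rewrite distrC dP// distrC.
by rewrite !f0// subrr normr0.
Qed.

Lemma compact_support_bounded K f : compact K -> continuous f ->
  (forall x, ~ K x -> f x = 0) -> exists2 C : R, 0 <= C & forall x, `|f x| <= C.
Proof.
move=> cK cf f0.
have [M [_ MP]] : bounded_set (f @` K).
  by apply: compact_bounded; apply: continuous_compact => //; exact: continuous_subspaceT.
exists (`|M| + 1) => // x; have [Kx|Kx] := pselect (K x).
  apply: (MP (`|M| + 1)); last by exists x.
  by rewrite ltr_pwDr// ler_norm.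
by rewrite f0// normr0.
Qed.
End compactness.

(** * Directional derivatives and product kernels *)

Section directional.
Context {R : realType} {V : normedModType R}.
Implicit Types (f : V -> R) (x v : V) (df : R).

(** Directional derivatives are ordinary derivatives along a line.  The
    one-dimensional chain rule and differentiation under the integral sign are
    transported to R^n through this equivalence. *)
Lemma is_derive_lineP f x v (t : R) df :
  is_derive t 1 (fun s : R => f (s *: v + x)) df <-> is_derive (t *: v + x) v f df.
Proof.
have E : (fun h : R => h^-1 *: (((fun s : R => f (s *: v + x)) \o shift t) (h *: 1) - f (t *: v + x)))
   = (fun h : R => h^-1 *: ((f \o shift (t *: v + x)) (h *: v) - f (t *: v + x))).
  by apply/funext => h /=; rewrite scaler1 scalerDl addrA.
by split => -[df1 df2]; apply: DeriveDef; move: df1 df2; rewrite /derivable /derive E.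
Qed.

Lemma is_derive_line f x v df :
  is_derive x v f df -> is_derive (0 : R) 1 (fun s : R => f (s *: v + x)) df.
Proof. by move=> h; apply/is_derive_lineP; rewrite scale0r add0r. Qed.

Lemma is_derive_of_line f x v df :
  is_derive (0 : R) 1 (fun s : R => f (s *: v + x)) df -> is_derive x v f df.
Proof. by move=> /is_derive_lineP; rewrite scale0r add0r. Qed.

Lemma is_derive_comp1 (g : R -> R) f x v a df :
  is_derive (f x) 1 g a -> is_derive x v f df -> is_derive x v (g \o f) (a * df).
Proof.
move=> dg /is_derive_line df'; apply: is_derive_of_line.
apply: (is_derive1_comp (f := g) (g := fun s : R => f (s *: v + x))) => //.
by rewrite scale0r add0r.
Qed.

End directional.

Section kernels.
Context {R : realType} {n : nat}.
Implicit Types (z : 'rV[R]_n) (s : 'I_n -> {poly R} * nat) (c d : R).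

(** A product of one-dimensional bumps supported in the cube [0, d]^n.  The index
    s records, coordinate by coordinate, which member of the family of bumps is
    used, so that the partial derivatives of a kernel are again kernels. *)
Definition kern c d s z : R :=
  c * \prod_(i < n) bump1 (s i).1 (s i).2 (z ord0 i / d).

(** The index of the partial derivative in direction i. *)
Definition kern_upd d i s : 'I_n -> {poly R} * nat := fun j =>
  if j == i then (d^-1 *: bump_deriv (s i).1 (s i).2, (s i).2.+2) else s j.

Lemma bump1Z a P k t : bump1 (a *: P) k t = a * bump1 P k t :> R.
Proof.
by rewrite /bump1; case: ifP => _; rewrite ?mulr0// /bump_rat hornerZ -!mulrA.
Qed.

Lemma is_derive_kern c d s i z :
  is_derive z (delta_mx ord0 i) (kern c d s) (kern c d (kern_upd d i s) z).
Proof.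
apply: is_derive_of_line.
have E : (fun h : R => kern c d s (h *: delta_mx ord0 i + z)) =
  (fun h => c * (\prod_(j < n | j != i) bump1 (s j).1 (s j).2 (z ord0 j / d)) *
            bump1 (s i).1 (s i).2 (h / d + z ord0 i / d)).
  apply/funext => h; rewrite /kern (bigD1 i)//= mulrAC -mulrA.
  rewrite !mxE !eqxx mulr1 mulrDl; congr (_ * (_ * _)).
  by apply: eq_bigr => j /negbTE ji; rewrite !mxE ji andbF mulr0 add0r.
rewrite E; set A := c * _.
have D1 : is_derive (0 : R) 1 (fun h : R => h / d + z ord0 i / d) d^-1.
  have -> : (fun h : R => h / d + z ord0 i / d) = (fun h => d^-1 * h + z ord0 i / d).
    by apply/funext => h; rewrite mulrC.
  by apply: is_derive_eq; rewrite addr0 /GRing.scale/= mulr1.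
have D2 : is_derive (0:R) 1 (fun h : R => bump1 (s i).1 (s i).2 (h / d + z ord0 i / d))
   (bump1 (bump_deriv (s i).1 (s i).2) (s i).2.+2 (0 / d + z ord0 i / d) * d^-1).
  apply: (is_derive1_comp (f := bump1 (s i).1 (s i).2)).
  exact: is_derive_bump1.
apply: (is_derive_eq (f' := A *: (bump1 (bump_deriv (s i).1 (s i).2) (s i).2.+2 (0 / d + z ord0 i / d) * d^-1))).
rewrite mul0r add0r /GRing.scale/= /A /kern -mulrA; congr (_ * _).
rewrite [RHS](bigD1 i)//= /kern_upd eqxx /= bump1Z [LHS]mulrC.
rewrite [X in X * _]mulrC; congr (_ * _).
by apply: eq_bigr => j ji; rewrite (negbTE ji).
Qed.

Lemma continuous_rVcoord i : continuous (fun z : 'rV[R]_n => z ord0 i).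
Proof. exact: coord_continuous. Qed.

Lemma continuous_kern c d s : continuous (kern c d s).
Proof.
move=> z; apply: (@cvgM _ _ (nbhs z) _ (cst c) (fun z => \prod_(i < n) bump1 (s i).1 (s i).2 (z ord0 i / d))).
  exact: cvg_cst.
apply: (@cvg_big R 'I_n (fun a b : R => a * b) 1 predT) => [|i _].
  exact: (@mul_continuous R).
 apply: (@cvg_comp _ _ _ (fun z : 'rV[R]_n => z ord0 i / d) (bump1 (s i).1 (s i).2)); last exact: continuous_bump1.
apply: (@cvgM _ _ (nbhs z) _ (fun z : 'rV[R]_n => z ord0 i) (cst d^-1)); last exact: cvg_cst.
exact: continuous_rVcoord.
Qed.

Lemma kern_out c d s z i : 0 < d -> ~~ (0 < z ord0 i < d) -> kern c d s z = 0.
Proof.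
move=> d0 h; rewrite /kern (bigD1 i)//= bump1_out ?mul0r ?mulr0//.
by rewrite pmulr_lgt0 ?invr_gt0// ltr_pdivrMr// mul1r.
Qed.

End kernels.

Section kernel_support.
Context {R : realType} {n : nat}.
Implicit Types (x y z : 'rV[R]_n) (s : 'I_n -> {poly R} * nat) (c d : R).

Definition corner_box (d : R) : set 'rV[R]_n := box (fun=> [set` `[0, d]]).

Lemma compact_corner_box d : compact (corner_box d).
Proof. by apply: rV_compact => i; exact: segment_compact. Qed.

Lemma kern_out_box c d s z : 0 < d -> ~ corner_box d z -> kern c d s z = 0.
Proof.
move=> d0 /existsNP[i iz]; apply: (@kern_out _ _ c d s z i) => //.
by apply/negP => /andP[a b]; apply: iz; rewrite /= in_itv/= !ltW.
Qed.

Lemma kern_bounded c d s : 0 < d -> exists2 C : R, 0 <= C & forall z, `|kern c d s z| <= C.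
Proof.
move=> d0; apply: (@compact_support_bounded R _ _ (kern c d s) (@compact_corner_box d)).
  exact: continuous_kern.
by move=> z; exact: kern_out_box.
Qed.

Lemma kern_unif_continuous c d s : 0 < d -> forall e, 0 < e -> exists2 t : R, 0 < t &
  forall x y, `|y - x| < t -> `|kern c d s y - kern c d s x| < e.
Proof.
move=> d0; apply: (@compact_support_unif_continuous R _ _ (kern c d s) (@compact_corner_box d)).
  exact: continuous_kern.
by move=> z; exact: kern_out_box.
Qed.

Lemma is_derive_kern_shift c d s i x y :
  is_derive y (delta_mx ord0 i) (fun y => kern c d s (y - x)) (kern c d (kern_upd d i s) (y - x)).
Proof.
apply: is_derive_of_line.
rewrite (_ : (fun _ => _) = (fun h : R => kern c d s (h *: delta_mx ord0 i + (y - x)))).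
  by apply: is_derive_line; exact: is_derive_kern.
by apply/funext => h; rewrite addrA.
Qed.

Lemma foldr_partial_kern_shift c d s x l : exists s',
  foldr partial (fun y => kern c d s (y - x)) l = (fun y => kern c d s' (y - x)).
Proof.
elim: l => [|i l [s' IH]]; first by exists s.
exists (kern_upd d i s') => /=; rewrite IH; apply/funext => y.
by have [_ ] := is_derive_kern_shift c d s' i x y.
Qed.

Lemma smooth_kern_shift c d s x : smooth (fun y => kern c d s (y - x)).
Proof.
move=> l; have [s' ->] := foldr_partial_kern_shift c d s x l; split.
  move=> y; apply: (@continuous_comp _ _ _ (fun y => y - x) (kern c d s')).
    by apply: (@cvgB _ _ _ (nbhs y) _ id (cst x)); [exact: cvg_id|exact: cvg_cst].
  exact: continuous_kern.
by move=> i y; have [] := is_derive_kern_shift c d s' i x y.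
Qed.

Lemma test_function_kern_shift c d s x (U : set 'rV[R]_n) : 0 < d ->
  (forall y, corner_box d (y - x) -> U y) -> test_function U (fun y => kern c d s (y - x)).
Proof.
move=> d0 xU; split; first exact: smooth_kern_shift.
exists (box (fun i => [set` `[x ord0 i, x ord0 i + d]])); split.
- by apply: rV_compact => i; exact: segment_compact.
- by move=> y yx; apply: xU => i; have := yx i; rewrite /= !mxE !in_itv/= subr_ge0 lerBlDl.
- move=> y yx; apply: kern_out_box => // h; apply: yx => i.
  by have := h i; rewrite /= !mxE !in_itv/= subr_ge0 lerBlDl.
Qed.

End kernel_support.

(** * Convolution with a bounded kernel *)

Section convolution.
Context {R : realType} {n : nat}.
Local Notation mu := (@lebesgue_rV R n).
Local Notation L1 f := (mu.-integrable setT (EFin \o f)).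
Implicit Types (x y z v : 'rV[R]_n) (f g k dk : 'rV[R]_n -> R).

(** The kernel is evaluated at y - x, not x - y: when it is supported in
    [0, d]^n, the value at x only involves f on the cube x + [0, d]^n. *)
Definition moll k f x : R := \int[mu]_y (f y * k (y - x)).

Lemma L1_mul_bounded f g (C : R) : L1 f -> measurable_fun setT g ->
  (forall x, `|g x| <= C) -> L1 (fun x => f x * g x).
Proof.
move=> /[dup] L1f /integrableP[/measurable_EFinP mf _] mg gC.
have L1Cf : L1 (fun x => C * f x).
  have := integrableZl measurableT C L1f; apply: eq_integrable => //.
apply: le_integrable L1Cf => //.
  by apply/measurable_EFinP; exact: measurable_funM.
move=> x _; rewrite /= lee_fin !normrM mulrC ler_wpM2r//.
by rewrite (le_trans (gC x))// ler_norm.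
Qed.

Lemma measurable_sub_comp k x : measurable_fun setT k -> measurable_fun setT (fun y => k (y - x)).
Proof. by move=> mk; apply: measurableT_comp mk _; exact: measurable_rV_translate. Qed.

(** Differentiation under the integral sign; the sign comes from the kernel being
    evaluated at y - x. *)
Lemma is_derive_moll k dk f x v (C : R) : L1 f ->
  measurable_fun setT k -> measurable_fun setT dk ->
  (forall z, is_derive z v k (dk z)) -> (forall z, `|k z| <= C) -> (forall z, `|dk z| <= C) ->
  is_derive x v (moll k f) (- moll dk f x).
Proof.
move=> L1f mk mdk dkP kC dkC; apply: is_derive_of_line.
pose F (t : R) y : R := f y * k (y - (t *: v + x)).
have lineE t y : y - (t *: v + x) = (- t) *: v + (y - x).
  by rewrite scaleNr opprD addrCA.
have dF (t : R) y : is_derive t 1 (F ^~ y) (- (f y * dk (y - (t *: v + x)))).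
  have -> : F ^~ y = (fun t => f y * (((fun s : R => k (s *: v + (y - x))) \o -%R) t)).
    by apply/funext => s; rewrite /F/= lineE.
  have dl : is_derive (- t) 1 (fun s : R => k (s *: v + (y - x))) (dk (y - (t *: v + x))).
    by rewrite lineE; apply/is_derive_lineP.
  apply: is_derive_eq.
  by rewrite /GRing.scale/= mulrN1 mulrN.
have H := @cvg_differentiation_under_integral R _ _ mu F setT measurableT 0 (-1) 1 _ _ _
  (fun y => `|f y| * C).
have d1E t y : partial1of2 F t y = - (f y * dk (y - (t *: v + x))).
  by rewrite partial1of2E; have [_ ->] := dF t y.
have {H} : h^-1 *: (\int[mu]_y F (h + 0) y - \int[mu]_y F 0 y) @[h --> (0 : R)^'] -->
    \int[mu]_y partial1of2 F 0 y.
  apply: H.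
  - by rewrite /= in_itv/= ltrN10 ltr01.
  - by move=> t _; apply: L1_mul_bounded => //; exact: measurable_sub_comp.
  - by move=> t y _ _; have [] := dF t y.
  - by move=> y; rewrite mulr_ge0// (le_trans _ (kC 0)).
  - apply: (@L1_mul_bounded (fun y => `|f y|) (cst C) `|C|) => //.
    by have := integrable_norm L1f; apply: eq_integrable.
  - by move=> t y _ _; rewrite d1E normrN normrM ler_wpM2l.
have -> : \int[mu]_y partial1of2 F 0 y = - moll dk f x.
  under eq_Rintegral do rewrite d1E scale0r add0r -mulN1r.
  rewrite RintegralZl ?mulN1r//.
  by apply: (L1_mul_bounded (C := C)) => //; exact: measurable_sub_comp.
move=> cF.
have cF' : h^-1 *: (((fun t : R => moll k f (t *: v + x)) \o shift 0) (h *: 1)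
    - moll k f (0 *: v + x)) @[h --> (0 : R)^'] --> - moll dk f x.
  by under eq_fun do rewrite /= scaler1.
by apply: DeriveDef; [apply/cvg_ex; exists (- moll dk f x)|exact/cvg_lim].
Qed.

Lemma continuous_moll k f (C : R) : L1 f -> measurable_fun setT k ->
  (forall z, `|k z| <= C) ->
  (forall e, 0 < e -> exists2 t : R, 0 < t & forall x y, `|y - x| < t -> `|k y - k x| < e) ->
  continuous (moll k f).
Proof.
move=> L1f mk kC ku x; apply/continuous_atP => e e0.
pose M := \int[mu]_y `|f y|.
have M0 : 0 <= M by apply: Rintegral_ge0.
have M1 : 0 < M + 1 by rewrite ltr_pwDr.
have [t t0 tP] := ku (e / (M + 1)) (divr_gt0 e0 M1).
have L1k z : L1 (fun y => f y * k (y - z)).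
  by apply: (L1_mul_bounded (C := C)) => //; exact: measurable_sub_comp.
have L1a : L1 (fun y => `|f y|).
  by have := integrable_norm L1f; apply: eq_integrable.
exists t => // z xz; rewrite distrC /moll -RintegralB//.
have L1B : L1 (fun y => f y * k (y - x) - f y * k (y - z)).
  by have := integrableB measurableT (L1k x) (L1k z); apply: eq_integrable.
rewrite (le_lt_trans (le_normr_Rintegral _ _))//.
apply: (@le_lt_trans _ _ (\int[mu]_y (e / (M + 1) * `|f y|))).
  apply: le_Rintegral => //.
  - by have := integrable_norm L1B; apply: eq_integrable.
  - by have := integrableZl measurableT (e / (M + 1)) L1a; apply: eq_integrable.
  move=> y _; rewrite -mulrBr normrM mulrC ler_wpM2r// ltW//.
  by apply: tP; rewrite opprB addrC addrA subrK.
rewrite RintegralZl// mulrAC -/M ltr_pdivrMr//.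
by rewrite ltr_pM2l// ltrDl.
Qed.

End convolution.

(** * Integrable functions *)

Section L1_toolkit.
Context {R : realType} {n : nat}.
Local Notation mu := (@lebesgue_rV R n).
Local Notation L1 f := (mu.-integrable setT (EFin \o f)).
Implicit Types (f g h : 'rV[R]_n -> R) (A K : set 'rV[R]_n).

Lemma L1_measurable f : L1 f -> measurable_fun setT f.
Proof. by move=> /integrableP[/measurable_EFinP]. Qed.

Lemma L1D f g : L1 f -> L1 g -> L1 (fun x => f x + g x).
Proof. by move=> L1f L1g; have := integrableD measurableT L1f L1g; apply: eq_integrable. Qed.

Lemma L1B f g : L1 f -> L1 g -> L1 (fun x => f x - g x).
Proof. by move=> L1f L1g; have := integrableB measurableT L1f L1g; apply: eq_integrable. Qed.

Lemma L1Z (c : R) f : L1 f -> L1 (fun x => c * f x).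
Proof. by move=> L1f; have := integrableZl measurableT c L1f; apply: eq_integrable. Qed.

Lemma L1N f : L1 f -> L1 (fun x => - f x).
Proof. by move=> /(L1Z (-1)); apply: eq_integrable => // x _ /=; rewrite mulN1r. Qed.

Lemma L1_norm f : L1 f -> L1 (fun x => `|f x|).
Proof. by move=> L1f; have := integrable_norm L1f; apply: eq_integrable. Qed.

Lemma L1_0 : L1 (fun _ : 'rV[R]_n => 0 : R).
Proof. exact: integrable0. Qed.

Lemma L1_sum (I : Type) (r : seq I) (F : I -> 'rV[R]_n -> R) :
  (forall i, L1 (F i)) -> L1 (fun x => \sum_(i <- r) F i x).
Proof.
move=> L1F; elim: r => [|i r IH].
  by apply: eq_integrable L1_0 => // x _; rewrite /= big_nil.
have := L1D (L1F i) IH; apply: eq_integrable => // x _.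
by rewrite /= big_cons.
Qed.

Lemma L1_le f g : measurable_fun setT f -> L1 g -> (forall x, `|f x| <= g x) -> L1 f.
Proof.
move=> mf L1g fg; apply: le_integrable L1g => //; first exact/measurable_EFinP.
by move=> x _; rewrite /= lee_fin (le_trans (fg x))// ler_norm.
Qed.

Lemma L1_indic A : measurable A -> (mu A < +oo)%E -> L1 (\1_A : 'rV[R]_n -> R).
Proof.
move=> mA Aoo; apply/integrableP; split; first exact/measurable_EFinP/measurable_indic.
rewrite (eq_integral (fun x => (\1_A x)%:E)) => [|x _].
  by rewrite integral_indic// setIT.
by rewrite gee0_abs// lee_fin indicE.
Qed.

Lemma L1_bounded_support f A (C : R) : measurable_fun setT f -> measurable A ->
  (mu A < +oo)%E -> (forall x, `|f x| <= C) -> (forall x, ~ A x -> f x = 0) -> L1 f.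
Proof.
move=> mf mA Aoo fC fA; apply: (L1_le mf (L1Z C (L1_indic mA Aoo))) => x.
rewrite indicE; have [xA|/negP xA] := boolP (x \in A); first by rewrite mulr1.
by rewrite mulr0 fA ?normr0// => Ax; apply: xA; rewrite inE.
Qed.

Lemma L1_compact_support f K : continuous f -> compact K -> (forall x, ~ K x -> f x = 0) -> L1 f.
Proof.
move=> cf cK fK; have [C _ fC] := compact_support_bounded cK cf fK.
apply: (L1_bounded_support (A := K) (C := C)) => //.
- exact: measurable_rV_continuous.
- exact: measurable_rV_compact.
- exact: lebesgue_rV_compact.
Qed.

Definition dist1 f g : R := \int[mu]_x `|f x - g x|.

Lemma dist1_ge0 f g : 0 <= dist1 f g.
Proof. exact: Rintegral_ge0. Qed.

Lemma dist1C f g : dist1 f g = dist1 g f.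
Proof. by apply: eq_Rintegral => x _; rewrite distrC. Qed.

Lemma dist1_triangle f g h : L1 f -> L1 g -> L1 h -> dist1 f h <= dist1 f g + dist1 g h.
Proof.
move=> L1f L1g L1h; rewrite -RintegralD//; try exact/L1_norm/L1B.
apply: le_Rintegral => //; first exact/L1_norm/L1B.
  by apply: L1D; exact/L1_norm/L1B.
by move=> x _; rewrite -[X in `|X|](subrKA (g x)) ler_normD.
Qed.

Lemma dominated_dist1 (g_ : nat -> 'rV[R]_n -> R) g h :
  (forall m, measurable_fun setT (g_ m)) ->
  (forall x, g_ m x @[m --> \oo] --> g x) -> L1 h ->
  (forall m x, `|g_ m x| <= h x) ->
  [/\ L1 g, (forall m, L1 (g_ m)) & dist1 (g_ m) g @[m --> \oo] --> (0 : R)].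
Proof.
move=> mg gg L1h gh.
have mgE m : measurable_fun setT (EFin \o g_ m) by exact/measurable_EFinP.
have ggE x : setT x -> (g_ m x)%:E @[m --> \oo] --> (g x)%:E.
  by move=> _; apply: cvg_EFin; [exact: nearW|exact: gg].
have mG : measurable_fun setT (EFin \o g) by apply: (emeasurable_fun_cvg _ _ mgE ggE).
have [iG d0 _] := @dominated_convergence _ _ _ mu _ measurableT (fun m => EFin \o g_ m)
  (EFin \o g) (EFin \o h) mgE mG (aeW _ ggE) L1h (aeW _ (fun x m _ => gh m x)).
split => //; first by move=> m; exact: (L1_le (mg m) L1h).
exact/fine_cvg.
Qed.
End L1_toolkit.

(** * Density of continuous functions in L^1 *)

Section density.
Import HBSimple.
Context {R : realType} {n : nat}.
Local Notation mu := (@lebesgue_rV R n).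
Local Notation L1 f := (mu.-integrable setT (EFin \o f)).
Implicit Types (f g h : 'rV[R]_n -> R) (A K U Q : set 'rV[R]_n).

Lemma measurable_rV_openE : measurable = <<s @open 'rV[R]_n >>.
Proof.
apply/seteqP; split=> A; last first.
  apply: smallest_sub; first exact: sigma_algebra_measurable.
  exact: measurable_rV_open.
apply: smallest_sub; first exact: smallest_sigma_algebra.
rewrite -bigcup_seq; apply: bigcup_sub => i _ _ [Y mY <-]; rewrite setTI.
suff : (measurable : set (set R)) `<=`
    [set Y | <<s @open 'rV[R]_n >> ((fun x : 'rV[R]_n => x ord0 i) @^-1` Y)] by exact.
rewrite [X in X `<=` _](RGenOpens.measurableE R); apply: smallest_sub.
  have [S0 SD SU] := smallest_sigma_algebra setT (@open 'rV[R]_n).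
  split=> /=.
  - by rewrite preimage_set0.
  - by move=> B SB; rewrite setTD preimage_setC -setTD; exact: SD.
  - by move=> F SF; rewrite preimage_bigcup; exact: SU.
move=> _ [a [b ->]] /=; apply: sub_sigma_algebra.
by apply: open_comp; [move=> x _; exact: coord_continuous|exact: interval_open].
Qed.

Lemma compact_cube k : compact (@cube R n k).
Proof. by apply: rV_compact => i; exact: segment_compact. Qed.

Lemma cube_norm k (x : 'rV[R]_n) : `|x| <= k%:R -> cube k x.
Proof. by move=> xk i; rewrite /= in_itv/= -ler_norml (le_trans (ler_rV_norm _ _)). Qed.

(** For U = setT this is the infimum of the empty set, hence the hypothesis
    that the complement of U is nonempty in the lemmas on continuity and positivity. *)
Definition dist_compl U (x : 'rV[R]_n) : R := inf [set `|x - y| | y in ~` U].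

Lemma dist_compl_lip U x y : ~` U !=set0 ->
  dist_compl U x <= dist_compl U y + `|x - y|.
Proof.
move=> [z0 Uz0]; rewrite -lerBlDr; apply: lb_le_inf; first by exists `|y - z0|, z0.
move=> _ [z Uz <-]; rewrite lerBlDr.
apply: (@le_trans _ _ `|x - z|).
  apply: ge_inf; last by exists z.
  by exists 0 => _ [w _ <-].
by rewrite [leRHS]addrC -[x - z](subrKA y) ler_normD.
Qed.

Lemma dist_compl_ge0 U x : 0 <= dist_compl U x.
Proof.
rewrite /dist_compl; have [->|/set0P[z0 Uz0]] := eqVneq (~` U) set0.
  by rewrite image_set0 inf0.
by apply: lb_le_inf; [exists `|x - z0|, z0|move=> _ [w _ <-]].
Qed.

Lemma dist_compl_gt0 U x : open U -> U x -> ~` U !=set0 -> 0 < dist_compl U x.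
Proof.
move=> oU Ux [z0 Uz0]; have /nbhs_ballP[e /= e0 eU] := open_nbhs_nbhs (conj oU Ux).
apply: (lt_le_trans e0); apply: lb_le_inf; first by exists `|x - z0|, z0.
move=> _ [z Uz <-]; rewrite leNgt; apply/negP => xz; apply: Uz; apply: eU.
by rewrite -ball_normE.
Qed.

Lemma dist_compl_out U x : ~ U x -> dist_compl U x = 0.
Proof.
move=> Ux; apply/eqP; rewrite eq_le dist_compl_ge0 andbT.
apply: ge_inf; first by exists 0 => _ [w _ <-].
by exists x => //; rewrite subrr normr0.
Qed.

Lemma continuous_dist_compl U : ~` U !=set0 -> continuous (dist_compl U).
Proof.
move=> U0 x; apply/continuous_atP => e e0; exists e => // y yx.
apply: le_lt_trans yx; have := dist_compl_lip x y U0; have := dist_compl_lip y x U0.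
rewrite (distrC x y) ler_norml; move: (`|y - x|) (dist_compl U x) (dist_compl U y) => a b c h1 h2.
by apply/andP; split; lra.
Qed.

(** The class of integrable functions which are limits in L^1 of continuous
    functions with compact support. *)
Definition Cc_approx f := L1 f /\ forall e, 0 < e -> exists psi,
  [/\ continuous psi, (exists2 K, compact K & forall x, ~ K x -> psi x = 0) &
      dist1 f psi <= e].

Lemma Cc_L1 psi : continuous psi -> (exists2 K, compact K & forall x, ~ K x -> psi x = 0) ->
  L1 psi.
Proof. by move=> cpsi [K cK psiK]; exact: L1_compact_support cpsi cK psiK. Qed.

Lemma Cc_approx_lim (f_ : nat -> 'rV[R]_n -> R) f : L1 f -> (forall m, Cc_approx (f_ m)) ->
  dist1 (f_ m) f @[m --> \oo] --> (0 : R) -> Cc_approx f.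
Proof.
move=> L1f cf f0; split => // e e0; have e20 : 0 < e / 2 by rewrite divr_gt0.
have /cvgr0Pnorm_lt /(_ _ e20) [N _ /(_ N (leqnn N)) /= NP] := f0.
have [L1N /(_ _ e20) [psi [cpsi sK d1]]] := cf N.
exists psi; split => //; have L1psi := Cc_L1 cpsi sK.
rewrite (le_trans (dist1_triangle L1f L1N L1psi))// (splitr e) lerD//.
by rewrite dist1C (le_trans (ler_norm _))// ltW.
Qed.

Lemma Cc_approxD f g : Cc_approx f -> Cc_approx g -> Cc_approx (fun x => f x + g x).
Proof.
move=> [L1f cf] [L1g cg]; split => [|e e0]; first exact: L1D.
have e20 : 0 < e / 2 by rewrite divr_gt0.
have [p [cp sp dp]] := cf _ e20; have [q [cq sq dq]] := cg _ e20.
have L1p := Cc_L1 cp sp; have L1q := Cc_L1 cq sq.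
exists (fun x => p x + q x); split.
- by move=> x; apply: (@cvgD _ _ _ (nbhs x) _ p q); [exact: cp|exact: cq].
- case: sp => K cK pK; case: sq => L cL qL; exists (K `|` L); first exact: compactU.
  by move=> x /not_orP[xK xL]; rewrite pK// qL// addr0.
- rewrite (splitr e) (le_trans _ (lerD dp dq))// /dist1 -RintegralD//; try exact/L1_norm/L1B.
  apply: le_Rintegral => //; first by apply/L1_norm/L1B; exact: L1D.
    by apply: L1D; exact/L1_norm/L1B.
  by move=> x _; rewrite opprD addrACA ler_normD.
Qed.

Lemma Cc_approxZ c f : Cc_approx f -> Cc_approx (fun x => c * f x).
Proof.
move=> [L1f cf]; split => [|e e0]; first exact: L1Z.
have c1 : 0 < `|c| + 1 by rewrite ltr_pwDr.
have [p [cp sp dp]] := cf _ (divr_gt0 e0 c1); have L1p := Cc_L1 cp sp.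
exists (fun x => c * p x); split.
- by move=> x; apply: (@cvgM _ _ (nbhs x) _ (cst c) p); [exact: cvg_cst|exact: cp].
- by case: sp => K cK pK; exists K => // x /pK ->; rewrite mulr0.
- rewrite /dist1; under eq_Rintegral do rewrite -mulrBr normrM.
  rewrite RintegralZl//; last exact/L1_norm/L1B.
  rewrite (@le_trans _ _ ((`|c| + 1) * dist1 f p))//.
    by rewrite ler_wpM2r ?dist1_ge0// lerDl.
  by rewrite mulrC -ler_pdivlMr.
Qed.

Lemma Cc_approx0 : Cc_approx (fun=> 0).
Proof.
split=> [|e e0]; first exact: L1_0.
exists (fun=> 0); split; first exact: cst_continuous.
  by exists set0 => //; exact: compact0.
by rewrite /dist1; under eq_Rintegral do rewrite subrr normr0; rewrite Rintegral_cst ?mul0r ?ltW.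
Qed.

Lemma Cc_approx_sum (I : Type) (r : seq I) (F : I -> 'rV[R]_n -> R) :
  (forall i, Cc_approx (F i)) -> Cc_approx (fun x => \sum_(i <- r) F i x).
Proof.
move=> cF; elim: r => [|i r IH].
  by rewrite (_ : (fun _ => _) = fun=> 0); [exact: Cc_approx0|apply/funext => x; rewrite big_nil].
rewrite (_ : (fun _ => _) = fun x => F i x + \sum_(j <- r) F j x); first exact: Cc_approxD.
by apply/funext => x; rewrite big_cons.
Qed.

(** The indicator of U is the limit of min (1, m dist (x, R^n - U)) as m grows. *)
Lemma Cc_approx_open U (M : R) : open U -> (forall x, U x -> `|x| <= M) ->
  ~` U !=set0 -> Cc_approx \1_U.
Proof.
move=> oU UM U0.
pose psi (m : nat) x : R := Num.min 1 (m%:R * dist_compl U x).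
have cpsi m : continuous (psi m).
  move=> x; apply: (@continuous_min _ _ (cst 1) (fun x => m%:R * dist_compl U x) x).
    exact: cst_continuous.
  apply: (@cvgM _ _ (nbhs x) _ (cst m%:R) (dist_compl U)); first exact: cvg_cst.
  exact: continuous_dist_compl.
have psi0 m x : ~ U x -> psi m x = 0.
  by move=> /dist_compl_out h; rewrite /psi h mulr0; apply/min_idPr.
have mU : measurable U by exact: measurable_rV_open.
have L1U : L1 (\1_U : 'rV[R]_n -> R) by apply: L1_indic => //; exact: lebesgue_rV_bounded UM.
have psiU m x : `|psi m x| <= \1_U x.
  rewrite indicE; have [xU|/negP xU] := boolP (x \in U); last first.
    by rewrite psi0 ?normr0// => Ux; apply: xU; rewrite inE.
  rewrite ger0_norm; first by rewrite ge_min lexx.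
  by rewrite le_min ler01 mulr_ge0// dist_compl_ge0.
have mpsi m : measurable_fun setT (psi m).
  by apply: measurable_rV_continuous; exact: cpsi.
have lpsi x : psi m x @[m --> \oo] --> (\1_U x : R).
  rewrite indicE.
  have [xU|/negP xU] := boolP (x \in U); last first.
    have xU' : ~ U x by move=> Ux; apply: xU; rewrite inE.
    by under eq_fun do rewrite (psi0 _ _ xU'); exact: cvg_cst.
  have dx : 0 < dist_compl U x by apply: dist_compl_gt0 => //; exact: set_mem.
  apply: (@cvg_near_cst _ _ _ _ _).
  exists (Num.truncn (dist_compl U x)^-1).+1 => // m /= Nm.
  apply/min_idPl; rewrite -ler_pdivrMr// div1r (le_trans (ltW (truncnS_gt _)))//.
  by rewrite ler_nat.
have [_ _ d0] := dominated_dist1 mpsi lpsi L1U psiU.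
apply: Cc_approx_lim d0 => // m.
pose K : set 'rV[R]_n := cube (Num.truncn M).+1.
have cK : compact K by exact: compact_cube.
have psiK x : ~ K x -> psi m x = 0.
  move=> xK; apply: psi0 => Ux; apply: xK; apply: cube_norm.
  by rewrite (le_trans (UM _ Ux))// ltW// truncnS_gt.
split; first exact: (L1_compact_support (cpsi m) cK psiK).
move=> e e0; exists (psi m); split => //; first by exists K.
by rewrite /dist1; under eq_Rintegral do rewrite subrr normr0; rewrite Rintegral_cst ?mul0r ?ltW.
Qed.

Lemma open_ball0 (k : nat) : open [set x : 'rV[R]_n | `|x| < k.+1%:R].
Proof.
rewrite (_ : [set x | _] = ball (0 : 'rV[R]_n) (k.+1%:R : R)); first exact: ball_open.
by apply/seteqP; split=> x /=; rewrite -ball_normE/= sub0r normrN.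
Qed.

(** By the pi-lambda theorem: the sets A for which the claim holds form a Dynkin
    class containing the open sets.  The intersection with a ball keeps all
    indicators integrable. *)
Lemma Cc_approx_indic (k : nat) A : (0 < n)%N -> measurable A ->
  Cc_approx \1_(A `&` [set x | `|x| < k.+1%:R]).
Proof.
move=> n0 mA; set Q := [set x | _].
have oQ : open Q by exact: open_ball0.
have mQ : measurable Q by exact: measurable_rV_open.
have Qk : ~` Q !=set0.
  exists (const_mx k.+1%:R) => /=; apply/negP; rewrite -leNgt.
  apply: le_trans (ler_rV_norm _ (Ordinal n0)); by rewrite mxE ger0_norm.
have QU U : open U -> Cc_approx \1_(U `&` Q).
  move=> oU; apply: (@Cc_approx_open _ k.+1%:R); first exact: openI.
    by move=> x [_ /ltW].
  by case: Qk => x Qx; exists x => -[].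
have L1Q : L1 (\1_Q : 'rV[R]_n -> R).
  by apply: L1_indic => //; apply: (lebesgue_rV_bounded mQ) => x /ltW; exact.
have {mA} : <<s @open 'rV[R]_n >> A by rewrite -measurable_rV_openE.
apply: (dynkin_induction (P := fun A => Cc_approx \1_(A `&` Q)) measurable_rV_openE) => //.
- by move=> U V oU oV; exact: openI.
- by apply: QU; exact: openT.
- move=> B mB cB.
  rewrite (_ : \1__ = fun x => \1_([set: 'rV[R]_n] `&` Q) x + -1 * \1_(B `&` Q) x).
    by apply: Cc_approxD; [apply: QU; exact: openT|exact: Cc_approxZ].
  apply/funext => x; rewrite !indicE !in_setI in_setC in_setT/=.
  by case: (x \in B); case: (x \in Q) => /=; ring.
- move=> F mF tF cF.
  pose s (m : nat) (x : 'rV[R]_n) : R := \sum_(j <- iota 0 m) \1_(F j `&` Q) x.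
  have ms m : measurable_fun setT (s m).
    by apply: measurable_sum => j; apply: measurable_indic; exact: measurableI.
  have sE m x j : F j x -> s m x = (j < m)%N%:R * \1_Q x.
    move=> Fx; rewrite /s; have [jm|jm] := ltnP j m.
      rewrite (big_rem j)/= ?mem_iota// big_seq big1.
        by rewrite addr0 mul1r !indicE in_setI mem_set.
      move=> i; rewrite mem_rem_uniq ?iota_uniq// inE => /andP[ij _].
      rewrite indicE memNset// => -[Fix _]; move: ij; apply/negP/negPn/eqP.
      by apply: tF => //; exists x.
    rewrite mul0r big_seq big1// => i; rewrite mem_iota/= add0n => im.
    rewrite indicE memNset// => -[Fix _].
    have ij : i = j by apply: tF => //; exists x.
    by move: im; rewrite ij ltnNge jm.
  have s0 m x : ~ (\bigcup_j F j) x -> s m x = 0.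
    move=> nF; rewrite /s big1// => i _; rewrite indicE memNset// => -[Fx _].
    by apply: nF; exists i.
  have sQ m x : `|s m x| <= \1_Q x.
    have [[j _ Fx]|/s0 ->] := pselect ((\bigcup_j F j) x).
      by rewrite (sE _ _ _ Fx) indicE; case: ltnP; case: (x \in Q); rewrite /= ?mul1r ?mul0r ?normr1 ?normr0.
    by rewrite normr0 indicE.
  have ls x : s m x @[m --> \oo] --> (\1_((\bigcup_j F j) `&` Q) x : R).
    have [[j _ Fx]|nF] := pselect ((\bigcup_j F j) x).
      apply: cvg_near_cst; exists j.+1 => // m /= jm.
      rewrite (sE _ _ _ Fx) jm mul1r !indicE in_setI [X in X && _]mem_set//.
      by exists j.
    rewrite indicE memNset; last by case.
    by under eq_fun do rewrite (s0 _ _ nF); exact: cvg_cst.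
  have [L1F _ d0] := dominated_dist1 ms ls L1Q sQ.
  by apply: Cc_approx_lim d0 => // m; exact: Cc_approx_sum.
Qed.

(** Simple functions are dense in L^1, and the indicators of their level sets are
    covered by [Cc_approx_indic] after truncation to balls. *)
Lemma Cc_dense f : (0 < n)%N -> L1 f -> Cc_approx f.
Proof.
move=> n0 L1f.
pose Q (k : nat) : set 'rV[R]_n := [set x | `|x| < k.+1%:R].
have mQ k : measurable (Q k) by apply: measurable_rV_open; exact: open_ball0.
have [g [L1g _ gf]] := approximation_sfun_integrable measurableT L1f.
have cg m : Cc_approx (g m).
  pose h (k : nat) x : R := g m x * \1_(Q k) x.
  have mh k : measurable_fun setT (h k).
    by apply: measurable_funM; [exact: measurable_funP|exact: measurable_indic].
  have lh x : h k x @[k --> \oo] --> (g m x : R).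
    apply: cvg_near_cst; exists (Num.truncn `|x|) => // k /= xk.
    rewrite /h indicE mem_set ?mulr1//; rewrite /Q/= (lt_le_trans (truncnS_gt _))//.
    by rewrite ler_nat ltnS.
  have hb k x : `|h k x| <= `|g m x|.
    by rewrite /h indicE; case: (x \in Q k); rewrite ?mulr1 ?mulr0 ?normr0.
  have [_ _ d0] := dominated_dist1 mh lh (L1_norm (L1g m)) hb.
  apply: Cc_approx_lim d0 => // k.
  have [N [c cE]] : exists N (c : 'I_N -> R), forall x,
      g m x = \sum_(i < N) c i * \1_(g m @^-1` [set c i]) x.
    by eexists; exists (fun i => (finmap.enum_fset (fset_set (range (g m))))`_i) => x; exact: fimfunEord.
  rewrite (_ : h k = fun x => \sum_(i < N) c i * \1_(g m @^-1` [set c i] `&` Q k) x).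
    by apply: Cc_approx_sum => i; apply: Cc_approxZ; exact: Cc_approx_indic.
  apply/funext => x; rewrite /h cE mulr_suml; apply: eq_bigr => i _.
  by rewrite -mulrA; congr (_ * _); rewrite !indicE in_setI -mulnb natrM.
apply: (Cc_approx_lim L1f cg).
have : dist1 f (g m) @[m --> \oo] --> (0 : R) by exact: fine_cvg gf.
by under eq_fun do rewrite dist1C.
Qed.

End density.

(** * Mollification *)

Section mollifier.
Context {R : realType} {n : nat}.
Local Notation mu := (@lebesgue_rV R n).
Local Notation L1 f := (mu.-integrable setT (EFin \o f)).
Implicit Types (f g h k : 'rV[R]_n -> R) (K : set 'rV[R]_n) (d : R) (x y z : 'rV[R]_n).

(** The index of the undifferentiated bump exp (- 1 / (t (1 - t))). *)
Definition base_index : 'I_n -> {poly R} * nat := fun=> (1, 0%N).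

Lemma bump1_ge0 t : 0 <= bump1 1 0 t :> R.
Proof. by rewrite /bump1; case: ifP => // _; rewrite /bump_rat hornerC expr0 invr1 !mul1r expR_ge0. Qed.

Lemma bump1_le1 t : bump1 1 0 t <= 1 :> R.
Proof.
rewrite /bump1; case: ifPn => // /andP[t0 t1].
rewrite /bump_rat hornerC expr0 invr1 !mul1r -[leRHS]expR0 ler_expR oppr_le0 invr_ge0.
by rewrite mulr_ge0 ?subr_ge0// ltW.
Qed.

Lemma bump1_ge t : 1 / 4 <= t <= 3 / 4 -> expR (- 6) <= bump1 1 0 t :> R.
Proof.
move=> /andP[t0 t1]; rewrite /bump1 ifT; last by apply/andP; split; lra.
rewrite /bump_rat hornerC expr0 invr1 !mul1r ler_expR lerN2.
have q : 1 / 6 <= t * (1 - t) by nra.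
rewrite -[leRHS]invrK lef_pV2 ?posrE; [lra|lra|lra].
Qed.

Lemma kern_base_ge0 c d z : 0 <= c -> 0 <= kern c d base_index z.
Proof. by move=> c0; rewrite mulr_ge0// prodr_ge0// => i _; exact: bump1_ge0. Qed.

Lemma kern_base_le c d z : 0 <= c -> kern c d base_index z <= c.
Proof.
move=> c0; rewrite /kern ler_piMr//.
by apply: prodr_ile1 => i _; rewrite bump1_ge0 bump1_le1.
Qed.

Lemma measurable_kern c d s : measurable_fun setT (@kern R n c d s).
Proof. apply: measurable_rV_continuous; exact: continuous_kern. Qed.

Lemma L1_kern c d s : 0 < d -> L1 (@kern R n c d s).
Proof.
move=> d0; apply: (L1_compact_support (K := corner_box d)).
- exact: continuous_kern.
- exact: compact_corner_box.
- by move=> z; exact: kern_out_box.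
Qed.

Definition mass d : R := \int[mu]_z kern 1 d base_index z.

Definition mass_lb : R := expR (- 6) / 2.

Lemma mass_lb_gt0 : 0 < mass_lb.
Proof. by rewrite divr_gt0// expR_gt0. Qed.

(** On the middle half of each side of the cube the one-dimensional bump is at
    least exp (- 6), since t (1 - t) >= 3 / 16 > 1 / 6 there.  The resulting
    bound O(d^-n) for the mollifier enters [moll_modular]. *)
Lemma mass_ge d : 0 < d -> (mass_lb * d) ^+ n <= mass d.
Proof.
move=> d0.
pose Q : set 'rV[R]_n := box (fun=> [set` `[d / 4, 3 * d / 4]]).
have mQ : measurable Q by apply: measurable_box.
have muQ : mu Q = ((d / 2) ^+ n)%:E.
  rewrite lebesgue_rV_box//.
  under eq_bigr do rewrite lebesgue_measure_itv/= lte_fin.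
  rewrite ifT; last lra.
  under eq_bigr do rewrite -EFinB.
  rewrite prodEFin prodr_const card_ord; congr ((_ ^+ _)%:E); lra.
have L1Q : L1 (\1_Q : 'rV[R]_n -> R) by apply: L1_indic => //; rewrite muQ ltry.
have -> : (mass_lb * d) ^+ n = \int[mu]_z (expR (- 6) ^+ n * \1_Q z).
  have IQ : \int[mu]_z (\1_Q z : R) = (d / 2) ^+ n.
    by rewrite /Rintegral integral_indic// setIT; exact: (congr1 fine muQ).
  rewrite RintegralZl// IQ -exprMn.
  by rewrite /mass_lb mulrAC mulrA.
apply: le_Rintegral => //; first exact: L1Z.
  exact: L1_kern.
move=> z _; rewrite indicE; have [zQ|_] := boolP (z \in Q); last by rewrite mulr0 kern_base_ge0.
rewrite mulr1 /kern mul1r -[X in _ ^+ X]card_ord -prodr_const ler_prod// => i _.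
rewrite expR_ge0 bump1_ge//; move: zQ; rewrite inE => /(_ i); rewrite /= in_itv/=.
move=> /andP[z1 z2]; rewrite ler_pdivlMr// ler_pdivrMr//; apply/andP; split; lra.
Qed.

Lemma mass_gt0 d : 0 < d -> 0 < mass d.
Proof.
by move=> d0; apply: lt_le_trans (mass_ge d0); rewrite exprn_gt0// mulr_gt0// mass_lb_gt0.
Qed.

Definition mollifier d : 'rV[R]_n -> R := kern (mass d)^-1 d base_index.

Lemma mollifier_ge0 d z : 0 < d -> 0 <= mollifier d z.
Proof. by move=> d0; rewrite kern_base_ge0// invr_ge0 ltW// mass_gt0. Qed.

Lemma mollifier_le d z : 0 < d -> mollifier d z <= (mass_lb * d) ^- n.
Proof.
move=> d0; rewrite (le_trans (kern_base_le _ _ _))// ?invr_ge0 ?(ltW (mass_gt0 _))//.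
by rewrite lef_pV2 ?posrE ?mass_gt0// ?mass_ge// exprn_gt0// mulr_gt0// mass_lb_gt0.
Qed.

Lemma L1_mollifier d : 0 < d -> L1 (mollifier d).
Proof. exact: L1_kern. Qed.

Lemma mollifier_integral d : 0 < d -> \int[mu]_z mollifier d z = 1.
Proof.
move=> d0; rewrite /mollifier.
rewrite (_ : kern (mass d)^-1 d base_index = fun z => (mass d)^-1 * kern 1 d base_index z).
  by rewrite RintegralZl ?mulVf ?gt_eqF ?mass_gt0//; exact: L1_kern.
by apply/funext => z; rewrite /kern mul1r.
Qed.

Lemma mollifier_out d z : 0 < d -> ~ corner_box d z -> mollifier d z = 0.
Proof. exact: kern_out_box. Qed.

Lemma corner_box_norm d z : 0 < d -> corner_box d z -> `|z| <= d.
Proof.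
move=> d0 zd; apply: rV_norm_ler => [|i]; first exact: ltW.
by have := zd i; rewrite /= in_itv/= => /andP[z0 zd']; rewrite ger0_norm.
Qed.

Lemma mollE k f x : measurable_fun setT f -> measurable_fun setT k ->
  moll k f x = \int[mu]_z (f (z + x) * k z).
Proof.
move=> mf mk; rewrite /moll -(Rintegral_translate x (f := fun y => f y * k (y - x))).
  by apply: eq_Rintegral => z _; rewrite addrK.
by apply: measurable_funM => //; exact: measurable_sub_comp.
Qed.

Lemma mollifier_bounded d z : 0 < d -> `|mollifier d z| <= (mass_lb * d) ^- n.
Proof. by move=> d0; rewrite ger0_norm ?mollifier_ge0// mollifier_le. Qed.

Lemma measurable_mollifier d : measurable_fun setT (mollifier d).
Proof. exact: measurable_kern. Qed.

Lemma L1_mollM d f x : 0 < d -> L1 f -> L1 (fun y => f y * mollifier d (y - x)).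
Proof.
move=> d0 L1f; apply: (@L1_mul_bounded _ _ f (fun y => mollifier d (y - x)) ((mass_lb * d) ^- n)) => //.
  by apply: measurable_sub_comp; exact: measurable_mollifier.
by move=> z; exact: mollifier_bounded.
Qed.

Lemma L1_mollM_translate d f x : 0 < d -> L1 f -> L1 (fun z => f (z + x) * mollifier d z).
Proof.
move=> d0 L1f; apply: (@L1_mul_bounded _ _ (fun y => f (y + x)) (mollifier d) ((mass_lb * d) ^- n)).
- exact: integrable_translate.
- exact: measurable_mollifier.
- by move=> z; exact: mollifier_bounded.
Qed.

Lemma mollB d f g x : 0 < d -> L1 f -> L1 g ->
  moll (mollifier d) (fun y => f y - g y) x = moll (mollifier d) f x - moll (mollifier d) g x.
Proof.
move=> d0 L1f L1g; rewrite /moll -RintegralB//; [|exact: L1_mollM..].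
by apply: eq_Rintegral => y _; rewrite mulrBl.
Qed.

(** A mollification is an average with respect to a probability density
    supported in x + [0, d]^n. *)
Lemma moll_close d f x (a e : R) : 0 < d -> L1 f ->
  (forall z, corner_box d z -> `|f (z + x) - a| <= e) -> `|moll (mollifier d) f x - a| <= e.
Proof.
move=> d0 L1f fa.
have mf := L1_measurable L1f.
have L1m c : L1 (fun z => c * mollifier d z : R) by apply: L1Z; exact: L1_mollifier.
rewrite mollE//; last exact: measurable_mollifier.
have -> : a = \int[mu]_z (a * mollifier d z).
  by rewrite RintegralZl ?mollifier_integral ?mulr1//; exact: L1_mollifier.
rewrite -RintegralB//; last exact: L1_mollM_translate.
have L1B' := L1B (L1_mollM_translate x d0 L1f) (L1m a).
rewrite (le_trans (le_normr_Rintegral _ _))//.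
have -> : e = \int[mu]_z (e * mollifier d z).
  by rewrite RintegralZl ?mollifier_integral ?mulr1//; exact: L1_mollifier.
apply: le_Rintegral => //; first exact: L1_norm.
move=> z _; rewrite -mulrBl normrM [X in _ * X]ger0_norm ?mollifier_ge0//.
have [zd|/(mollifier_out d0) ->] := pselect (corner_box d z); last by rewrite !mulr0.
by rewrite ler_wpM2r ?mollifier_ge0// fa.
Qed.

Lemma continuous_moll_mollifier d f : 0 < d -> L1 f -> continuous (moll (mollifier d) f).
Proof.
move=> d0 L1f; apply: (continuous_moll (C := (mass_lb * d) ^- n)) => //.
- exact: measurable_mollifier.
- by move=> z; exact: mollifier_bounded.
- exact: kern_unif_continuous.
Qed.

Lemma normr_moll_le d f x : 0 < d -> L1 f ->
  `|moll (mollifier d) f x| <= moll (mollifier d) (fun y => `|f y|) x.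
Proof.
move=> d0 L1f; rewrite (le_trans (le_normr_Rintegral _ _))//; first exact: L1_mollM.
apply: le_Rintegral => //; first exact/L1_norm/L1_mollM.
  by apply: L1_mollM => //; exact: L1_norm.
by move=> y _; rewrite normrM [X in _ * X]ger0_norm ?mollifier_ge0.
Qed.

(** Mollification contracts the L^1 norm, by Tonelli's theorem and translation
    invariance. *)
Lemma moll_L1 d f : 0 < d -> L1 f ->
  L1 (moll (mollifier d) f) /\ \int[mu]_x `|moll (mollifier d) f x| <= \int[mu]_x `|f x|.
Proof.
move=> d0 L1f; have mf := L1_measurable L1f.
have mm : measurable_fun setT (moll (mollifier d) f).
  by apply: measurable_rV_continuous; exact: continuous_moll_mollifier.
pose F (xz : 'rV[R]_n * 'rV[R]_n) : \bar R := (`|f (xz.2 + xz.1)| * mollifier d xz.2)%:E.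
have mF : measurable_fun setT F.
  apply/measurable_EFinP; apply: measurable_funM.
    apply: measurableT_comp => //; apply: (measurableT_comp mf).
    apply: measurable_fun_rV => i; under eq_fun do rewrite mxE.
    apply: measurable_funD.
      exact: (measurableT_comp (measurable_rVcoord i) measurable_snd).
    exact: (measurableT_comp (measurable_rVcoord i) measurable_fst).
  exact: (measurableT_comp (measurable_mollifier d) measurable_snd).
have F0 xz : (0 <= F xz)%E by rewrite lee_fin mulr_ge0// mollifier_ge0.
have key : (\int[mu]_x `|(moll (mollifier d) f x)%:E| <= \int[mu]_x `|(f x)%:E|)%E.
  apply: (@le_trans _ _ (\int[mu]_x \int[mu]_z F (x, z))%E).
    apply: ge0_le_integral => //.
    - by apply/measurable_EFinP; exact: measurableT_comp.
    - exact: (measurable_fun_fubini_tonelli_F (m2 := mu)).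
    move=> x _.
    have L1x : L1 (fun z => `|f (z + x)| * mollifier d z).
      by apply: (@L1_mollM_translate d (fun y => `|f y|)) => //; exact: L1_norm.
    have -> : (\int[mu]_z F (x, z) = (\int[mu]_z (`|f (z + x)| * mollifier d z))%:E)%E.
      by rewrite /Rintegral fineK//; exact: integrable_fin_num.
    rewrite lee_fin (le_trans (normr_moll_le _ _ _))// mollE//.
      exact: measurableT_comp.
    exact: measurable_mollifier.
  rewrite (fubini_tonelli F mF F0).
  have E z : (\int[mu]_x F (x, z) = (mollifier d z)%:E * \int[mu]_x `|(f x)%:E|)%E.
    rewrite -(integral_translate z (f := fun x => `|(f x)%:E|%E)); last first.
      by apply: measurableT_comp => //; exact/measurable_EFinP.
    rewrite -ge0_integralZl//.
    - by apply: eq_integral => x _; rewrite /F/= [z + x]addrC mulrC EFinM.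
    - apply: measurableT_comp => //; apply/measurable_EFinP.
      exact: (measurableT_comp mf (measurable_rV_translate z)).
    - by rewrite lee_fin mollifier_ge0.
  under eq_integral do rewrite E.
  rewrite ge0_integralZr//.
  - rewrite (_ : (\int[mu]_z (mollifier d z)%:E)%E = 1%E) ?mul1e//.
    rewrite -(fineK (integrable_fin_num measurableT (L1_mollifier d0))).
    by congr EFin; exact: mollifier_integral.
  - by apply/measurable_EFinP; exact: measurable_mollifier.
  - by move=> z _; rewrite lee_fin mollifier_ge0.
  - exact: integral_ge0.
have foo : (\int[mu]_x `|(f x)%:E| < +oo)%E by case/integrableP: L1f.
have L1m : L1 (moll (mollifier d) f).
  by apply/integrableP; split; [exact/measurable_EFinP|exact: le_lt_trans key foo].
split => //; rewrite /Rintegral fine_le//.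
  by rewrite ge0_fin_numE ?integral_ge0//; exact: le_lt_trans key foo.
by rewrite ge0_fin_numE ?integral_ge0.
Qed.

(** Uniform continuity gives the claim for continuous functions with compact
    support; these are dense, and mollification is a contraction. *)
Lemma moll_cvg1 f e : (0 < n)%N -> L1 f -> 0 < e -> exists2 d0 : R, 0 < d0 &
  forall d, 0 < d < d0 -> dist1 (moll (mollifier d) f) f <= e.
Proof.
move=> n0 L1f e0; have e40 : 0 < e / 4 by rewrite divr_gt0.
have [_ /(_ _ e40) [psi [cpsi [K cK psiK] dpsi]]] := Cc_dense n0 L1f.
have L1p : L1 psi by exact: L1_compact_support cpsi cK psiK.
have [M [_ MK]] := compact_bounded cK.
pose k := (Num.truncn (`|M| + 3)).+1.
have L1k : L1 (\1_(cube k) : 'rV[R]_n -> R).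
  apply: L1_indic; first by apply: measurable_box => i.
  exact: lebesgue_rV_cube.
pose m := \int[mu]_x (\1_(cube k) x : R).
have m0 : 0 <= m by apply: Rintegral_ge0 => x _; rewrite indicE.
have m1 : 0 < 2 * (m + 1) by rewrite mulr_gt0// ltr_pwDr.
have [t t0 tP] := compact_support_unif_continuous cK cpsi psiK (divr_gt0 e0 m1).
have outk x : ~ cube k x -> `|M| + 2 < `|x|.
  move=> xk; rewrite ltNge; apply/negP => xM; apply: xk; apply: cube_norm.
  by rewrite (le_trans xM)// (le_trans _ (ltW (truncnS_gt _)))// lerD2l; lra.
have psi_out x : `|M| + 1 < `|x| -> psi x = 0.
  move=> xM; apply: psiK => Kx; have : `|x| <= `|M| + 1.
    by apply: (MK (`|M| + 1)) => //; rewrite ltr_pwDr// ler_norm.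
  by rewrite leNgt xM.
exists (Num.min t 1); first by rewrite lt_min t0 ltr01.
move=> d /andP[d0]; rewrite lt_min => /andP[dt d1].
have [L1mf _] := moll_L1 d0 L1f; have [L1mp _] := moll_L1 d0 L1p.
have h1 : dist1 (moll (mollifier d) f) (moll (mollifier d) psi) <= e / 4.
  apply: le_trans dpsi; have [_ H] := moll_L1 d0 (L1B L1f L1p).
  by apply: le_trans H; rewrite /dist1; under eq_Rintegral do rewrite -mollB//.
have h2 : dist1 (moll (mollifier d) psi) psi <= e / 2.
  apply: (@le_trans _ _ (\int[mu]_x (e / (2 * (m + 1)) * \1_(cube k) x))).
    apply: le_Rintegral => //; [exact/L1_norm/L1B|exact: L1Z|move=> x _].
    rewrite indicE; have [xk|/negP xk] := boolP (x \in cube k).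
      rewrite mulr1; apply: moll_close => // z zd; apply/ltW/tP.
      by rewrite addrK (le_lt_trans (corner_box_norm d0 zd)).
    rewrite mulr0; have xM : `|M| + 2 < `|x| by apply: outk => xk'; apply: xk; rewrite inE.
    rewrite (psi_out x) ?(lt_trans _ xM) ?ltrD2l ?ltr1n//; apply: moll_close => // z zd.
    rewrite psi_out ?subrr ?normr0//.
    have := corner_box_norm d0 zd; have := ler_normB (z + x) z.
    by rewrite [z + x]addrC addrK; lra.
  rewrite RintegralZl// -/m invfM -!mulrA ler_pM2l// ler_piMr ?invr_ge0// mulrC ler_pdivrMr ?mul1r ?lerDl ?ltr_pwDr//.
rewrite (le_trans (dist1_triangle L1mf L1mp L1f))//.
have h3 := le_trans (dist1_triangle L1mp L1p L1f) (lerD h2 (le_refl _)).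
by rewrite dist1C in dpsi; lra.
Qed.

End mollifier.

(** * Functions of class C^1 *)

Lemma near_continuous (T U : topologicalType) (f h : T -> U) (x : T) :
  (\near x, f x = h x) -> {for x, continuous f} -> {for x, continuous h}.
Proof.
move=> fh cf; have E : f x = h x by exact: (nbhs_singleton fh).
have : f y @[y --> x] --> h x by rewrite -E.
by apply: cvg_trans; apply: near_eq_cvg; apply: filterS fh => y ->.
Qed.

Section C1_calculus.
Context {R : realType} {n : nat}.
Implicit Types (f h : 'rV[R]_n -> R) (df dh : 'I_n -> 'rV[R]_n -> R) (O K : set 'rV[R]_n).

(** The candidate df for the gradient is carried along explicitly, so that
    gradients are computed by the calculus rules below without differentiability
    side conditions. *)
Definition C1on O f df := forall x, O x ->
  [/\ {for x, continuous f},
      forall i, is_derive x (delta_mx ord0 i) f (df i x) &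
      forall i, {for x, continuous (df i)}].

Lemma C1onS O O' f df : O `<=` O' -> C1on O' f df -> C1on O f df.
Proof. by move=> OO' cf x /OO' /cf. Qed.

Lemma C1on_cst O (c : R) : C1on O (fun=> c) (fun _ _ => 0).
Proof.
move=> x _; split; first exact: cst_continuous.
  by move=> i; exact: is_derive_cst.
by move=> i; exact: cst_continuous.
Qed.

Lemma C1onD O f df h dh : C1on O f df -> C1on O h dh ->
  C1on O (fun x => f x + h x) (fun i x => df i x + dh i x).
Proof.
move=> cf ch x Ox; have [f1 f2 f3] := cf x Ox; have [h1 h2 h3] := ch x Ox; split.
- exact: (@continuousD _ _ _ f h).
- by move=> i; exact: (is_deriveD (f := f) (g := h)).
- by move=> i; exact: (@continuousD _ _ _ (df i) (dh i)).
Qed.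

Lemma C1onM O f df h dh : C1on O f df -> C1on O h dh ->
  C1on O (fun x => f x * h x) (fun i x => f x * dh i x + h x * df i x).
Proof.
move=> cf ch x Ox; have [f1 f2 f3] := cf x Ox; have [h1 h2 h3] := ch x Ox; split.
- exact: (@continuousM _ _ f h).
- by move=> i; exact: (is_deriveM (f := f) (g := h)).
- move=> i; apply: (@continuousD _ _ _ (fun x => f x * dh i x) (fun x => h x * df i x)).
    exact: (@continuousM _ _ f (dh i)).
  exact: (@continuousM _ _ h (df i)).
Qed.

Lemma C1onZ O c f df : C1on O f df -> C1on O (fun x => c * f x) (fun i x => c * df i x).
Proof.
move=> cf x Ox; have [f1 f2 f3] := cf x Ox; split.
- by apply: (@continuousM _ _ (cst c) f) => //; exact: cst_continuous.
- by move=> i; exact: (is_deriveZ (f := f)).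
- by move=> i; apply: (@continuousM _ _ (cst c) (df i)) => //; exact: cst_continuous.
Qed.

Lemma C1onB O f df h dh : C1on O f df -> C1on O h dh ->
  C1on O (fun x => f x - h x) (fun i x => df i x - dh i x).
Proof.
move=> cf ch x Ox; have [f1 f2 f3] := cf x Ox; have [h1 h2 h3] := ch x Ox; split.
- exact: (@continuousB _ _ _ f h).
- by move=> i; exact: (is_deriveB (f := f) (g := h)).
- by move=> i; exact: (@continuousB _ _ _ (df i) (dh i)).
Qed.

Lemma C1on_comp O (g dg : R -> R) f df : C1on O f df ->
  (forall x, O x -> is_derive (f x) 1 g (dg (f x))) ->
  (forall x, O x -> {for f x, continuous dg}) ->
  C1on O (g \o f) (fun i x => dg (f x) * df i x).
Proof.
move=> cf dgP cdg x Ox; have [f1 f2 f3] := cf x Ox; split.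
- apply: continuous_comp => //; apply: differentiable_continuous.
  by apply/derivable1_diffP; have [] := dgP x Ox.
- by move=> i; apply: is_derive_comp1 => //; exact: dgP.
- move=> i; apply: (@continuousM _ _ (dg \o f) (df i)) => //.
  by apply: continuous_comp => //; exact: cdg.
Qed.

Lemma C1on_near O f df h dh : open O -> (forall x, O x -> f x = h x) ->
  (forall i x, O x -> df i x = dh i x) -> C1on O f df -> C1on O h dh.
Proof.
move=> oO fh dfh cf x Ox; have [f1 f2 f3] := cf x Ox.
have nO : \near x, O x by apply: open_nbhs_nbhs.
split.
- by apply: near_continuous f1; apply: filterS nO => y /fh.
- move=> i; rewrite -dfh//; apply: near_eq_is_derive (f2 i).
  by apply: filterS nO => y /fh.
- by move=> i; apply: near_continuous (f3 i); apply: filterS nO => y /dfh.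
Qed.

Lemma C1on_bigcup O O' f df : C1on O f df -> C1on O' f df -> C1on (O `|` O') f df.
Proof. by move=> c1 c2 x [/c1|/c2]. Qed.

(** Extension by zero: the open sets O and R^n - K cover R^n. *)
Lemma C1on_glue O K f df h dh : open O -> closed K -> K `<=` O ->
  C1on O f df -> (forall x, O x -> h x = f x) -> (forall i x, O x -> dh i x = df i x) ->
  (forall x, ~ K x -> h x = 0) -> (forall i x, ~ K x -> dh i x = 0) -> C1on setT h dh.
Proof.
move=> oO cK KO cf hf dhf h0 dh0.
apply: (@C1onS _ (O `|` ~` K)).
  by move=> x _; have [Kx|Kx] := pselect (K x); [left; exact: KO|right].
apply: C1on_bigcup.
  by apply: C1on_near cf => //; [move=> x /hf|move=> i x /dhf].
apply: (C1on_near (f := fun=> 0) (df := fun _ _ => 0)); first exact: closed_openC.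
- by move=> x /h0.
- by move=> i x /dh0.
- exact: C1on_cst.
Qed.

Lemma C1_support_deriv K h dh : closed K -> C1on setT h dh -> (forall x, ~ K x -> h x = 0) ->
  forall i x, ~ K x -> dh i x = 0.
Proof.
move=> cK ch h0 i x Kx; have [_ /(_ i) [_ <-] _] := ch x I.
have nK : \near x, (~` K) x by apply: open_nbhs_nbhs; split => //; exact: closed_openC.
rewrite (near_eq_derive (g := fun=> 0) (delta_mx ord0 i)); last first.
  by apply: filterS nK => y /h0.
exact: derive_cst.
Qed.

End C1_calculus.

(** * Integration by parts *)

Section integration_by_parts.
Context {R : realType} {n : nat}.
Local Notation mu := (@lebesgue_rV R n).
Local Notation L1 f := (mu.-integrable setT (EFin \o f)).
Local Notation e_ i := (delta_mx ord0 i : 'rV[R]_n).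
Implicit Types (x y z : 'rV[R]_n) (d : R) (f h g : 'rV[R]_n -> R) (df dh : 'I_n -> 'rV[R]_n -> R)
  (K : set 'rV[R]_n).

Lemma C1_continuous f df : C1on setT f df -> continuous f.
Proof. by move=> cf x; have [] := cf x I. Qed.

Lemma C1_continuous_deriv f df i : C1on setT f df -> continuous (df i).
Proof. by move=> cf x; have [_ _ /(_ i)] := cf x I. Qed.

Lemma C1_is_derive f df i x : C1on setT f df -> is_derive x (e_ i) f (df i x).
Proof. by move=> cf; have [_ /(_ i)] := cf x I. Qed.

Lemma norm_delta_mx i : `|e_ i| <= 1.
Proof.
by apply: rV_norm_ler => // j; rewrite mxE eqxx/=; case: eqP; rewrite ?normr1 ?normr0.
Qed.

Lemma C1_support_L1 K f df : compact K -> C1on setT f df -> (forall x, ~ K x -> f x = 0) ->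
  L1 f /\ forall i, L1 (df i).
Proof.
move=> cK cf f0; split; first exact: L1_compact_support (C1_continuous cf) cK f0.
move=> i; apply: (L1_compact_support (@C1_continuous_deriv _ _ i cf) cK) => x.
by apply: C1_support_deriv cf f0 _ _; apply: compact_closed => //; exact: norm_hausdorff.
Qed.

(** The integral of f (x + t e_i) over x does not depend on t; its derivative
    at t = 0 is the integral of the partial derivative. *)
Lemma integral_partial0 K f df i : compact K -> C1on setT f df -> (forall x, ~ K x -> f x = 0) ->
  \int[mu]_x df i x = 0.
Proof.
move=> cK cf f0.
have clK : closed K by apply: compact_closed => //; exact: norm_hausdorff.
have df0 := C1_support_deriv clK cf f0.
have [L1f L1df] := C1_support_L1 cK cf f0.
have [C C0 dfC] := compact_support_bounded cK (@C1_continuous_deriv _ _ i cf) (df0 i).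
have [M [_ MK]] := compact_bounded cK.
pose k := (Num.truncn (`|M| + 2)).+1.
pose F (t : R) (x : 'rV[R]_n) : R := f (x + t *: e_ i).
have dF (t : R) x : is_derive t 1 (F ^~ x) (df i (x + t *: e_ i)).
  rewrite (_ : F ^~ x = fun s : R => f (s *: e_ i + x)); last first.
    by apply/funext => s; rewrite /F addrC.
  by apply/is_derive_lineP; rewrite addrC; exact: C1_is_derive.
have d1E t x : partial1of2 F t x = df i (x + t *: e_ i).
  by rewrite partial1of2E; have [_ ->] := dF t x.
have H := @cvg_differentiation_under_integral R _ _ mu F setT measurableT 0 (-1) 1 _ _ _
  (fun x => C * \1_(cube k) x).
have {H} : h^-1 *: (\int[mu]_x F (h + 0) x - \int[mu]_x F 0 x) @[h --> (0 : R)^'] -->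
    \int[mu]_x partial1of2 F 0 x.
  apply: H.
  - by rewrite /= in_itv/= ltrN10 ltr01.
  - by move=> t _; exact: integrable_translate.
  - by move=> t x _ _; have [] := dF t x.
  - by move=> x; rewrite mulr_ge0// indicE.
  - apply: L1Z; apply: L1_indic; first by apply: measurable_box => j.
    exact: lebesgue_rV_cube.
  - move=> t x; rewrite /= in_itv/= -ltr_norml => t1 _; rewrite d1E indicE.
    have [xk|/negP xk] := boolP (x \in cube k); first by rewrite mulr1.
    rewrite mulr0 df0 ?normr0// => Kx; apply: xk; rewrite inE; apply: cube_norm.
    apply: le_trans (ltW (truncnS_gt _)).
    have : `|x + t *: e_ i| <= `|M| + 1 by apply: (MK (`|M| + 1)) => //; rewrite ltr_pwDr// ler_norm.
    have : `|t *: e_ i| <= 1.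
      by rewrite normrZ mulr_ile1 ?norm_delta_mx// ltW.
    have := ler_normB (x + t *: e_ i) (t *: e_ i); rewrite addrK; lra.
have -> : \int[mu]_x partial1of2 F 0 x = \int[mu]_x df i x.
  by apply: eq_Rintegral => x _; rewrite d1E scale0r addr0.
have FE t : \int[mu]_x F t x = \int[mu]_x f x.
  by rewrite /F (Rintegral_translate (t *: e_ i)) //; exact: L1_measurable.
under eq_fun do rewrite !FE subrr scaler0.
by move=> /cvg_lim <- //; rewrite lim_cst.
Qed.

Lemma integration_by_parts_rV K f df h dh i : compact K -> C1on setT f df ->
  (forall x, ~ K x -> f x = 0) -> C1on setT h dh ->
  \int[mu]_x (h x * df i x) = - \int[mu]_x (dh i x * f x).
Proof.
move=> cK cf f0 ch.
have fh0 x : ~ K x -> h x * f x = 0 by move=> /f0 ->; rewrite mulr0.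
have := integral_partial0 i cK (C1onM ch cf) fh0.
have clK : closed K by apply: compact_closed => //; exact: norm_hausdorff.
have df0 := C1_support_deriv clK cf f0.
have L1a : L1 (fun x => h x * df i x).
  apply: (@L1_compact_support _ _ (fun x => h x * df i x) K) => //.
    by move=> x; apply: (@continuousM _ _ h (df i)); [exact: (C1_continuous ch)|exact: (C1_continuous_deriv cf)].
  by move=> x /df0 ->; rewrite mulr0.
have L1b : L1 (fun x => f x * dh i x).
  apply: (@L1_compact_support _ _ (fun x => f x * dh i x) K) => //.
    by move=> x; apply: (@continuousM _ _ f (dh i)); [exact: (C1_continuous cf)|exact: (C1_continuous_deriv ch)].
  by move=> x /f0 ->; rewrite mul0r.
rewrite RintegralD// => /eqP; rewrite addr_eq0 => /eqP ->.
by congr (- _); apply: eq_Rintegral => x _; rewrite mulrC.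
Qed.

Lemma is_derive_moll_kern c d s f i x : 0 < d -> L1 f ->
  is_derive x (e_ i) (moll (kern c d s) f) (- moll (kern c d (kern_upd d i s)) f x).
Proof.
move=> d0 L1f.
have [C1 _ kC] := kern_bounded c s d0.
have [C2 _ dkC] := kern_bounded c (kern_upd d i s) d0.
apply: (@is_derive_moll _ _ _ _ f x (e_ i) (Num.max C1 C2)) => //.
- exact: measurable_kern.
- exact: measurable_kern.
- by move=> z; exact: is_derive_kern.
- by move=> z; rewrite le_max kC.
- by move=> z; rewrite le_max dkC orbT.
Qed.

(** The derivative is first taken on the kernel; the hypothesis is the definition
    of a weak derivative g of f, tested with the translated kernel. *)
Lemma is_derive_moll_weak d f g i x : 0 < d -> L1 f ->
  \int[mu]_y (f y * partial i (fun y => mollifier d (y - x)) y) =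
    - (\int[mu]_y (g y * mollifier d (y - x))) ->
  is_derive x (e_ i) (moll (mollifier d) f) (moll (mollifier d) g x).
Proof.
move=> d0 L1f H; pose dk := kern (@mass R n d)^-1 d (kern_upd d i (@base_index R n)).
apply: (is_derive_eq (f' := - moll dk f x)); first exact: is_derive_moll_kern.
rewrite {2}/moll -[RHS]opprK -H; congr (- _); apply: eq_Rintegral => y _; congr (_ * _).
by rewrite /dk; have [_ <-] := is_derive_kern_shift (@mass R n d)^-1 d (@base_index R n) i x y.
Qed.

Lemma is_derive_moll_C1 d K f df i x : 0 < d -> compact K -> C1on setT f df ->
  (forall x, ~ K x -> f x = 0) ->
  is_derive x (e_ i) (moll (mollifier d) f) (moll (mollifier d) (df i) x).
Proof.
move=> d0 cK cf f0; have [L1f L1df] := C1_support_L1 cK cf f0.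
apply: is_derive_moll_weak => //.
pose k y := mollifier d (y - x); pose dk j y := kern (@mass R n d)^-1 d (kern_upd d j (@base_index R n)) (y - x).
have ck : C1on setT k dk.
  move=> y _; split.
  - apply: (@continuous_comp _ _ _ (fun y => y - x) (mollifier d)).
      by apply: (@cvgB _ _ _ (nbhs y) _ id (cst x)); [exact: cvg_id|exact: cvg_cst].
    exact: continuous_kern.
  - by move=> j; exact: is_derive_kern_shift.
  - move=> j; apply: (@continuous_comp _ _ _ (fun y => y - x) (kern (@mass R n d)^-1 d (kern_upd d j (@base_index R n)))).
      by apply: (@cvgB _ _ _ (nbhs y) _ id (cst x)); [exact: cvg_id|exact: cvg_cst].
    exact: continuous_kern.
have := integration_by_parts_rV i cK cf f0 ck.
have E y : partial i (fun y => mollifier d (y - x)) y = dk i y.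
  by rewrite /partial; have [_ ->] := is_derive_kern_shift (@mass R n d)^-1 d (@base_index R n) i x y.
under [X in _ -> X = _]eq_Rintegral do rewrite E mulrC.
move=> H; rewrite -[LHS]opprK -H; congr (- _); apply: eq_Rintegral => y _.
by rewrite mulrC.
Qed.

Lemma foldr_partial_moll d f s (c : R) l : 0 < d -> L1 f -> exists c' s',
  foldr partial (moll (kern c d s) f) l = moll (kern c' d s') f.
Proof.
move=> d0 L1f; elim: l => [|i l [c' [s' IH]]]; first by exists c, s.
exists (- c'), (kern_upd d i s'); rewrite /= IH; apply/funext => x.
have [C2 _ dkC] := kern_bounded c' (kern_upd d i s') d0.
have [_] := is_derive_moll_kern c' s' i x d0 L1f.
rewrite /partial => ->; rewrite /moll -mulN1r -RintegralZl//; last first.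
  apply: (@L1_mul_bounded _ _ _ _ C2) => //; apply: measurable_sub_comp.
  exact: measurable_kern.
by apply: eq_Rintegral => y _; rewrite /kern mulN1r !mulNr mulrN.
Qed.

(** All derivatives fall on the kernel, and derivatives of kernels are kernels. *)
Lemma smooth_moll d f : 0 < d -> L1 f -> smooth (moll (mollifier d) f).
Proof.
move=> d0 L1f l; have [c [s ->]] := foldr_partial_moll (@base_index R n) (@mass R n d)^-1 l d0 L1f.
have [C1 _ kC] := kern_bounded c s d0.
split.
  apply: (@continuous_moll _ _ _ _ C1) => //; first exact: measurable_kern.
  exact: kern_unif_continuous.
by move=> i x; have [] := is_derive_moll_kern c s i x d0 L1f.
Qed.

End integration_by_parts.

(** * Euclidean geometry and the flux of the p-Laplacian *)

Section euclid.
Context {R : realType} {n : nat}.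
Implicit Types (x y z a b : 'rV[R]_n) (c t : R).

Lemma dotC x y : dot x y = dot y x.
Proof. by apply: eq_bigr => i _; rewrite mulrC. Qed.

Lemma dotDl x y z : dot (x + y) z = dot x z + dot y z.
Proof. by rewrite /dot -big_split; apply: eq_bigr => i _; rewrite mxE mulrDl. Qed.

Lemma dotZl c x y : dot (c *: x) y = c * dot x y.
Proof. by rewrite /dot mulr_sumr; apply: eq_bigr => i _; rewrite mxE mulrA. Qed.

Lemma dotNl x y : dot (- x) y = - dot x y.
Proof. by rewrite -scaleN1r dotZl mulN1r. Qed.

Lemma dotBl x y z : dot (x - y) z = dot x z - dot y z.
Proof. by rewrite dotDl dotNl. Qed.

Lemma dotBr x y z : dot z (x - y) = dot z x - dot z y.
Proof. by rewrite dotC dotBl !(dotC z). Qed.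

Lemma dotDr x y z : dot z (x + y) = dot z x + dot z y.
Proof. by rewrite dotC dotDl !(dotC z). Qed.

Lemma dotZr c x y : dot x (c *: y) = c * dot x y.
Proof. by rewrite dotC dotZl dotC. Qed.

Lemma dot0l x : dot 0 x = 0.
Proof. by rewrite -(scale0r x) dotZl mul0r. Qed.

Lemma dot_ge0 x : 0 <= dot x x.
Proof. by apply: sumr_ge0 => i _; rewrite -expr2 sqr_ge0. Qed.

Lemma enorm_ge0 x : 0 <= enorm x.
Proof. exact: sqrtr_ge0. Qed.

Lemma enorm_sqr x : enorm x ^+ 2 = dot x x.
Proof. by rewrite sqr_sqrtr// dot_ge0. Qed.

Lemma enorm0 : enorm (0 : 'rV[R]_n) = 0.
Proof. by rewrite /enorm dot0l sqrtr0. Qed.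

Lemma enormN x : enorm (- x) = enorm x.
Proof. by rewrite /enorm dotNl dotC dotNl opprK. Qed.

Lemma enormB x y : enorm (x - y) = enorm (y - x).
Proof. by rewrite -enormN opprB. Qed.

Lemma enormZ c x : enorm (c *: x) = `|c| * enorm x.
Proof. by rewrite /enorm dotZl dotC dotZl mulrA -expr2 sqrtrM ?sqr_ge0// sqrtr_sqr. Qed.

Lemma coord_le_enorm x i : `|x ord0 i| <= enorm x.
Proof.
rewrite -sqrtr_sqr ler_sqrt ?dot_ge0// /dot (bigD1 i)//= expr2 lerDl.
by apply: sumr_ge0 => j _; rewrite -expr2 sqr_ge0.
Qed.

Lemma norm_le_enorm x : `|x| <= enorm x.
Proof. by apply: rV_norm_ler => [|i]; [exact: enorm_ge0|exact: coord_le_enorm]. Qed.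

Lemma enorm_eq0 x : enorm x = 0 -> x = 0.
Proof.
by move=> x0; apply/eqP; rewrite -normr_eq0 eq_le normr_ge0 andbT -x0 norm_le_enorm.
Qed.

Lemma cauchy_schwarz x y : dot x y <= enorm x * enorm y.
Proof.
have [x0|x0] := eqVneq (enorm x) 0; first by rewrite (enorm_eq0 x0) dot0l enorm0 mul0r.
have [y0|y0] := eqVneq (enorm y) 0; first by rewrite dotC (enorm_eq0 y0) dot0l enorm0 mulr0.
have xp : 0 < enorm x by rewrite lt_def x0 enorm_ge0.
have yp : 0 < enorm y by rewrite lt_def y0 enorm_ge0.
have := dot_ge0 (enorm y *: x - enorm x *: y).
rewrite dotBl !dotBr !dotZl !dotZr -!enorm_sqr (dotC y x) => H.
have {}H : 0 <= 2 * (enorm x * enorm y) * (enorm x * enorm y - dot x y).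
  by apply: le_trans H _; rewrite le_eqVlt; apply/orP; left; apply/eqP; ring.
by rewrite pmulr_rge0 ?subr_ge0// in H; rewrite !mulr_gt0.
Qed.

Lemma enormD x y : enorm (x + y) <= enorm x + enorm y.
Proof.
rewrite -(@ler_pXn2r _ 2) ?nnegrE ?addr_ge0 ?enorm_ge0//.
rewrite enorm_sqr dotDl !dotDr sqrrD -!enorm_sqr (dotC y x).
have := cauchy_schwarz x y; rewrite mulr2n; lra.
Qed.

Lemma enorm_le_sum x : enorm x <= \sum_(i < n) `|x ord0 i|.
Proof.
have E : x = \sum_(i < n) x ord0 i *: delta_mx ord0 i by rewrite -row_sum_delta.
rewrite {1}E; elim/big_ind2: _ => //; first by rewrite enorm0.
  by move=> a b c d ab cd; rewrite (le_trans (enormD _ _))// lerD.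
move=> i _; rewrite enormZ ler_piMr//.
rewrite /enorm /dot (bigD1 i)//= big1 ?addr0 ?mxE ?eqxx/= ?mulr1 ?sqrtr1// => j ji.
by rewrite !mxE (negbTE ji)/= mulr0.
Qed.

(** The topology and the measure are tied to the sup norm; this and
    [norm_le_enorm] transfer estimates between the two norms. *)
Lemma enorm_le_norm x : enorm x <= n%:R * `|x|.
Proof.
apply: (le_trans (enorm_le_sum x)); rewrite -[X in X%:R * _]card_ord mulr_natl -sumr_const.
by apply: ler_sum => i _; exact: ler_rV_norm.
Qed.

Lemma ler_enormB x y : enorm x - enorm y <= enorm (x - y).
Proof. by rewrite lerBlDr -{1}(subrK y x) enormD. Qed.

Lemma enorm_triangle y x z : enorm (x - z) <= enorm (x - y) + enorm (y - z).
Proof. by rewrite -[x - z](subrKA y) enormD. Qed.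

Lemma continuous_enorm : continuous (@enorm R n).
Proof.
move=> x; apply/continuous_atP => e e0.
have n1 : 0 < n%:R + 1 :> R by rewrite ltr_pwDr.
exists (e / (n%:R + 1)) => [|y yx]; first exact: divr_gt0.
have H (u v : 'rV[R]_n) : enorm u - enorm v <= n%:R * `|u - v|.
  by rewrite (le_trans (ler_enormB _ _))// enorm_le_norm.
have := H y x; have := H x y; rewrite (distrC x y).
have : n%:R * `|y - x| < e.
  rewrite ltr_pdivlMr// in yx; apply: le_lt_trans yx.
  by rewrite mulrC ler_wpM2l// lerDl.
move: (`|y - x|) => u h1 h2 h3; rewrite ltr_norml; apply/andP; split; lra.
Qed.

Lemma continuous_subr (V : normedModType R) (c : V) : continuous (fun x : V => x - c).
Proof. by move=> x; apply: (@cvgB _ _ _ (nbhs x) _ id (cst c)); [exact: cvg_id|exact: cvg_cst]. Qed.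

Lemma continuous_enormB a : continuous (fun x : 'rV[R]_n => enorm (x - a)).
Proof.
move=> x; apply: (@continuous_comp _ _ _ (fun x => x - a) (@enorm R n)).
  exact: continuous_subr.
exact: continuous_enorm.
Qed.

Lemma open_eball a t : open (eball a t).
Proof.
rewrite (_ : eball a t = (fun x => enorm (x - a)) @^-1` [set s | s < t])//.
by apply: open_comp; [move=> x _; exact: continuous_enormB|exact: open_lt].
Qed.

Lemma compact_ceball a t : compact [set x | enorm (x - a) <= t].
Proof.
apply: bounded_closed_compact.
  exists (t + `|a|); split; first exact: num_real.
  move=> M tM x /= xt; rewrite (le_trans _ (ltW tM))// -[x](subrK a).
  by rewrite (le_trans (ler_normD _ _))// lerD2r (le_trans (norm_le_enorm _)).
rewrite (_ : [set _ | _] = (fun x => enorm (x - a)) @^-1` [set s | s <= t])//.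
by apply: closed_comp; [move=> x _; exact: continuous_enormB|exact: closed_le].
Qed.

(** The vector field |a|^(q - 2) a whose divergence is the q-Laplacian. *)
Definition pflux (q : R) a : 'rV[R]_n := enorm a `^ (q - 2) *: a.

Lemma powR_pred (q t : R) : 1 < q -> 0 <= t -> t `^ (q - 2) * t = t `^ (q - 1).
Proof.
move=> q1; rewrite le_eqVlt => /predU1P[<-|t0].
  by rewrite mulr0 powR0// subr_eq0 gt_eqF.
have -> : q - 1 = (q - 2) + 1 by ring.
rewrite (@powRD _ t (q - 2) 1); last by rewrite (gt_eqF t0) implybT.
by rewrite powRr1// ltW.
Qed.

Lemma enorm_pflux q a : 1 < q -> enorm (pflux q a) = enorm a `^ (q - 1).
Proof. by move=> q1; rewrite enormZ ger0_norm ?powR_ge0// powR_pred ?enorm_ge0. Qed.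

(** By the Cauchy-Schwarz inequality the scalar product is at least
    (|a|^(q - 1) - |b|^(q - 1)) (|a| - |b|), and t^(q - 1) is nondecreasing. *)
Lemma pflux_monotone q a b : 1 < q -> 0 <= dot (pflux q a - pflux q b) (a - b).
Proof.
move=> q1; rewrite dotBl !dotBr !dotZl -!enorm_sqr (dotC b a).
have := cauchy_schwarz a b; have := powR_pred q1 (enorm_ge0 a); have := powR_pred q1 (enorm_ge0 b).
have := @ge0_ler_powR _ (q - 1); rewrite subr_ge0 (ltW q1) => /(_ isT).
have := enorm_ge0 a; have := enorm_ge0 b.
have := powR_ge0 (enorm a) (q - 2); have := powR_ge0 (enorm b) (q - 2).
move: (enorm a) (enorm b) (enorm a `^ (q - 2)) (enorm b `^ (q - 2)) (dot a b) => s t u v w v0 u0 t0 s0 mono E1 E2 st.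
have H : 0 <= (u * s - v * t) * (s - t).
  rewrite E1 E2; have [/ltW ts|/ltW ts|->] := ltgtP s t; last by rewrite !subrr mulr0.
    by rewrite mulr_le0// subr_le0// mono// nnegrE.
  by rewrite mulr_ge0// subr_ge0// mono// nnegrE.
have : (u + v) * w <= (u + v) * (s * t) by rewrite ler_wpM2l// addr_ge0.
nra.
Qed.

End euclid.

(** * Mollification with a variable exponent *)

Section modular.
Context {R : realType} {n : nat}.
Local Notation mu := (@lebesgue_rV R n).
Local Notation L1 f := (mu.-integrable setT (EFin \o f)).
Implicit Types (x y : 'rV[R]_n) (d : R) (f h p : 'rV[R]_n -> R).

Lemma moll_ge0 d f x : 0 < d -> (forall y, 0 <= f y) -> 0 <= moll (mollifier d) f x.
Proof. by move=> d0 f0; apply: Rintegral_ge0 => y _; rewrite mulr_ge0// mollifier_ge0. Qed.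

Lemma moll_sup_le d f x : 0 < d -> L1 f ->
  moll (mollifier d) (fun y => `|f y|) x <= (\int[mu]_y `|f y|) * (mass_lb * d) ^- n.
Proof.
move=> d0 L1f; have L1a := L1_norm L1f.
rewrite -RintegralZr//; apply: le_Rintegral => //.
- exact: L1_mollM.
- have := L1Z ((mass_lb * d) ^- n) L1a; apply: eq_integrable => //.
  by move=> y _ /=; rewrite mulrC.
- by move=> y _; rewrite ler_wpM2l// mollifier_le.
Qed.

(** A pointwise Jensen inequality for a variable exponent.  Let A be the average
    of |f| over the cube x + [0, d]^n and b = A / 2 > 1.  Where |f| > b, one has
    |f| <= b^(1 - p(y)) |f|^p(y), and p(y) differs from p(x) by at most L d;
    averaging, b^p(x) <= b^(L d) times the average of h.  Since b = O(d^-n), the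
    factor b^(L d) is bounded uniformly in d. *)
Lemma moll_modular f h p (L P : R) : L1 f -> L1 h -> (forall y, `|f y| `^ p y <= h y) ->
  (forall y, 1 <= p y <= P) -> 0 <= L -> (forall x y, `|p x - p y| <= L * `|x - y|) ->
  exists2 C : R, 0 <= C & forall d x, 0 < d <= 1 ->
    `|moll (mollifier d) f x| `^ p x <= C * (1 + moll (mollifier d) h x).
Proof.
move=> L1f L1h fh pP L0 pL.
have h0 y : 0 <= h y by apply: le_trans (fh y); exact: powR_ge0.
pose M := \int[mu]_y `|f y|.
have M0 : 0 <= M by apply: Rintegral_ge0.
have P1 : 1 <= P by have /andP[a b] := pP 0; exact: le_trans a b.
pose G : R := ln (M * mass_lb ^- n + 1).
have G0 : 0 <= G.
  by rewrite ln_ge0// lerDr mulr_ge0// invr_ge0 exprn_ge0// ltW// mass_lb_gt0.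
pose C0 := expR (L * (G + n%:R)).
have C01 : 1 <= C0 by rewrite -expR0 ler_expR mulr_ge0// addr_ge0.
exists (2 `^ P * C0); first by rewrite mulr_ge0 ?powR_ge0// (le_trans _ C01).
move=> d x /andP[d0 d1].
have [p1 p2] := andP (pP x).
set a := `|_|; set H := moll _ h x.
have a0 : 0 <= a by exact: normr_ge0.
have px0 : 0 <= p x by exact: le_trans p1.
have H0 : 0 <= H by exact: moll_ge0.
pose A := moll (mollifier d) (fun y => `|f y|) x.
have aA : a <= A by exact: normr_moll_le.
(* For A <= 2 the left side is at most 2^P. *)
have [A2|A2] := leP A 2.
  have a2 : a `^ p x <= 2 `^ P.
    apply: (@le_trans _ _ (2 `^ p x)); last by rewrite ler_powR// ler1n.
    by apply: ge0_ler_powR; rewrite ?nnegrE//; exact: le_trans A2.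
  rewrite (le_trans a2)// -mulrA ler_peMr ?powR_ge0//.
  by rewrite mulr_ege1// lerDl.
pose b := A / 2; have b1 : 1 < b by rewrite /b ltr_pdivlMr// mul1r.
have b0 : 0 < b by exact: lt_trans b1.
have Ab : A = 2 * b by rewrite /b mulrC divfK.
pose T := b `^ (1 - p x + L * d).
have T0 : 0 <= T by exact: powR_ge0.
have fy y : corner_box d (y - x) -> `|f y| <= b + T * h y.
  move=> yx; have [fb|fb] := leP `|f y| b; first by rewrite (le_trans fb)// lerDl mulr_ge0.
  have fy0 : 0 < `|f y| by exact: lt_trans fb.
  have [p1y p2y] := andP (pP y).
  have -> : `|f y| = `|f y| `^ (1 - p y) * `|f y| `^ p y.
    rewrite -powRD ?subrK ?powRr1 ?normr_ge0//.
    by rewrite (gt_eqF fy0) implybT.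
  rewrite ler_wpDl ?(ltW b0)// ler_pM ?powR_ge0//.
  apply: (@le_trans _ _ (b `^ (1 - p y))).
    have -> : 1 - p y = - (p y - 1) by ring.
    rewrite !powRN lef_pV2 ?posrE ?powR_gt0//.
    by rewrite ge0_ler_powR ?subr_ge0 ?nnegrE// ltW.
  rewrite /T ler_powR ?(ltW b1)//.
  have := pL x y; have : `|x - y| <= d by rewrite distrC corner_box_norm.
  move=> xyd pxy; have : `|p x - p y| <= L * d by apply: le_trans pxy _; rewrite ler_wpM2l.
  by rewrite ler_norml => /andP[_ hh]; lra.
have Ale : A <= b + T * H.
  have L1g : L1 (fun y => `|f y| - T * h y) by apply: L1B; [exact: L1_norm|exact: L1Z].
  have E : moll (mollifier d) (fun y => `|f y| - T * h y) x = A - T * H.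
    rewrite mollB//; [|exact: L1_norm|exact: L1Z].
    congr (_ - _); rewrite /H /moll -RintegralZl//; last exact: L1_mollM.
    by apply: eq_Rintegral => y _; rewrite mulrA.
  rewrite -lerBlDr -E /moll.
  have -> : b = \int[mu]_y (b * mollifier d (y - x)).
    rewrite RintegralZl//; last first.
      by have := integrable_translate (- x) (@L1_mollifier R n d d0); apply: eq_integrable.
    by rewrite (Rintegral_translate (- x)) ?mollifier_integral ?mulr1//; exact: measurable_mollifier.
  apply: le_Rintegral => //; first exact: L1_mollM.
    by apply: L1Z; have := integrable_translate (- x) (@L1_mollifier R n d d0); apply: eq_integrable.
  move=> y _; have [yx|/(mollifier_out d0) ->] := pselect (corner_box d (y - x)); last by rewrite !mulr0.
  by rewrite ler_wpM2r ?mollifier_ge0// lerBlDr fy.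
have bTH : b <= T * H by rewrite Ab in Ale; lra.
have bp : b `^ p x <= b `^ (L * d) * H.
  have -> : b `^ p x = b `^ (p x - 1) * b.
    have -> : p x = (p x - 1) + 1 by ring.
    by rewrite (@powRD _ b (p x - 1) 1) ?addrK ?powRr1 ?(ltW b0)// (gt_eqF b0) implybT.
  have -> : b `^ (L * d) = b `^ (p x - 1) * T.
    rewrite /T -powRD ?(gt_eqF b0) ?implybT//; congr (_ `^ _); ring.
  by rewrite -mulrA ler_wpM2l// powR_ge0.
have lnb : ln b <= G - n%:R * ln d.
  have bM : b <= (M * mass_lb ^- n + 1) * d ^- n.
    rewrite (@le_trans _ _ A)//; first by rewrite Ab; lra.
    apply: le_trans (moll_sup_le x d0 L1f) _; rewrite -/M exprMn invfM mulrA.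
    by rewrite ler_wpM2r ?invr_ge0 ?exprn_ge0 ?ltW// ltrDl.
  have M'0 : 0 < M * mass_lb ^- n + 1.
    by rewrite ltr_wpDl// mulr_ge0// invr_ge0 exprn_ge0// ltW// mass_lb_gt0.
  have dn0 : 0 < d ^- n by rewrite invr_gt0 exprn_gt0.
  have -> : G - n%:R * ln d = ln ((M * mass_lb ^- n + 1) * d ^- n).
    by rewrite lnM ?posrE// lnV ?posrE ?exprn_gt0// lnXn// mulr_natl.
  by rewrite ler_ln// posrE mulr_gt0.
have bL : b `^ (L * d) <= C0.
  rewrite /powR (gt_eqF b0) ler_expR -mulrA ler_wpM2l//.
  have dln : d * - ln d <= 1.
    rewrite -lnV ?posrE// mulrC -ler_pdivlMr// mul1r.
    by rewrite ltW// ln_sublinear// invr_gt0.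
  apply: (@le_trans _ _ (d * (G - n%:R * ln d))); first by rewrite ler_wpM2l// ltW.
  rewrite mulrBr; have -> : d * (n%:R * ln d) = - (n%:R * (d * - ln d)) by ring.
  rewrite opprK lerD//; first by rewrite ler_piMl.
  by rewrite -[leRHS]mulr1 ler_wpM2l.
apply: (@le_trans _ _ (A `^ p x)).
  by apply: ge0_ler_powR; rewrite ?nnegrE//; exact: le_trans aA.
rewrite Ab powRM ?(ltW b0)//.
apply: (@le_trans _ _ (2 `^ P * (C0 * H))).
  rewrite ler_pM ?powR_ge0//; first by rewrite ler_powR// ler1n.
  by apply: le_trans bp _; rewrite ler_wpM2r.
by rewrite mulrA ler_wpM2l ?mulr_ge0 ?powR_ge0 ?(le_trans _ C01)// lerDr.
Qed.

End modular.

Section pairing.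
Context {R : realType} {n : nat}.
Local Notation mu := (@lebesgue_rV R n).
Local Notation L1 f := (mu.-integrable setT (EFin \o f)).
Implicit Types (x y : 'rV[R]_n) (d : R) (f h w p Y : 'rV[R]_n -> R) (K : set 'rV[R]_n).

(** A form of Young's inequality in which the first term has a small factor:
    compare b with l a. *)
Lemma mulr_powR_split (a b l q : R) : 0 <= a -> 0 <= b -> 0 < l <= 1 -> 1 < q ->
  a * b `^ (q - 1) <= l `^ (q - 1) * a `^ q + l^-1 * b `^ q.
Proof.
move=> a0 b0 /andP[l0 l1] q1.
have q0 : 0 <= q - 1 by rewrite subr_ge0 ltW.
have E t : 0 <= t -> t * t `^ (q - 1) = t `^ q.
  rewrite le_eqVlt => /predU1P[<-|t0].
    by rewrite mul0r powR0// gt_eqF// (lt_trans ltr01).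
  have -> : q = 1 + (q - 1) by ring.
  by rewrite (@powRD _ t 1 (q - 1)) ?powRr1 ?(ltW t0)// ?(gt_eqF t0) ?implybT//; congr (_ * _ `^ _); ring.
have [bla|bla] := leP b (l * a).
  rewrite -[leLHS]addr0 lerD//; last by rewrite mulr_ge0 ?powR_ge0// invr_ge0 ltW.
  rewrite -E// mulrCA ler_wpM2l// -powRM ?(ltW l0)//.
  by apply: ge0_ler_powR; rewrite ?nnegrE// mulr_ge0// ltW.
rewrite -[leLHS]add0r lerD//; first by rewrite mulr_ge0 ?powR_ge0.
rewrite -E// mulrA ler_wpM2r ?powR_ge0//.
by rewrite mulrC ler_pdivlMr// mulrC ltW.
Qed.

(** This is how gradients of mollifications converge against the flux of the
    solution.  Where w <= M the field Y is bounded and convergence in L^1 is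
    enough.  Where w > M, [mulr_powR_split] bounds the product by a small multiple
    of the modulars of moll f and f, which are controlled uniformly by
    [moll_modular], plus l^-1 times the part of w^p above the level M, which
    tends to 0 by dominated convergence. *)
Lemma moll_pairing K p f h Y w (L pm P C : R) :
  measurable K -> (mu K < +oo)%E -> L1 f -> L1 h ->
  (forall y, `|f y| `^ p y <= h y) ->
  measurable_fun setT p -> 1 < pm -> (forall y, pm <= p y <= P) ->
  0 <= L -> (forall x y, `|p x - p y| <= L * `|x - y|) ->
  (0 < n)%N ->
  measurable_fun setT w -> (forall y, 0 <= w y) -> L1 (fun y => w y `^ p y) ->
  measurable_fun setT Y -> (forall y, ~ K y -> Y y = 0) -> 0 <= C ->
  (forall y, `|Y y| <= C * (w y `^ (p y - 1) + 1)) ->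
  forall e, 0 < e -> exists2 d0 : R, 0 < d0 & forall d, 0 < d < d0 ->
    L1 (fun x => Y x * (moll (mollifier d) f x - f x)) /\
    \int[mu]_x `|Y x * (moll (mollifier d) f x - f x)| <= e.
Proof.
move=> mK Koo L1f L1h fh mp pm1 pP L0 pL n0 mw w0 L1w mY YK C0 YC e e0.
have p1 y : 1 < p y by have /andP[a _] := pP y; exact: lt_le_trans a.
have p1P y : 1 <= p y <= P by have /andP[_ b] := pP y; rewrite b (ltW (p1 y)).
have h0 y : 0 <= h y by apply: le_trans (fh y); exact: powR_ge0.
have [C1 C10 modular] := moll_modular L1f L1h fh p1P L0 pL.
have L1K : L1 (\1_K : 'rV[R]_n -> R) by exact: L1_indic.
pose mK' := \int[mu]_x (\1_K x : R); pose Ih := \int[mu]_x h x.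
have mK'0 : 0 <= mK' by apply: Rintegral_ge0 => x _; rewrite indicE.
have Ih0 : 0 <= Ih by apply: Rintegral_ge0.
(* l is fixed first: it makes the modulars of moll f and f small. *)
pose B := 2 * C * (C1 * (mK' + Ih) + Ih).
have B0 : 0 <= B by rewrite !mulr_ge0// addr_ge0// mulr_ge0// addr_ge0.
have e30 : 0 < e / 3 by rewrite divr_gt0.
have [l [l0 l1 lB]] : exists l : R, [/\ 0 < l, l <= 1 & l `^ (pm - 1) * B <= e / 3].
  pose s := Num.min 1 (e / 3 / (B + 1)).
  have s0 : 0 < s by rewrite lt_min ltr01 divr_gt0// ltr_wpDl.
  have s1 : s <= 1 by rewrite ge_min lexx.
  have pm0 : 0 < pm - 1 by rewrite subr_gt0.
  exists (s `^ (pm - 1)^-1); split; first exact: powR_gt0.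
    by rewrite /powR gt_eqF// -[leRHS]expR0 ler_expR mulr_ge0_le0 ?ln_le0// invr_ge0 ltW.
  rewrite -powRrM mulVf ?gt_eqF// powRr1 ?(ltW s0)//.
  apply: (@le_trans _ _ (e / 3 / (B + 1) * B)).
    by rewrite ler_wpM2r// ge_min lexx orbT.
  by rewrite mulrAC ler_pdivrMr ?ltr_wpDl// ler_wpM2l ?(ltW e30)// lerDl.
(* M is fixed next, in terms of l: the part of w `^ p above M pays for l^-1. *)
pose tail (m : nat) x := w x `^ p x * \1_[set y | m.+1%:R < w y] x.
have mtailset m : measurable [set y | m.+1%:R < w y].
  rewrite (_ : [set y | _] = w @^-1` `]m.+1%:R, +oo[%classic).
    by rewrite -[X in measurable X]setTI; exact: mw.
  by apply/seteqP; split=> y; rewrite /= in_itv/= andbT.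
have mtail m : measurable_fun setT (tail m).
  by apply: measurable_funM; [exact: (L1_measurable L1w)|exact: measurable_indic].
have ltail x : tail m x @[m --> \oo] --> (0 : R).
  apply: cvg_near_cst; exists (Num.truncn (w x)) => // m /= wm.
  rewrite /tail indicE memNset ?mulr0//= => /(lt_trans); move=> /(_ _ (truncnS_gt _)).
  by rewrite ltr_nat !ltnS ltnNge wm.
have tailb m x : `|tail m x| <= w x `^ p x.
  rewrite /tail indicE; case: (_ \in _); rewrite ?mulr1 ?mulr0 ?normr0 ?powR_ge0//.
  by rewrite ger0_norm// powR_ge0.
have [_ L1tail tail0] := dominated_dist1 mtail ltail L1w tailb.
pose D := 4 * C * l^-1.
have D0 : 0 <= D by rewrite !mulr_ge0// invr_ge0 ltW.
have e3D : 0 < e / 3 / (D + 1) by rewrite divr_gt0// ltr_wpDl.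
have /cvgr0Pnorm_lt /(_ _ e3D) [M _ /(_ M (leqnn M)) /= tailM] := tail0.
have {}tailM : D * (\int[mu]_x tail M x) <= e / 3.
  have E : dist1 (tail M) (fun=> 0) = \int[mu]_x tail M x.
    by apply: eq_Rintegral => x _; rewrite subr0 ger0_norm// /tail mulr_ge0 ?powR_ge0.
  rewrite E ger0_norm in tailM; last by rewrite -E dist1_ge0.
  apply: (@le_trans _ _ ((D + 1) * (e / 3 / (D + 1)))).
    rewrite ler_pM ?(ltW tailM) ?lerDl//; rewrite -E; exact: dist1_ge0.
  by rewrite mulrC divfK// gt_eqF// ltr_wpDl.
pose CM := C * (M.+1%:R `^ P + 1).
have CM0 : 0 <= CM by rewrite mulr_ge0// addr_ge0// powR_ge0.
have e3C : 0 < e / 3 / (CM + 1) by rewrite divr_gt0// ltr_wpDl.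
have [d0 d00 d0P] := moll_cvg1 n0 L1f e3C.
exists (Num.min d0 1); first by rewrite lt_min d00 ltr01.
move=> d /andP[dd]; rewrite lt_min => /andP[dd0 d1].
have [L1mf _] := moll_L1 dd L1f; have [L1mh mh] := moll_L1 dd L1h.
pose G x := CM * `|moll (mollifier d) f x - f x| +
  (2 * C * l `^ (pm - 1) * (C1 * (\1_K x + moll (mollifier d) h x) + h x) + D * tail M x).
have mh0 x : 0 <= moll (mollifier d) h x by exact: moll_ge0.
have L1G1 : L1 (fun x => C1 * (\1_K x + moll (mollifier d) h x)) by apply: L1Z; exact: L1D.
have L1G2 : L1 (fun x => C1 * (\1_K x + moll (mollifier d) h x) + h x) by exact: L1D.
have L1G3 : L1 (fun x => 2 * C * l `^ (pm - 1) * (C1 * (\1_K x + moll (mollifier d) h x) + h x) + D * tail M x).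
  by apply: L1D; exact: L1Z.
have L1d : L1 (fun x => `|moll (mollifier d) f x - f x|) by apply: L1_norm; exact: L1B.
have L1G : L1 G by apply: L1D => //; exact: L1Z.
have YG x : `|Y x * (moll (mollifier d) f x - f x)| <= G x.
  have tailM0 : 0 <= D * tail M x.
    by rewrite mulr_ge0// /tail mulr_ge0 ?powR_ge0.
  have Dd0 : 0 <= CM * `|moll (mollifier d) f x - f x| by rewrite mulr_ge0.
  have mid0 : 0 <= 2 * C * l `^ (pm - 1) * (C1 * (\1_K x + moll (mollifier d) h x) + h x).
    by rewrite mulr_ge0 ?mulr_ge0 ?powR_ge0// addr_ge0// mulr_ge0// addr_ge0.
  have [Kx|Kx] := pselect (K x); last first.
    by rewrite YK// mul0r normr0 /G !addr_ge0.
  rewrite normrM; have [wM|wM] := leP (w x) M.+1%:R.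
    apply: (@le_trans _ _ (CM * `|moll (mollifier d) f x - f x|)); last first.
      by rewrite /G lerDl addr_ge0.
    rewrite ler_wpM2r//; apply: le_trans (YC x) _; rewrite ler_wpM2l// lerD2r.
    have /andP[_ pxP] := pP x.
    apply: (@le_trans _ _ (M.+1%:R `^ (p x - 1))).
      by apply: ge0_ler_powR; rewrite ?nnegrE// subr_ge0 ltW.
    by rewrite ler_powR ?ler1n// (le_trans _ pxP)// gerBl.
  have w1 : 1 <= w x by rewrite (le_trans _ (ltW wM))// ler1n.
  have Yw : `|Y x| <= 2 * C * w x `^ (p x - 1).
    apply: le_trans (YC x) _; rewrite [2 * C]mulrC -mulrA ler_wpM2l// mulrDl mul1r lerD2l.
    have px1 : 0 <= p x - 1 by rewrite subr_ge0 ltW.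
    by have := ler_powR w1 px1; rewrite powRr0.
  have fd : `|moll (mollifier d) f x - f x| <= `|moll (mollifier d) f x| + `|f x| by exact: ler_normB.
  apply: (@le_trans _ _ (2 * C * ((`|moll (mollifier d) f x| + `|f x|) * w x `^ (p x - 1)))).
    by rewrite [X in _ <= _ * X]mulrC mulrA ler_pM.
  have l01 : 0 < l <= 1 by rewrite l0 l1.
  have S1 := mulr_powR_split (normr_ge0 (moll (mollifier d) f x)) (w0 x) l01 (p1 x).
  have S2 := mulr_powR_split (normr_ge0 (f x)) (w0 x) l01 (p1 x).
  have lpm : l `^ (p x - 1) <= l `^ (pm - 1).
    have /andP[pmx _] := pP x; rewrite /powR gt_eqF// ler_expR.
    by rewrite ler_wnM2r ?ln_le0// lerD2r.
  have m1 : `|moll (mollifier d) f x| `^ p x <= C1 * (\1_K x + moll (mollifier d) h x).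
    by rewrite indicE mem_set//; apply: modular; rewrite dd ltW.
  have T1 : l `^ (p x - 1) * `|moll (mollifier d) f x| `^ p x <=
            l `^ (pm - 1) * (C1 * (\1_K x + moll (mollifier d) h x)) by rewrite ler_pM ?powR_ge0.
  have T2 : l `^ (p x - 1) * `|f x| `^ p x <= l `^ (pm - 1) * h x by rewrite ler_pM ?powR_ge0.
  have tailE : tail M x = w x `^ p x by rewrite /tail indicE mem_set ?mulr1.
  rewrite /G tailE; apply: le_trans (_ : _ <= 2 * C * l `^ (pm - 1) *
    (C1 * (\1_K x + moll (mollifier d) h x) + h x) + D * w x `^ p x) _; last by rewrite lerDr.
  rewrite /D; have -> : 2 * C * l `^ (pm - 1) * (C1 * (\1_K x + moll (mollifier d) h x) + h x) +
      4 * C * l^-1 * w x `^ p x =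
      2 * C * ((l `^ (pm - 1) * (C1 * (\1_K x + moll (mollifier d) h x)) + l^-1 * w x `^ p x)
        + (l `^ (pm - 1) * h x + l^-1 * w x `^ p x)) by ring.
  rewrite ler_wpM2l ?mulr_ge0// mulrDl lerD//.
    by apply: le_trans S1 _; rewrite lerD2r.
  by apply: le_trans S2 _; rewrite lerD2r.
have L1Y : L1 (fun x => Y x * (moll (mollifier d) f x - f x)).
  apply: (L1_le _ L1G YG); apply: measurable_funM => //.
  by apply: L1_measurable; exact: L1B.
split => //; apply: (@le_trans _ _ (\int[mu]_x G x)).
  by apply: le_Rintegral => //; exact: L1_norm.
rewrite /G RintegralD//; last exact: L1Z.
rewrite RintegralD//; [|exact: L1Z..].
rewrite !RintegralZl// RintegralD// RintegralZl//; last exact: L1D.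
rewrite RintegralD// -/mK' -/Ih.
have P1 : CM * \int[mu]_x `|moll (mollifier d) f x - f x| <= e / 3.
  apply: (@le_trans _ _ ((CM + 1) * (e / 3 / (CM + 1)))).
    rewrite ler_pM ?lerDl//; first exact: Rintegral_ge0.
    by apply: d0P; rewrite dd.
  by rewrite mulrC divfK// gt_eqF// ltr_wpDl.
have mhle : \int[mu]_x moll (mollifier d) h x <= Ih.
  have -> : Ih = \int[mu]_x `|h x| by apply: eq_Rintegral => x _; rewrite ger0_norm.
  by apply: le_trans mh; rewrite le_eqVlt; apply/orP; left; apply/eqP; apply: eq_Rintegral => x _; rewrite ger0_norm.
have P2 : 2 * C * l `^ (pm - 1) * (C1 * (mK' + \int[mu]_x moll (mollifier d) h x) + Ih) <= e / 3.
  apply: le_trans lB; rewrite /B mulrAC [leRHS]mulrC ler_wpM2r ?powR_ge0//.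
  by rewrite ler_wpM2l ?mulr_ge0// lerD2r ler_wpM2l// lerD2l.
have {P1 P2 tailM} := lerD P1 (lerD P2 tailM); lra.
Qed.

End pairing.

(** * Lipschitz exponents and their distributional gradients *)

Section exponent.
Context {R : realType} {n : nat}.
Local Notation mu := (@lebesgue_rV R n).
Local Notation L1 f := (mu.-integrable setT (EFin \o f)).
Implicit Types (x y : 'rV[R]_n) (f p : 'rV[R]_n -> R) (U : set 'rV[R]_n).

Lemma ae_open_ex (P : 'rV[R]_n -> Prop) U : {ae mu, forall x, P x} -> open U -> U !=set0 ->
  exists2 x, U x & P x.
Proof.
move=> [N [mN N0 PN]] oU U0; apply: contrapT => nP.
have UN : U `<=` N.
  by move=> x Ux; apply: PN => /= Px; apply: nP; exists x.
have := lebesgue_rV_open_gt0 oU U0; rewrite ltNge => /negP; apply.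
rewrite -N0; apply: le_measure => //; rewrite inE //.
exact: measurable_rV_open.
Qed.

Lemma lebesgue_rV_setT_gt0 : (0 < mu setT)%E.
Proof. by apply: lebesgue_rV_open_gt0; [exact: openT|exists 0]. Qed.

Lemma lipschitz_continuous f (L : R) : (forall x y, `|f x - f y| <= L * `|x - y|) -> continuous f.
Proof.
move=> fL x; apply/continuous_atP => e e0; have L1 : 0 < `|L| + 1 by rewrite ltr_pwDr.
exists (e / (`|L| + 1)) => [|y]; first exact: divr_gt0.
rewrite ltr_pdivlMr// mulrC => h; apply: le_lt_trans h; apply: le_trans (fL y x) _.
by rewrite ler_wpM2r// (le_trans (ler_norm _))// lerDl.
Qed.

Lemma elipschitz_norm p : elipschitz p -> exists2 L : R, 0 <= L &
  (forall x y, `|p x - p y| <= L * `|x - y|).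
Proof.
move=> [L pL]; exists (`|L| * n%:R) => [|x y]; first by rewrite mulr_ge0.
apply: le_trans (pL x y) _; rewrite -mulrA; apply: (@le_trans _ _ (`|L| * enorm (x - y))).
  by rewrite ler_wpM2r ?enorm_ge0// ler_norm.
by rewrite ler_wpM2l// enorm_le_norm.
Qed.

(** Open sets have positive measure, so that continuity turns the essential
    bounds of p into pointwise ones. *)
Lemma bounded_exponentP p : bounded_exponent p -> continuous p ->
  1 < fine (pminus p) /\ forall x, fine (pminus p) <= p x <= fine (pplus p).
Proof.
move=> [mp pm1 ppoo] cp.
have aem : {ae mu, forall x, (pminus p <= (p x)%:E)%E} by exact: ess_inf_le.
have aep : {ae mu, forall x, ((p x)%:E <= pplus p)%E} by exact: ess_sup_ge.
have T0 : [set: 'rV[R]_n] !=set0 by exists 0.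
have [x0 _ x0m] := ae_open_ex aem openT T0.
have [x1 _ x1p] := ae_open_ex aep openT T0.
have fm : pminus p \is a fin_num.
  rewrite fin_numE; apply/andP; split; first by rewrite gt_eqF// (lt_trans _ pm1)// ltNyr.
  by rewrite lt_eqF// (le_lt_trans x0m)// ltry.
have fp : pplus p \is a fin_num.
  rewrite fin_numE; apply/andP; split; first by rewrite gt_eqF// (lt_le_trans _ x1p)// ltNyr.
  by rewrite lt_eqF.
rewrite -(fineK fm) in pm1 aem; rewrite -(fineK fp) in aep.
split; first by rewrite lte_fin in pm1.
move=> x; apply/andP; split; rewrite leNgt; apply/negP => px.
  have [y /= yx] := @ae_open_ex _ (p @^-1` [set t | t < fine (pminus p)]) aem
    (open_comp (fun x _ => cp x) (@open_lt _ _)) (ex_intro _ x px).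
  by rewrite lee_fin leNgt yx.
have [y /= yx] := @ae_open_ex _ (p @^-1` [set t | fine (pplus p) < t]) aep
  (open_comp (fun x _ => cp x) (@open_gt _ _)) (ex_intro _ x px).
by rewrite lee_fin leNgt yx.
Qed.

Lemma is_derive_le (F : 'rV[R]_n -> R) x v (D C : R) : is_derive x v F D ->
  (forall t : R, `|t| < 1 -> `|F (t *: v + x) - F x| <= C * `|t|) -> `|D| <= C.
Proof.
move=> [/cvg_ex[/= D' cD']]; have -> : 'D_v F x = D' by exact: cvg_lim.
move=> D'D FC; rewrite -D'D {D'D}; apply/ler_addgt0Pr => e e0.
have /cvgrPdist_lt /(_ _ e0) H := cD'.
near (0 : R)^' => h.
have h0 : h != 0 by near: h; exact: nbhs_dnbhs_neq.
have h1 : `|h| < 1 by near: h; exact: dnbhs0_lt.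
have := near H h; rewrite /= => Hh.
have q : `|h^-1 *: (F (h *: v + x) - F x)| <= C.
  by rewrite normrZ normfV ler_pdivrMl ?normr_gt0// mulrC FC.
have -> : D' = (D' - h^-1 *: (F (h *: v + x) - F x)) + h^-1 *: (F (h *: v + x) - F x) by rewrite subrK.
rewrite addrC (le_trans (ler_normD _ _))// lerD// ltW//.
by near: h.
Unshelve. all: by end_near. Qed.

End exponent.

Section local_mollification.
Context {R : realType} {n : nat}.
Local Notation mu := (@lebesgue_rV R n).
Local Notation L1 f := (mu.-integrable setT (EFin \o f)).
Local Notation e_ i := (delta_mx ord0 i : 'rV[R]_n).
Implicit Types (x y z : 'rV[R]_n) (d : R) (f g p u : 'rV[R]_n -> R) (K U : set 'rV[R]_n)
  (Du : 'rV[R]_n -> 'rV[R]_n).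

Lemma restrictT f K x : K x -> (f \_ K) x = f x.
Proof. by move=> Kx; rewrite patchE mem_set. Qed.

Lemma restrictF f K x : ~ K x -> (f \_ K) x = 0.
Proof. by move=> Kx; rewrite patchE memNset. Qed.

Lemma L1_restrict f K : measurable K -> mu.-integrable K (EFin \o f) <-> L1 (f \_ K).
Proof. by move=> mK; rewrite integrable_mkcond// restrict_EFin. Qed.

Lemma closed_rV_compact K : compact K -> closed K.
Proof. by move=> cK; apply: compact_closed => //; exact: norm_hausdorff. Qed.

Lemma distr_L1 U u Du K : distributional_gradient U u Du -> compact K -> K `<=` U ->
  L1 (u \_ K) /\ forall i, L1 ((fun y => Du y ord0 i) \_ K).
Proof.
move=> [lu lDu _] cK KU; have mK := measurable_rV_compact cK; split.
  by apply: (proj1 (L1_restrict u mK)); exact: lu.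
by move=> i; apply: (proj1 (L1_restrict _ mK)); exact: lDu.
Qed.

(** The translated mollifier is a test function in U whose support lies in K,
    where cutting off u and Du changes nothing. *)
Lemma is_derive_moll_distr U u Du K d x i : distributional_gradient U u Du ->
  compact K -> K `<=` U -> 0 < d -> (forall z, corner_box d z -> K (z + x)) ->
  is_derive x (e_ i) (moll (mollifier d) (u \_ K))
    (moll (mollifier d) ((fun y => Du y ord0 i) \_ K) x).
Proof.
move=> dg cK KU d0 xK; have [L1u L1Du] := distr_L1 dg cK KU.
apply: is_derive_moll_weak => //.
have xK' y : corner_box d (y - x) -> K y by move=> /xK; rewrite subrK.
have tf : test_function U (fun y => mollifier d (y - x)).
  by apply: test_function_kern_shift => // y /xK' /KU.
have [_ _ /(_ _ tf i) H] := dg.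
have psi0 y : ~ K y -> mollifier d (y - x) = 0.
  by move=> Ky; apply: mollifier_out => // /xK'.
have dpsi0 y : ~ K y -> partial i (fun y => mollifier d (y - x)) y = 0.
  move=> Ky; have [_ E] := is_derive_kern_shift (@mass R n d)^-1 d (@base_index R n) i x y.
  by rewrite /partial E; apply: kern_out_box => // /xK'.
have E g (psi : 'rV[R]_n -> R) : (forall y, ~ K y -> psi y = 0) ->
    \int[mu]_(y in U) (g y * psi y) = \int[mu]_y ((g \_ K) y * psi y).
  move=> p0; rewrite Rintegral_mkcond; apply: eq_Rintegral => y _.
  have [Ky|Ky] := pselect (K y); first by rewrite !restrictT//; exact: KU.
  by rewrite (restrictF g Ky) mul0r patchE (p0 _ Ky) mulr0; case: ifP.
by rewrite -!E.
Qed.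

Lemma continuous_moll_restrict U u Du K d : distributional_gradient U u Du ->
  compact K -> K `<=` U -> 0 < d ->
  continuous (moll (mollifier d) (u \_ K)) /\
  forall i, continuous (moll (mollifier d) ((fun y => Du y ord0 i) \_ K)).
Proof.
move=> dg cK KU d0; have [L1u L1Du] := distr_L1 dg cK KU.
by split => [|i]; exact: continuous_moll_mollifier.
Qed.

Lemma cubeP (k : nat) x : cube k x <-> `|x| <= k%:R.
Proof.
split=> [xk|]; last exact: cube_norm.
by apply: rV_norm_ler => // i; have := xk i; rewrite /= in_itv/= -ler_norml.
Qed.

Lemma cube_add (k : nat) d x z : d <= 1 -> 0 < d -> cube k x -> corner_box d z -> cube k.+1 (z + x).
Proof.
move=> d1 d0 /cubeP xk /(corner_box_norm d0) zd; apply/cubeP.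
by rewrite (le_trans (ler_normD _ _))// -natr1 addrC lerD// (le_trans zd).
Qed.

Lemma moll_lipschitz_cube p (L : R) (k : nat) d x y : (forall x y, `|p x - p y| <= L * `|x - y|) ->
  L1 (p \_ (cube k.+1)) -> 0 < d <= 1 -> cube k x -> cube k y ->
  `|moll (mollifier d) (p \_ (cube k.+1)) x - moll (mollifier d) (p \_ (cube k.+1)) y| <= L * `|x - y|.
Proof.
move=> pL L1p /andP[d0 d1] xk yk; have mp := L1_measurable L1p.
rewrite !mollE//; try exact: measurable_mollifier.
have L1x := L1_mollM_translate x d0 L1p; have L1y := L1_mollM_translate y d0 L1p.
have L1m := L1_mollifier d0.
rewrite -RintegralB//; apply: le_trans (le_normr_Rintegral _ _) _ => //; first exact: L1B.
have -> : L * `|x - y| = \int[mu]_z (L * `|x - y| * mollifier d z).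
  by rewrite RintegralZl// mollifier_integral// mulr1.
apply: le_Rintegral => //; [exact/L1_norm/L1B|exact: L1Z|move=> z _].
rewrite -mulrBl normrM [X in _ * X]ger0_norm ?mollifier_ge0//.
have [zd|/(mollifier_out d0) ->] := pselect (corner_box d z); last by rewrite !mulr0.
rewrite ler_wpM2r ?mollifier_ge0// !restrictT; try exact: (cube_add d1 d0).
by apply: le_trans (pL _ _) _; rewrite opprD addrACA subrr add0r.
Qed.

(** Mollifying p, the partial derivatives of the mollifications are bounded by the
    Lipschitz constant, and they converge in L^1 to the distributional ones. *)
Lemma lipschitz_distr_ae p Dp (L : R) i : (0 < n)%N ->
  (forall x y, `|p x - p y| <= L * `|x - y|) -> 0 <= L ->
  distributional_gradient setT p Dp -> {ae mu, forall x, `|Dp x ord0 i| <= L}.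
Proof.
move=> n0 pL L0 dg.
suff H (k : nat) : {ae mu, forall x, cube k x -> `|Dp x ord0 i| <= L}.
  apply: filterS (ae_foralln H) => x /= /(_ (Num.truncn `|x|).+1); apply.
  by apply/cubeP; rewrite ltW// truncnS_gt.
pose K : set 'rV[R]_n := cube k.+2.
have cK : compact K by exact: compact_cube.
have [L1p /(_ i) L1g] := distr_L1 dg cK (@subsetT _ _).
set g := (_ \_ K) in L1g.
have mb d x : 0 < d <= 1 -> cube k x -> `|moll (mollifier d) g x| <= L.
  move=> /andP[d0 d1] xk.
  have dx : is_derive x (e_ i) (moll (mollifier d) (p \_ K)) (moll (mollifier d) g x).
    apply: (@is_derive_moll_distr setT p Dp K d x i dg cK (@subsetT _ K) d0) => z zd.
    have /cubeP h := cube_add d1 d0 xk zd; apply/cubeP.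
    by rewrite (le_trans h)// ler_nat.
  apply: (is_derive_le dx) => t t1.
  have xk' : cube k.+1 x by move/cubeP: xk => xk; apply/cubeP; rewrite (le_trans xk)// ler_nat.
  have te : `|t *: e_ i| <= `|t| by rewrite normrZ ler_piMr// norm_delta_mx.
  apply: (@le_trans _ _ (L * `|(t *: e_ i + x) - x|)); last by rewrite addrK ler_wpM2l.
  apply: moll_lipschitz_cube => //; first by rewrite d0.
  move/cubeP: xk => xk; apply/cubeP; rewrite (le_trans (ler_normD _ _))// -natr1 addrC lerD//.
  by rewrite (le_trans te)// ltW.
have mcube (j : nat) : measurable (cube j : set 'rV[R]_n) by apply: measurable_box.
(* The excess a of |g| over L is at most the error of mollification, whose
   integral tends to 0. *)
pose a x : R := Num.max 0 (`|g x| - L) * \1_(cube k) x.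
have a0 x : 0 <= a x by rewrite /a mulr_ge0 ?indicE// le_max lexx.
have ma : measurable_fun setT a.
  apply: measurable_funM; last exact: measurable_indic.
  apply: measurable_maxr => //; apply: measurable_funB => //.
  by apply: measurableT_comp => //; exact: L1_measurable.
have ale d x : 0 < d <= 1 -> a x <= `|moll (mollifier d) g x - g x|.
  move=> d01; rewrite /a indicE; have [xk|_] := boolP (x \in cube k); last by rewrite mulr0.
  rewrite mulr1 ge_max normr_ge0/=; have := mb d x d01 (set_mem xk).
  by rewrite distrC; have := lerB_dist (g x) (moll (mollifier d) g x); lra.
have L1a : L1 a.
  apply: (L1_le ma (L1_norm L1g)) => x; rewrite ger0_norm// /a indicE.
  case: (x \in _); rewrite ?mulr0 ?mulr1// ge_max normr_ge0/=.
  by rewrite lerBlDr lerDl.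
have Ia : \int[mu]_x a x = 0.
  apply/eqP; rewrite eq_le Rintegral_ge0 ?andbT//; apply/ler_addgt0Pr => e e0; rewrite add0r.
  have [d0 d00 H] := moll_cvg1 n0 L1g e0.
  pose d := Num.min (d0 / 2) 1.
  have dd : 0 < d by rewrite lt_min ltr01 divr_gt0.
  have dd0 : d < d0 by rewrite gt_min ltr_pdivrMr// ltr_pMr// ltr1n.
  have [L1mg _] := moll_L1 dd L1g.
  apply: le_trans (H d _); last by rewrite dd.
  apply: le_Rintegral => //; first by apply: L1_norm; exact: L1B.
  by move=> x _; apply: ale; rewrite dd ge_min lexx orbT.
have : ae_eq mu setT (EFin \o a) (cst 0%E).
  apply/ae_eq_integral_abs => //; first exact/measurable_EFinP.
  under eq_integral do rewrite gee0_abs ?lee_fin//.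
  by rewrite -(fineK (integrable_fin_num measurableT L1a)); congr EFin.
apply: filterS => x /= /(_ I) [ax] xk.
have xK : K x by move/cubeP: xk => xk; apply/cubeP; rewrite (le_trans xk)// ler_nat -addn2 leq_addr.
move: ax; rewrite /a indicE mem_set// mulr1 => ax.
have : `|g x| - L <= 0 by rewrite -ax le_max lexx orbT.
by rewrite subr_le0 /g restrictT.
Qed.

(** The essential supremum of |Dp| is finite by [lipschitz_distr_ae], so that fine
    loses nothing. *)
Lemma Linfty_norm_ae p Dp (L : R) : (0 < n)%N ->
  (forall x y, `|p x - p y| <= L * `|x - y|) -> 0 <= L ->
  distributional_gradient setT p Dp ->
  0 <= fine (Linfty_norm Dp) /\ {ae mu, forall x, enorm (Dp x) <= fine (Linfty_norm Dp)}.
Proof.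
move=> n0 pL L0 dg.
have E : Linfty_norm Dp = ess_sup mu (EFin \o enorm \o Dp).
  rewrite /Linfty_norm unlock lebesgue_rV_setT_gt0; congr ess_sup.
  by apply/funext => x /=; rewrite ger0_norm// enorm_ge0.
have foo : (ess_sup mu (EFin \o enorm \o Dp) <= (n%:R * L)%:E)%E.
  apply/ess_supP.
  have : {ae mu, forall x, forall i, `|Dp x ord0 i| <= L}.
    by apply: filter_forall => i; exact: lipschitz_distr_ae pL L0 dg.
  apply: filterS => x /= h; rewrite lee_fin (le_trans (enorm_le_norm _))// ler_wpM2l//.
  exact: rV_norm_ler.
have ge0 : (0 <= ess_sup mu (EFin \o enorm \o Dp))%E.
  by apply: ess_sup_ger => [|t]; [exact: lebesgue_rV_setT_gt0|rewrite lee_fin enorm_ge0].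
have fn : ess_sup mu (EFin \o enorm \o Dp) \is a fin_num.
  by rewrite ge0_fin_numE// (le_lt_trans foo)// ltry.
rewrite E; split; first exact: fine_ge0.
have := ess_sup_ge mu (EFin \o enorm \o Dp); apply: filterS => x /=.
by rewrite -{1}(fineK fn) lee_fin.
Qed.

End local_mollification.

(** * The barrier and its flux *)

Section local_ibp.
Context {R : realType} {n : nat}.
Local Notation mu := (@lebesgue_rV R n).
Local Notation L1 f := (mu.-integrable setT (EFin \o f)).
Implicit Types (f h X phi : 'rV[R]_n -> R) (dX dphi : 'I_n -> 'rV[R]_n -> R) (O K : set 'rV[R]_n).

Lemma continuous_glue O K f : open O -> closed K -> K `<=` O ->
  (forall x, O x -> {for x, continuous f}) -> (forall x, ~ K x -> f x = 0) -> continuous f.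
Proof.
move=> oO cK KO cf f0 x; have [Kx|Kx] := pselect (K x); first exact/cf/KO.
have nK : \near x, (~` K) x by apply: open_nbhs_nbhs; split => //; exact: closed_openC.
apply: (@near_continuous _ _ (fun=> 0)); last exact: cst_continuous.
by apply: filterS nK => y /f0.
Qed.

(** The field X is of class C^1 near the support of phi only, because the flux of
    the barrier is singular at the critical point y0. *)
Lemma ibp_local O K X dX phi dphi i : open O -> compact K -> K `<=` O ->
  C1on O X dX -> C1on setT phi dphi -> (forall x, ~ K x -> phi x = 0) ->
  [/\ L1 (fun x => X x * dphi i x), L1 (fun x => dX i x * phi x) &
  \int[mu]_x (X x * dphi i x) = - \int[mu]_x (dX i x * phi x)].
Proof.
move=> oO cK KO cX cphi phi0.
have clK := closed_rV_compact cK.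
have dphi0 := C1_support_deriv clK cphi phi0.
have L1a : L1 (fun x => X x * dphi i x).
  apply: (@L1_compact_support _ _ (fun x => X x * dphi i x) K) => //; last by move=> x /dphi0 ->; rewrite mulr0.
  apply: (continuous_glue oO clK KO) => [x Ox|x /dphi0 ->]; last by rewrite mulr0.
  apply: (@continuousM _ _ X (dphi i)); first by have [] := cX x Ox.
  by have [] := cphi x I.
have L1b : L1 (fun x => dX i x * phi x).
  apply: (@L1_compact_support _ _ (fun x => dX i x * phi x) K) => //; last by move=> x /phi0 ->; rewrite mulr0.
  apply: (continuous_glue oO clK KO) => [x Ox|x /phi0 ->]; last by rewrite mulr0.
  apply: (@continuousM _ _ (dX i) phi); first by have [] := cX x Ox.
  by have [] := cphi x I.
split => //.
pose h x := X x * phi x; pose dh j x := X x * dphi j x + phi x * dX j x.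
have ch : C1on setT h dh.
  have cphiO : C1on O phi dphi by apply: C1onS cphi.
  apply: (C1on_glue oO clK KO (C1onM cX cphiO)) => //.
    by move=> x /phi0 hx; rewrite /h hx mulr0.
  by move=> j x Kx; rewrite /dh phi0// dphi0// mulr0 mul0r addr0.
have h0 x : ~ K x -> h x = 0 by move=> /phi0 hx; rewrite /h hx mulr0.
have := integral_partial0 i cK ch h0; rewrite /dh.
under eq_Rintegral do rewrite [X in _ + X]mulrC.
by rewrite RintegralD// => /eqP; rewrite addr_eq0 => /eqP.
Qed.

End local_ibp.

Section barrier.
Context {R : realType} {n : nat}.
Variables (y0 : 'rV[R]_n) (rho a k : R).
Hypotheses (rho0 : 0 < rho) (a0 : 0 < a) (k1 : 1 <= k).
Implicit Types (x : 'rV[R]_n).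

Definition sqd x : R := dot (x - y0) (x - y0).
Definition bar_ratio x : R := sqd x / rho ^+ 2.
(** For a = 2 S and large k this function vanishes on the sphere of radius rho
    about y0, is at least S on the sphere of radius 2 rho, and it is a strict
    supersolution in between. *)
Definition barrier x : R := a * (1 - expR (- (k * (bar_ratio x - 1)))).
Definition bar_factor x : R := 2 * a * k / rho ^+ 2 * expR (- (k * (bar_ratio x - 1))).
Definition bar_grad x : 'rV[R]_n := bar_factor x *: (x - y0).
(** The logarithm of |bar_grad|.  Writing powers of the gradient as exponentials
    of bar_log makes their dependence on the exponent differentiable. *)
Definition bar_log x : R := ln (2 * a * k / rho ^+ 2) - k * (bar_ratio x - 1) + 2^-1 * ln (sqd x).

Let k0 : 0 < k. Proof. exact: lt_le_trans k1. Qed.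
Let c0 : 0 < 2 * a * k / rho ^+ 2. Proof. by rewrite divr_gt0 ?exprn_gt0// !mulr_gt0. Qed.

Lemma bar_factor_gt0 x : 0 < bar_factor x.
Proof. by rewrite mulr_gt0 ?expR_gt0. Qed.

Lemma sqd_gt0 x : x != y0 -> 0 < sqd x.
Proof.
move=> xy; rewrite /sqd -enorm_sqr exprn_gt0// lt_def enorm_ge0 andbT.
by apply: contra_neq xy => /enorm_eq0/eqP; rewrite subr_eq0 => /eqP.
Qed.

Lemma enorm_bar_grad x : x != y0 -> enorm (bar_grad x) = expR (bar_log x).
Proof.
move=> xy; have s0 := sqd_gt0 xy.
rewrite enormZ gtr0_norm ?bar_factor_gt0// /bar_log !expRD lnK ?posrE//.
congr (_ * _); rewrite /enorm -/(sqd x).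
apply/eqP; rewrite -(@eqrXn2 _ 2) ?sqrtr_ge0 ?expR_ge0//.
by rewrite sqr_sqrtr ?ltW// -expRM_natl mulrA mulfV// mul1r lnK// posrE.
Qed.

Lemma pflux_bar q x : x != y0 ->
  pflux q (bar_grad x) = (expR ((q - 2) * bar_log x) * bar_factor x) *: (x - y0).
Proof.
move=> xy; rewrite /pflux enorm_bar_grad// /bar_grad scalerA; congr (_ * _ *: _).
by rewrite /powR gt_eqF ?expR_gt0// expRK.
Qed.

Definition dsqd (i : 'I_n) x : R := 2 * (x - y0) ord0 i.

Lemma C1_coord j : C1on setT (fun x => (x - y0) ord0 j) (fun i _ => (i == j)%:R).
Proof.
move=> x _; split.
- apply: (@continuous_comp _ _ _ (fun x => x - y0) (fun x : 'rV[R]_n => x ord0 j)).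
    exact: continuous_subr.
  exact: coord_continuous.
- move=> i; apply: is_derive_of_line.
  rewrite (_ : (fun _ => _) = fun t : R => (i == j)%:R * t + (x - y0) ord0 j).
    by apply: is_derive_eq; rewrite addr0 /GRing.scale/= mulr1.
  by apply/funext => t; rewrite -addrA !mxE eqxx/= mulrC eq_sym.
- by move=> i; exact: cst_continuous.
Qed.

Lemma C1on_ext (O : set 'rV[R]_n) f df g dg : C1on O f df -> f = g -> df = dg -> C1on O g dg.
Proof. by move=> ? <- <-. Qed.

Lemma C1on_sum (I : Type) (r : seq I) (F : I -> 'rV[R]_n -> R) dF O :
  (forall j, C1on O (F j) (dF j)) ->
  C1on O (fun x => \sum_(j <- r) F j x) (fun i x => \sum_(j <- r) dF j i x).
Proof.
move=> cF; elim: r => [|j r IH].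
  apply: (C1on_ext (@C1on_cst R n O 0)); first by apply/funext => x; rewrite big_nil.
  by apply/funext => i; apply/funext => x; rewrite big_nil.
apply: (C1on_ext (C1onD (cF j) IH)); first by apply/funext => x; rewrite big_cons.
by apply/funext => i; apply/funext => x; rewrite big_cons.
Qed.

Lemma C1_sqd : C1on setT sqd dsqd.
Proof.
have := C1on_sum (index_enum 'I_n) (fun j => C1onM (C1_coord j) (C1_coord j)).
move=> /C1on_ext; apply; first by [].
apply/funext => i; apply/funext => x; rewrite /dsqd (bigD1 i)//= eqxx big1.
  by rewrite addr0 mulr1; ring.
by move=> j ji; rewrite eq_sym (negbTE ji) mulr0 addr0.
Qed.

Lemma C1_expB : C1on setT (fun x => expR (- (k * (bar_ratio x - 1))))
  (fun i x => expR (- (k * (bar_ratio x - 1))) * (- (k / rho ^+ 2) * dsqd i x)).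
Proof.
pose f x := - (k / rho ^+ 2) * sqd x + k.
have cf : C1on setT f (fun i x => - (k / rho ^+ 2) * dsqd i x + 0).
  by apply: C1onD; [exact: C1onZ C1_sqd|exact: C1on_cst].
have fE x : f x = - (k * (bar_ratio x - 1)) by rewrite /f /bar_ratio; ring.
have := C1on_comp (g := expR) (dg := expR) cf.
move=> /(_ (fun x _ => is_derive_expR _) (fun x _ => @continuous_expR R _)).
move=> /C1on_ext; apply; first by apply/funext => x /=; rewrite fE.
by apply/funext => i; apply/funext => x; rewrite fE addr0.
Qed.

Lemma C1_barrier : C1on setT barrier (fun i x => bar_grad x ord0 i).
Proof.
have := C1onZ a (C1onB (@C1on_cst R n setT 1) C1_expB).
move=> /C1on_ext; apply; first by [].
apply/funext => i; apply/funext => x; rewrite /bar_grad /bar_factor /dsqd [RHS]mxE.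
by field; rewrite gt_eqF.
Qed.

Lemma C1_bar_factor : C1on setT bar_factor (fun i x => bar_factor x * (- (k / rho ^+ 2) * dsqd i x)).
Proof.
have := C1onZ (2 * a * k / rho ^+ 2) C1_expB.
move=> /C1on_ext; apply; first by [].
by apply/funext => i; apply/funext => x; rewrite /bar_factor mulrA.
Qed.

Lemma C1_bar_log : C1on [set x | x != y0] bar_log
  (fun i x => - (k / rho ^+ 2) * dsqd i x + 2^-1 * ((sqd x)^-1 * dsqd i x)).
Proof.
have C1a : C1on [set x | x != y0] (fun x => ln (2 * a * k / rho ^+ 2) + k + - (k / rho ^+ 2) * sqd x)
    (fun i x => 0 + - (k / rho ^+ 2) * dsqd i x).
  apply: (C1onS (@subsetT _ _)); apply: C1onD; [exact: C1on_cst|exact: C1onZ C1_sqd].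
have C1b : C1on [set x | x != y0] (@ln R \o sqd) (fun i x => (sqd x)^-1 * dsqd i x).
  apply: (C1on_comp (C1onS (@subsetT _ _) C1_sqd)) => x /= xy.
    by apply: is_derive1_ln; exact: sqd_gt0.
  by apply: inv_continuous; rewrite gt_eqF// sqd_gt0.
have := C1onD C1a (C1onZ 2^-1 C1b).
move=> /C1on_ext; apply.
  by apply/funext => x; rewrite /bar_log /bar_ratio /=; ring.
by apply/funext => i; apply/funext => x; rewrite add0r.
Qed.

End barrier.

Section moll_gradient_bound.
Context {R : realType} {n : nat}.
Local Notation mu := (@lebesgue_rV R n).
Local Notation L1 f := (mu.-integrable setT (EFin \o f)).
Implicit Types (x y xi : 'rV[R]_n) (d : R) (f : 'rV[R]_n -> R) (K : set 'rV[R]_n)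
  (Dp : 'rV[R]_n -> 'rV[R]_n).

Lemma Rintegral_sum (I : Type) (r : seq I) (F : I -> 'rV[R]_n -> R) : (forall i, L1 (F i)) ->
  \int[mu]_x (\sum_(i <- r) F i x) = \sum_(i <- r) \int[mu]_x F i x.
Proof.
move=> L1F; elim: r => [|i r IH].
  by under eq_Rintegral do rewrite big_nil; rewrite big_nil Rintegral_cst// mul0r.
rewrite big_cons -IH -RintegralD//; last exact: L1_sum.
by apply: eq_Rintegral => x _; rewrite big_cons.
Qed.

Lemma Rintegral_ge0_ae f : L1 f -> {ae mu, forall x, 0 <= f x} -> 0 <= \int[mu]_x f x.
Proof.
move=> L1f f0; have mf := L1_measurable L1f.
have -> : \int[mu]_x f x = \int[mu]_x `|f x|; last exact: Rintegral_ge0.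
congr fine; apply: ae_eq_integral => //; first exact/measurable_EFinP.
  by apply/measurable_EFinP; exact: measurableT_comp.
by apply: filterS f0 => x f0 _; rewrite ger0_norm.
Qed.

(** An average of vectors of length at most L has length at most L.  Applied to
    Dp, this keeps the constant L when p is mollified. *)
Lemma moll_grad_dot Dp K (L : R) d x xi : 0 < d -> 0 <= L ->
  (forall i, L1 ((fun y => Dp y ord0 i) \_ K)) ->
  {ae mu, forall y, enorm (Dp y) <= L} ->
  \sum_i moll (mollifier d) ((fun y => Dp y ord0 i) \_ K) x * xi ord0 i <= L * enorm xi.
Proof.
move=> d0 L0 L1D aeD.
have L1i i : L1 (fun y => ((fun y => Dp y ord0 i) \_ K) y * mollifier d (y - x) * xi ord0 i).
  have := L1Z (xi ord0 i) (L1_mollM x d0 (L1D i)); apply: eq_integrable => //.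
  by move=> y _ /=; rewrite mulrC.
have -> : \sum_i moll (mollifier d) ((fun y => Dp y ord0 i) \_ K) x * xi ord0 i =
    \int[mu]_y (\sum_i ((fun y => Dp y ord0 i) \_ K) y * mollifier d (y - x) * xi ord0 i).
  rewrite Rintegral_sum//; apply: eq_bigr => i _; rewrite RintegralZr//.
  exact: L1_mollM.
have L1k : L1 (fun y => mollifier d (y - x)).
  by have := integrable_translate (- x) (@L1_mollifier R n d d0); apply: eq_integrable.
have -> : L * enorm xi = \int[mu]_y (L * enorm xi * mollifier d (y - x)).
  rewrite RintegralZl// (Rintegral_translate (- x)) ?mollifier_integral ?mulr1//.
  exact: measurable_mollifier.
rewrite -subr_ge0 -RintegralB//; [|exact: L1Z|exact: L1_sum].
apply: Rintegral_ge0_ae; first by apply: L1B; [exact: L1Z|exact: L1_sum].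
apply: filterS aeD => y Dy; rewrite subr_ge0.
have -> : \sum_i ((fun y => Dp y ord0 i) \_ K) y * mollifier d (y - x) * xi ord0 i =
    (\sum_i ((fun y => Dp y ord0 i) \_ K) y * xi ord0 i) * mollifier d (y - x).
  by rewrite mulr_suml; apply: eq_bigr => i _; rewrite mulrAC.
rewrite ler_wpM2r ?mollifier_ge0//.
have [Ky|Ky] := pselect (K y); last first.
  by rewrite big1 ?mulr_ge0 ?enorm_ge0// => i _; rewrite restrictF// mul0r.
under eq_bigr do rewrite restrictT//.
by rewrite (le_trans (cauchy_schwarz (Dp y) xi))// ler_wpM2r// enorm_ge0.
Qed.

Lemma moll_grad_normr Dp K (L : R) d x xi : 0 < d -> 0 <= L ->
  (forall i, L1 ((fun y => Dp y ord0 i) \_ K)) ->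
  {ae mu, forall y, enorm (Dp y) <= L} ->
  `|\sum_i moll (mollifier d) ((fun y => Dp y ord0 i) \_ K) x * xi ord0 i| <= L * enorm xi.
Proof.
move=> d0 L0 L1D aeD; rewrite ler_norml moll_grad_dot// andbT lerNl.
have := moll_grad_dot x (- xi) d0 L0 L1D aeD; rewrite enormN; apply: le_trans.
by rewrite -sumrN le_eqVlt; apply/orP; left; apply/eqP/eq_bigr => i _; rewrite !mxE mulrN.
Qed.

End moll_gradient_bound.

Section supersolution.
Context {R : realType} {n : nat}.
Local Notation mu := (@lebesgue_rV R n).
Local Notation L1 f := (mu.-integrable setT (EFin \o f)).
Variables (y0 : 'rV[R]_n) (rho a k : R).
Hypotheses (rho0 : 0 < rho) (a0 : 0 < a) (k1 : 1 <= k).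
Implicit Types (x : 'rV[R]_n) (q p : 'rV[R]_n -> R) (O K : set 'rV[R]_n).
Local Notation sqd := (@sqd R n y0).
Local Notation bar_ratio := (@bar_ratio R n y0 rho).
Local Notation bar_factor := (@bar_factor R n y0 rho a k).
Local Notation bar_log := (@bar_log R n y0 rho a k).
Local Notation bar_grad := (@bar_grad R n y0 rho a k).
Local Notation dsqd := (@dsqd R n y0).

(** The i-th component of |bar_grad|^(q(x) - 2) bar_grad, away from y0. *)
Definition bar_flux q i x : R := expR ((q x - 2) * bar_log x) * (bar_factor x * (x - y0) ord0 i).

Definition bar_flux_deriv q (dq : 'I_n -> 'rV[R]_n -> R) i j x : R :=
  expR ((q x - 2) * bar_log x) *
    (bar_factor x * (j == i)%:R + (x - y0) ord0 i * (bar_factor x * (- (k / rho ^+ 2) * dsqd j x))) +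
  bar_factor x * (x - y0) ord0 i * (expR ((q x - 2) * bar_log x) *
    ((q x - 2) * (- (k / rho ^+ 2) * dsqd j x + 2^-1 * ((sqd x)^-1 * dsqd j x)) +
     bar_log x * dq j x)).

Lemma C1_bar_flux q dq O i : C1on O q dq -> O `<=` [set x | x != y0] ->
  C1on O (bar_flux q i) (bar_flux_deriv q dq i).
Proof.
move=> cq Oy.
have cl : C1on O bar_log _ := C1onS Oy (@C1_bar_log R n y0 rho a k).
have cm : C1on O bar_factor _ := C1onS (@subsetT _ _) (C1_bar_factor y0 rho a k).
have cc : C1on O (fun x => (x - y0) ord0 i) _ := C1onS (@subsetT _ _) (C1_coord y0 i).
have cql := C1onM (C1onB cq (@C1on_cst R n O 2)) cl.
have ce := C1on_comp (g := expR) (dg := expR) cql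
  (fun x _ => is_derive_expR _) (fun x _ => @continuous_expR R _).
have := C1onM ce (C1onM cm cc).
move=> /C1on_ext; apply; first by [].
apply/funext => j; apply/funext => x; rewrite /bar_flux_deriv/= subr0.
by [].
Qed.

(** The divergence of the flux for a smooth exponent q.  The last term, of order
    - 2 k (q - 1), is the one that wins for large k. *)
Lemma bar_div q dq x : x != y0 ->
  \sum_i bar_flux_deriv q dq i i x =
  expR ((q x - 2) * bar_log x) * bar_factor x *
  (bar_log x * (\sum_i dq i x * (x - y0) ord0 i) + n%:R + (q x - 2) - (q x - 1) * (2 * k * bar_ratio x)).
Proof.
move=> xy; have s0 := sqd_gt0 xy.
set E := expR _; set m := bar_factor x; set l := bar_log x.
pose al := (q x - 2) * (- (2 * k / rho ^+ 2) + (sqd x)^-1) - 2 * k / rho ^+ 2.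
have H i : bar_flux_deriv q dq i i x = E * m *
    (al * ((x - y0) ord0 i * (x - y0) ord0 i) + l * (dq i x * (x - y0) ord0 i) + 1).
  rewrite /bar_flux_deriv -/E -/m -/l eqxx /dsqd /al /=.
  move: ((x - y0) ord0 i) (dq i x) s0 => yi dqi s0.
  by field; rewrite !gt_eqF.
rewrite (eq_bigr _ (fun i _ => H i)) -mulr_sumr; congr (_ * _).
rewrite !big_split/= -!mulr_sumr sumr_const card_ord.
have -> : \sum_(i < n) (x - y0) ord0 i * (x - y0) ord0 i = sqd x by [].
by rewrite /al /bar_ratio; field; rewrite !gt_eqF.
Qed.

(** A bound for the logarithm of the slope of the barrier in the annulus. *)
Definition bar_Lambda : R := `|ln (2 * a * k / rho)| + 3 * k + 2.

Lemma bar_log_bound x : rho ^+ 2 <= sqd x <= 4 * rho ^+ 2 -> `|bar_log x| <= bar_Lambda.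
Proof.
move=> /andP[s1 s2]; have k0 : 0 < k by exact: lt_le_trans k1.
have r2 : 0 < rho ^+ 2 by rewrite exprn_gt0.
have sp : 0 < sqd x by exact: lt_le_trans s1.
have bs1 : 1 <= bar_ratio x by rewrite /bar_ratio ler_pdivlMr// mul1r.
have bs4 : bar_ratio x <= 4 by rewrite /bar_ratio ler_pdivrMr.
have bs0 : 0 < bar_ratio x by exact: lt_le_trans bs1.
have E : bar_log x = ln (2 * a * k / rho) - k * (bar_ratio x - 1) + 2^-1 * ln (bar_ratio x).
  rewrite /bar_log /bar_ratio; have A0 : 0 < 2 * a * k by rewrite !mulr_gt0.
  rewrite !ln_div ?posrE// lnXn//.
  by move: (ln _) (ln _) => u v; rewrite -mulr_natl; field; rewrite gt_eqF.
have l0 : 0 <= ln (bar_ratio x) by exact: ln_ge0.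
have l4 : ln (bar_ratio x) <= 4 by rewrite (le_trans (ltW (ln_sublinear bs0))).
have kb : 0 <= k * (bar_ratio x - 1) <= 3 * k.
  apply/andP; split; first by rewrite mulr_ge0 ?subr_ge0// ltW.
  by rewrite mulrC ler_wpM2r ?(ltW k0)// lerBlDr; lra.
rewrite E /bar_Lambda; have := ler_norm (ln (2 * a * k / rho)).
have := ler_norm (- ln (2 * a * k / rho)); rewrite normrN.
move: kb => /andP[]; move: (ln _) (`|_|) (k * (bar_ratio x - 1)) l0 l4 => u v w.
by move=> h1 h2 h3 h4 h5 h6; rewrite ler_norml; apply/andP; split; lra.
Qed.

Definition bar_kappa (P : R) : R :=
  expR (- ((P + 2) * bar_Lambda)) * (2 * a * k / rho ^+ 2 * expR (- (3 * k))).

Lemma bar_Lambda_ge0 : 0 <= bar_Lambda.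
Proof. by rewrite /bar_Lambda !addr_ge0// mulr_ge0// (le_trans _ k1). Qed.

Lemma bar_kappa_gt0 P : 0 < bar_kappa P.
Proof.
by rewrite mulr_gt0 ?expR_gt0// mulr_gt0 ?expR_gt0// divr_gt0 ?exprn_gt0// !mulr_gt0// (lt_le_trans _ k1).
Qed.

(** In the annulus the bracket in [bar_div] is at most -1: the gradient of the
    exponent contributes at most 2 bar_Lambda L rho, and the hypothesis on k
    absorbs this and the dimension. *)
Lemma bar_div_le q dq x (L pm P : R) : rho ^+ 2 <= sqd x <= 4 * rho ^+ 2 ->
  1 < pm -> pm <= q x <= P -> 0 <= L ->
  `|\sum_i dq i x * (x - y0) ord0 i| <= L * enorm (x - y0) ->
  2 * bar_Lambda * L * rho + n%:R <= (pm - 1) * (2 * k - 1) ->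
  \sum_i bar_flux_deriv q dq i i x <= - bar_kappa P.
Proof.
move=> /[dup] sx /andP[s1 s2] pm1 /andP[q1 q2] L0 dqL H.
have k0 : 0 < k by exact: lt_le_trans k1.
have r2 : 0 < rho ^+ 2 by rewrite exprn_gt0.
have sp : 0 < sqd x by exact: lt_le_trans s1.
have xy : x != y0 by apply: contraTneq sp => ->; rewrite /sqd subrr dot0l ltxx.
rewrite bar_div//.
have bs1 : 1 <= bar_ratio x by rewrite /bar_ratio ler_pdivlMr// mul1r.
have bs4 : bar_ratio x <= 4 by rewrite /bar_ratio ler_pdivrMr.
have lb := bar_log_bound sx.
have xr : enorm (x - y0) <= 2 * rho.
  rewrite -(@ler_pXn2r _ 2) ?nnegrE ?enorm_ge0 ?mulr_ge0 ?(ltW rho0)//.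
  by rewrite enorm_sqr exprMn (le_trans s2)// -natrX.
have T1 : bar_log x * (\sum_i dq i x * (x - y0) ord0 i) <= 2 * bar_Lambda * L * rho.
  apply: le_trans (ler_norm _) _; rewrite normrM.
  have -> : 2 * bar_Lambda * L * rho = bar_Lambda * (L * (2 * rho)) by ring.
  by rewrite ler_pM// (le_trans dqL)// ler_wpM2l.
have T2 : (pm - 1) * (2 * k - 1) <= (q x - 1) * (2 * k * bar_ratio x - 1).
  have kk : k <= k * bar_ratio x by rewrite ler_pMr.
  by apply: ler_pM; move: pm1 k1; lra.
have T3 : bar_log x * (\sum_i dq i x * (x - y0) ord0 i) + n%:R + (q x - 2) - (q x - 1) * (2 * k * bar_ratio x) <= -1.
  have -> : bar_log x * (\sum_i dq i x * (x - y0) ord0 i) + n%:R + (q x - 2) - (q x - 1) * (2 * k * bar_ratio x)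
    = (bar_log x * (\sum_i dq i x * (x - y0) ord0 i) + n%:R) - (q x - 1) * (2 * k * bar_ratio x - 1) - 1 by ring.
  have := le_trans (lerD T1 (lexx n%:R)) (le_trans H T2); lra.
have Ep : bar_kappa P <= expR ((q x - 2) * bar_log x) * bar_factor x.
  rewrite /bar_kappa ler_pM ?expR_ge0//.
  - by rewrite mulr_ge0 ?expR_ge0// divr_ge0 ?(ltW r2)// !mulr_ge0// ltW.
  - rewrite ler_expR lerNl -mulNr (le_trans (ler_norm _))// normrM.
    rewrite normrN ler_pM// ler_norml; apply/andP; split; lra.
  - rewrite /bar_factor ler_wpM2l ?divr_ge0 ?(ltW r2) ?mulr_ge0 ?(ltW a0) ?(ltW k0)//.
    by rewrite ler_expR lerN2 mulrC ler_wpM2r ?(ltW k0)// lerBlDr; lra.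
set A := expR _ * _ in Ep *; set B := (X in _ * X <= _).
have A0 : 0 <= A by rewrite mulr_ge0 ?expR_ge0// ltW// bar_factor_gt0.
apply: (@le_trans _ _ (A * -1)); first by rewrite ler_wpM2l.
by rewrite mulrN1 lerN2.
Qed.

Lemma expR_lip (u v M : R) : u <= M -> v <= M -> `|expR u - expR v| <= expR M * `|u - v|.
Proof.
wlog uv : u v / v <= u.
  move=> H uM vM; have [|/ltW] := leP v u; first by move=> /H; exact.
  by rewrite distrC [X in _ * X]distrC => /H; exact.
move=> uM vM; rewrite !ger0_norm ?subr_ge0 ?ler_expR//.
have -> : expR v = expR u * expR (v - u) by rewrite -expRD addrC subrK.
have := expR_ge1Dx (v - u) => h; rewrite -[X in X - _]mulr1 -mulrBr.
by rewrite ler_pM ?expR_ge0 ?ler_expR// ?subr_ge0 -?expR0 ?ler_expR ?subr_le0//; rewrite ?expR0; lra.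
Qed.

(** The exponent p is only Lipschitz, so that the flux has no classical divergence.
    For a mollified exponent, integration by parts and [bar_div_le] give the
    inequality; the flux depends on the exponent in a Lipschitz way, uniformly on
    K, which allows the scale d to tend to 0. *)
Lemma barrier_supersolution p (Dp : 'rV[R]_n -> 'rV[R]_n) (L L' pm P : R) phi dphi K :
  distributional_gradient setT p Dp ->
  (forall x y, `|p x - p y| <= L' * `|x - y|) -> 0 <= L' ->
  {ae mu, forall x, enorm (Dp x) <= L} -> 0 <= L ->
  1 < pm -> (forall x, pm <= p x <= P) ->
  2 * bar_Lambda * L * rho + n%:R <= (pm - 1) * (2 * k - 1) ->
  compact K -> (forall x, K x -> rho ^+ 2 <= sqd x <= 4 * rho ^+ 2) ->
  C1on setT phi dphi -> (forall x, ~ K x -> phi x = 0) -> (forall x, 0 <= phi x) ->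
  (forall i, L1 (fun x => pflux (p x) (bar_grad x) ord0 i * dphi i x)) /\
  bar_kappa P * \int[mu]_x phi x <=
    \sum_i \int[mu]_x (pflux (p x) (bar_grad x) ord0 i * dphi i x).
Proof.
move=> dg pL L'0 aeD L0 pm1 pP H cK Ks cphi phi0 phi_ge0.
have k0 : 0 < k by exact: lt_le_trans k1.
have [M [_ MK]] := compact_bounded cK.
pose N := (Num.truncn (`|M| + 1)).+1.
pose KN : set 'rV[R]_n := cube N.+2.
have cKN : compact KN by exact: compact_cube.
have [L1p L1D] := distr_L1 dg cKN (@subsetT _ KN).
(* On O the cut-off of p to KN is invisible at scales d <= 1, and the critical
   point of the barrier is removed. *)
pose O := [set x : 'rV[R]_n | `|x| < N.+1%:R] `&` [set x | x != y0].
have oO : open O.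
  apply: openI; first exact: open_ball0.
  rewrite (_ : [set x | x != y0] = ~` [set y0]); last by apply/seteqP; split=> x /eqP.
  by apply: closed_openC; apply: closed_rV_compact; exact: compact_set1.
have KO : K `<=` O.
  move=> x Kx; split => /=.
    have : `|x| <= `|M| + 1 by apply: (MK (`|M| + 1)) => //; rewrite ltr_pwDr// ler_norm.
    move/le_lt_trans; apply; apply: lt_le_trans (truncnS_gt _) _; by rewrite ler_nat.
  have /andP[s1 _] := Ks x Kx; apply: contraTneq s1 => ->.
  by rewrite /sqd subrr dot0l -ltNge exprn_gt0.
have clK := closed_rV_compact cK.
have [L1phi L1dphi] := C1_support_L1 cK cphi phi0.
have dphi0 := C1_support_deriv clK cphi phi0.
have cp : continuous p by exact: lipschitz_continuous pL.
have OcN x z d : O x -> 0 < d <= 1 -> corner_box d z -> KN (z + x).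
  by move=> [xO _] /andP[d0 d1]; apply: cube_add => //; apply/cubeP/ltW.
pose q d := moll (mollifier d) (p \_ KN).
pose dq d i := moll (mollifier d) ((fun y => Dp y ord0 i) \_ KN).
have cq d : 0 < d <= 1 -> C1on O (q d) (dq d).
  move=> /[dup] d01 /andP[d0 _] x Ox; have [cq1 cq2] := continuous_moll_restrict dg cKN (@subsetT _ KN) d0.
  split; [exact: cq1| |by move=> i; exact: cq2].
  move=> i; apply: (@is_derive_moll_distr _ _ setT p Dp KN d x i dg cKN (@subsetT _ KN) d0) => z.
  exact: OcN.
have qP d x : 0 < d <= 1 -> O x -> pm <= q d x <= P.
  move=> /[dup] d01 /andP[d0 _] Ox.
  have : `|q d x - (pm + P) / 2| <= (P - pm) / 2.
    apply: moll_close => // z zd; rewrite restrictT; last exact: OcN zd.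
    by have /andP[h1 h2] := pP (z + x); rewrite ler_norml; apply/andP; split; lra.
  by rewrite ler_norml => /andP[h1 h2]; apply/andP; split; lra.
have qp d x : 0 < d <= 1 -> O x -> `|q d x - p x| <= L' * d.
  move=> /[dup] d01 /andP[d0 _] Ox; apply: moll_close => // z zd.
  rewrite restrictT; last exact: OcN zd.
  by apply: le_trans (pL _ _) _; rewrite addrK ler_wpM2l// corner_box_norm.
have fluxE x i : x != y0 -> pflux (p x) (bar_grad x) ord0 i = bar_flux p i x.
  by move=> xy; rewrite pflux_bar// [LHS]mxE /bar_flux -mulrA.
have cflux i x : O x -> {for x, continuous (fun x => pflux (p x) (bar_grad x) ord0 i)}.
  move=> Ox; have [_ /= xy] := Ox.
  apply: (@near_continuous _ _ (bar_flux p i)).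
    have nO : \near x, O x by apply: open_nbhs_nbhs.
    by apply: filterS nO => y [_ yy]; rewrite fluxE.
  have [cl _ _] := C1_bar_log rho a k xy.
  apply: (@continuousM _ _ (fun x => expR ((p x - 2) * bar_log x)) (fun x => bar_factor x * (x - y0) ord0 i)).
    apply: (@continuous_comp _ _ _ (fun x => (p x - 2) * bar_log x) (@expR R)); last exact: continuous_expR.
    apply: (@continuousM _ _ (fun x => p x - 2) bar_log) => //.
    by apply: (@continuousB _ _ _ p (cst 2)); [exact: cp|exact: cst_continuous].
  apply: (@continuousM _ _ bar_factor (fun x => (x - y0) ord0 i)).
    by have [] := C1_bar_factor y0 rho a k (x := x) I.
  by have [] := C1_coord y0 i (x := x) I.
have L1flux i : L1 (fun x => pflux (p x) (bar_grad x) ord0 i * dphi i x).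
  apply: (@L1_compact_support _ _ (fun x => pflux (p x) (bar_grad x) ord0 i * dphi i x) K) => //; last first.
    by move=> x /dphi0 ->; rewrite mulr0.
  apply: (continuous_glue oO clK KO) => [x Ox|x /dphi0 ->]; last by rewrite mulr0.
  apply: (@continuousM _ _ (fun x => pflux (p x) (bar_grad x) ord0 i) (dphi i)); first exact: cflux.
  by have [] := cphi x I.
split => //.
(* C i * d bounds the error made in the i-th component of the flux when the
   exponent p is replaced by its mollification at scale d. *)
pose Mm := 2 * a * k / rho ^+ 2.
pose C i := expR ((P + 2) * bar_Lambda) * (bar_Lambda * L') * (Mm * (2 * rho)) * \int[mu]_x `|dphi i x|.
have C0 i : 0 <= C i.
  rewrite /C !mulr_ge0 ?expR_ge0 ?bar_Lambda_ge0 ?Rintegral_ge0//; try exact: ltW.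
  by rewrite invr_ge0 sqr_ge0.
have SC0 : 0 <= \sum_i C i by apply: sumr_ge0.
apply/ler_addgt0Pr => e e0.
have SC1 : 0 < \sum_i C i + 1 by rewrite ltr_wpDl.
pose d := Num.min 1 (e / (\sum_i C i + 1)).
have d0 : 0 < d by rewrite lt_min ltr01 divr_gt0.
have d01 : 0 < d <= 1 by rewrite d0 ge_min lexx.
have dC : d * \sum_i C i <= e.
  apply: (@le_trans _ _ (e / (\sum_i C i + 1) * \sum_i C i)).
    by rewrite ler_wpM2r// ge_min lexx orbT.
  by rewrite mulrAC ler_pdivrMr// ler_wpM2l ?(ltW e0)// lerDl.
have ibp i := ibp_local i oO cK KO (C1_bar_flux i (cq d d01) (@subIsetr _ _ _)) cphi phi0.
have S1 : bar_kappa P * \int[mu]_x phi x <= \sum_i \int[mu]_x (bar_flux (q d) i x * dphi i x).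
  have -> : \sum_i \int[mu]_x (bar_flux (q d) i x * dphi i x) =
      - \sum_i \int[mu]_x (bar_flux_deriv (q d) (dq d) i i x * phi x).
    by rewrite -sumrN; apply: eq_bigr => i _; have [_ _ ->] := ibp i.
  rewrite -Rintegral_sum; last by move=> i; have [] := ibp i.
  rewrite -RintegralZl// lerNr -mulN1r -RintegralZl//; last exact: L1Z.
  apply: le_Rintegral => //.
  - by apply: L1_sum => i; have [] := ibp i.
  - by apply: L1Z; exact: L1Z.
  move=> x _; rewrite -mulr_suml mulN1r -mulNr.
  have [Kx|/phi0 ->] := pselect (K x); last by rewrite !mulr0.
  rewrite ler_wpM2r//; apply: (@bar_div_le (q d) (dq d) x L pm P) => //; first exact: Ks.
    by apply: qP => //; exact: KO.
  exact: moll_grad_normr.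
apply: (le_trans S1); rewrite -lerBlDl -sumrB; apply: le_trans dC.
rewrite mulr_sumr; apply: ler_sum => i _.
have [L1q _ _] := ibp i.
rewrite -RintegralB//; apply: le_trans (ler_norm _) _.
apply: le_trans (le_normr_Rintegral _ _) _ => //; first exact: L1B.
pose B := expR ((P + 2) * bar_Lambda) * (bar_Lambda * L') * (Mm * (2 * rho)).
have -> : d * C i = \int[mu]_x (d * B * `|dphi i x|).
  by rewrite RintegralZl ?mulrA//; exact: L1_norm.
apply: le_Rintegral => //; first by apply: L1_norm; exact: L1B.
  by apply: L1Z; exact: L1_norm.
move=> x _; rewrite -mulrBl normrM.
have [Kx|/dphi0 ->] := pselect (K x); last by rewrite normr0 !mulr0.
rewrite ler_wpM2r//.
have Ox := KO x Kx; have [_ /= xy] := Ox; have sx := Ks x Kx.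
rewrite fluxE// /bar_flux -mulrBl normrM.
have lb := bar_log_bound sx.
have P0 : 0 <= P + 2.
  by have /andP[h1 h2] := pP x; lra.
have E1 t : pm <= t <= P -> (t - 2) * bar_log x <= (P + 2) * bar_Lambda.
  move=> /andP[t1 t2]; apply: le_trans (ler_norm _) _; rewrite normrM ler_pM//.
  by rewrite ler_norml; apply/andP; split; lra.
have E2 := expR_lip (E1 _ (qP d x d01 Ox)) (E1 _ (pP x)).
have E3 : `|(q d x - 2) * bar_log x - (p x - 2) * bar_log x| <= (bar_Lambda * L') * d.
  rewrite -mulrBl normrM mulrC -mulrA ler_pM//.
  have -> : q d x - 2 - (p x - 2) = q d x - p x by ring.
  exact: qp.
have E4 : `|bar_factor x * (x - y0) ord0 i| <= Mm * (2 * rho).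
  rewrite normrM ler_pM//.
    rewrite gtr0_norm ?bar_factor_gt0// /bar_factor -/Mm ler_piMr//.
      by rewrite divr_ge0 ?sqr_ge0// !mulr_ge0// ltW.
    rewrite -[leRHS]expR0 ler_expR oppr_le0 mulr_ge0 ?(ltW k0)// subr_ge0 /bar_ratio.
    by have /andP[s1 _] := sx; rewrite ler_pdivlMr ?exprn_gt0// mul1r.
  rewrite (le_trans (coord_le_enorm _ _))//.
  rewrite -(@ler_pXn2r _ 2) ?nnegrE ?enorm_ge0 ?mulr_ge0 ?(ltW rho0)//.
  by have /andP[_ s2] := sx; rewrite enorm_sqr exprMn (le_trans s2)// -natrX.
have -> : d * B = (expR ((P + 2) * bar_Lambda) * ((bar_Lambda * L') * d)) * (Mm * (2 * rho)).
  by rewrite /B; ring.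
rewrite ler_pM//; apply: le_trans E2 _.
by rewrite ler_wpM2l// expR_ge0.
Qed.

End supersolution.

(** * Test functions of class C^1 *)

Lemma smaller_than_all (R : realType) (I : finType) (c : R) (f : I -> R) : 0 < c ->
  (forall i, 0 < f i) -> exists d : R, [/\ 0 < d, d < c & forall i, d < f i].
Proof.
move=> c0 f0; pose m := Num.min c (\big[Num.min/1]_i f i).
have m0 : 0 < m.
  rewrite lt_min c0/=; elim/big_ind: _ => // x y x0 y0.
  by rewrite lt_min x0.
have m2 : m / 2 < m by rewrite ltr_pdivrMr// ltr_pMr// ltr1n.
exists (m / 2); split; first by rewrite divr_gt0.
  by apply: lt_le_trans m2 _; rewrite ge_min lexx.
move=> i; apply: lt_le_trans m2 _.
by rewrite ge_min; apply/orP; right; rewrite (bigD1 i)//= ge_min lexx.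
Qed.

Section weak_form.
Context {R : realType} {n : nat}.
Local Notation mu := (@lebesgue_rV R n).
Local Notation L1 f := (mu.-integrable setT (EFin \o f)).
Implicit Types (x y z : 'rV[R]_n) (d : R) (f g p : 'rV[R]_n -> R) (K U : set 'rV[R]_n)
  (Du : 'rV[R]_n -> 'rV[R]_n).

Lemma measurable_powR_fun f g : measurable_fun setT f -> measurable_fun setT g ->
  measurable_fun setT (fun x => f x `^ g x).
Proof.
move=> mf mg; rewrite /powR; apply: measurable_fun_ifT.
- by apply: measurable_fun_eqr => //; exact: measurable_cst.
- apply: (measurableT_comp (f := fun b : bool => (nat_of_bool b)%:R : R)) => //.
  by apply: measurable_fun_eqr => //; exact: measurable_cst.
- apply: measurableT_comp; first exact: measurable_expR.
  apply: measurable_funM => //.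
  by apply: measurableT_comp mf; exact: measurable_ln.
Qed.

Lemma measurable_enorm_fun (W : 'rV[R]_n -> 'rV[R]_n) : (forall i, measurable_fun setT (fun x => W x ord0 i)) ->
  measurable_fun setT (fun x => enorm (W x)).
Proof.
move=> mW; apply: (measurableT_comp (f := @enorm R n)).
  by apply: measurable_rV_continuous; exact: continuous_enorm.
exact: measurable_fun_rV.
Qed.

(** Extension by zero turns a field on K into one on R^n, so that all integrals
    below are over the whole space. *)
Definition cutoff Du K x : 'rV[R]_n := \row_i ((fun y => Du y ord0 i) \_ K) x.

Lemma cutoffT Du K x : K x -> cutoff Du K x = Du x.
Proof. by move=> Kx; apply/rowP => i; rewrite mxE restrictT. Qed.

Lemma cutoffF Du K x : ~ K x -> cutoff Du K x = 0.
Proof. by move=> Kx; apply/rowP => i; rewrite !mxE restrictF. Qed.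

(** Since p is bounded, finiteness of the modular of f / m for one m > 0 implies
    finiteness of the modular of f. *)
Lemma Lp_var_L1 p K f (pm P : R) : measurable K -> measurable_fun setT p -> 1 < pm ->
  (forall y, pm <= p y <= P) -> Lp_var p K f ->
  measurable_fun setT (f \_ K) /\ L1 (fun x => `|(f \_ K) x| `^ p x).
Proof.
move=> mK mp pm1 pP [mf [m m0 foo]].
have mfK : measurable_fun setT (f \_ K) by exact/(measurable_restrictT f mK).
have p0 y : p y != 0 by have /andP[h1 _] := pP y; rewrite gt_eqF// (lt_trans ltr01)// (lt_le_trans pm1).
split => //.
have L1q : L1 (fun x => `|(f \_ K) x / m| `^ p x).
  apply/integrableP; split.
    apply/measurable_EFinP; apply: measurable_powR_fun => //.
    by apply: measurableT_comp => //; apply: measurable_funM.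
  rewrite (eq_integral ((fun x => (`|f x / m| `^ p x)%:E) \_ K)) => [|x _].
    by rewrite -integral_mkcond.
  rewrite /= ger0_norm ?powR_ge0//; have [Kx|Kx] := pselect (K x).
    by rewrite restrictT// patchE mem_set.
  by rewrite restrictF// patchE memNset// mul0r normr0 powR0.
apply: (L1_le _ (L1Z ((1 + m) `^ P) L1q)).
  by apply: measurable_powR_fun => //; exact: measurableT_comp.
move=> x; rewrite ger0_norm ?powR_ge0//.
have -> : `|(f \_ K) x| = m * `|(f \_ K) x / m|.
  by rewrite normrM normfV [`|m|]gtr0_norm// mulrCA mulfV ?gt_eqF// mulr1.
rewrite powRM ?(ltW m0)// ler_wpM2r ?powR_ge0//.
have /andP[h1 h2] := pP x.
apply: (@le_trans _ _ ((1 + m) `^ p x)); last by rewrite ler_powR// lerDl ltW.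
apply: ge0_ler_powR; rewrite ?nnegrE; [lra|lra|lra|].
by rewrite lerDr.
Qed.

Lemma enorm_max (a : 'rV[R]_n) : (0 < n)%N -> exists i, enorm a <= n%:R * `|a ord0 i|.
Proof.
move=> n0; pose i0 : 'I_n := Ordinal n0.
have [i _ Hi] := @arg_maxP _ _ _ i0 xpredT (fun i => `|a ord0 i|) isT.
exists i; apply: le_trans (enorm_le_norm a) _; rewrite ler_wpM2l//.
by apply: rV_norm_ler => // j; exact: Hi.
Qed.

Lemma cutoff_L1 p U Du K (pm P : R) : (0 < n)%N ->
  compact K -> K `<=` U -> measurable_fun setT p -> 1 < pm ->
  (forall y, pm <= p y <= P) -> (forall i, Lp_var_loc p U (fun x => Du x ord0 i)) ->
  (forall i, measurable_fun setT (fun x => cutoff Du K x ord0 i)) /\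
  L1 (fun x => enorm (cutoff Du K x) `^ p x).
Proof.
move=> n0 cK KU mp pm1 pP LDu; have mK := measurable_rV_compact cK.
have H i := Lp_var_L1 mK mp pm1 pP (LDu i K cK KU).
have mW i : measurable_fun setT (fun x => cutoff Du K x ord0 i).
  by have [m _] := H i; apply: eq_measurable_fun m => x _; rewrite mxE.
split => //.
have L1s : L1 (fun x => n%:R `^ P * \sum_i `|((fun y => Du y ord0 i) \_ K) x| `^ p x).
  by apply: L1Z; apply: L1_sum => i; have [] := H i.
apply: (L1_le _ L1s).
  by apply: measurable_powR_fun => //; exact: measurable_enorm_fun.
move=> x; rewrite ger0_norm ?powR_ge0//.
have [i Hi] := enorm_max (cutoff Du K x) n0.
have /andP[h1 h2] := pP x.
apply: (@le_trans _ _ ((n%:R * `|cutoff Du K x ord0 i|) `^ p x)).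
  by apply: ge0_ler_powR; rewrite ?nnegrE ?enorm_ge0//; lra.
rewrite powRM// ler_pM ?powR_ge0//.
  by rewrite ler_powR// ler1n.
rewrite mxE (bigD1 i)//= lerDl; apply: sumr_ge0 => j _; exact: powR_ge0.
Qed.
Lemma powR_pred_le (q t : R) : 1 < q -> 0 <= t -> t `^ (q - 1) <= 1 + t `^ q.
Proof.
move=> q1 t0; have [t1|t1] := leP t 1.
  rewrite -[leLHS]addr0 lerD ?powR_ge0//.
  rewrite [leRHS](_ : 1 = 1 `^ (q - 1)); last by rewrite powR1.
  by apply: ge0_ler_powR; rewrite ?nnegrE//; lra.
by rewrite -[leLHS]add0r lerD// ler_powR ?(ltW t1)//; lra.
Qed.

Lemma pflux_cutoff_L1 p U Du K (pm P : R) : (0 < n)%N ->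
  compact K -> K `<=` U -> measurable_fun setT p -> 1 < pm ->
  (forall y, pm <= p y <= P) -> (forall i, Lp_var_loc p U (fun x => Du x ord0 i)) ->
  forall i, L1 (fun x => pflux (p x) (cutoff Du K x) ord0 i).
Proof.
move=> n0 cK KU mp pm1 pP LDu i.
have [mW L1W] := cutoff_L1 n0 cK KU mp pm1 pP LDu.
have mK := measurable_rV_compact cK.
have p1 y : 1 < p y by have /andP[h1 _] := pP y; exact: lt_le_trans h1.
apply: (L1_le _ (L1D (L1_indic mK (lebesgue_rV_compact cK)) L1W)).
  under eq_fun do rewrite mxE.
  apply: measurable_funM => //; apply: measurable_powR_fun; first exact: measurable_enorm_fun.
  exact: measurable_funB.
move=> x; apply: le_trans (coord_le_enorm _ _) _; rewrite enorm_pflux//.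
have [Kx|Kx] := pselect (K x).
  by rewrite indicE mem_set//= powR_pred_le ?enorm_ge0.
rewrite cutoffF// enorm0 !powR0 ?addr0 ?indicE ?memNset//.
  by rewrite gt_eqF// (lt_trans ltr01).
by rewrite subr_eq0 gt_eqF.
Qed.

Lemma dot_sum_delta (a : 'rV[R]_n) (b : 'I_n -> R) (q : R) :
  enorm a `^ (q - 2) * dot a (\row_i b i) = \sum_i pflux q a ord0 i * b i.
Proof. by rewrite -dotZl /dot; apply: eq_bigr => i _; rewrite [in RHS]mxE !mxE. Qed.

Lemma moll_out d f x : 0 < d -> L1 f -> (forall z, corner_box d z -> f (z + x) = 0) ->
  moll (mollifier d) f x = 0.
Proof.
move=> d0 L1f f0; apply/eqP; rewrite -normr_le0 -[X in `|X|]subr0.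
by apply: moll_close => // z /f0 ->; rewrite subrr normr0.
Qed.

(** Mollifying phi gives admissible test functions supported in a fixed compact
    subset of U; their gradients converge uniformly, while the flux is
    integrable. *)
Lemma weak_form_C1 p U Du K phi dphi (pm P : R) : (0 < n)%N -> open U ->
  compact K -> K `<=` U -> measurable_fun setT p -> 1 < pm ->
  (forall y, pm <= p y <= P) -> (forall i, Lp_var_loc p U (fun x => Du x ord0 i)) ->
  (forall phi, test_function U phi ->
     \int[mu]_(x in U) (enorm (Du x) `^ (p x - 2) * dot (Du x) (grad phi x)) = 0) ->
  C1on setT phi dphi -> (forall x, ~ K x -> phi x = 0) ->
  (forall i, L1 (fun x => pflux (p x) (cutoff Du K x) ord0 i * dphi i x)) /\
  \sum_(i < n) \int[mu]_x (pflux (p x) (cutoff Du K x) ord0 i * dphi i x) = 0.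
Proof.
move=> n0 oU cK KU mp pm1 pP LDu weak C1phi phiK.
have [d1 d10 d1U] := compact_open_margin cK oU KU.
pose c := d1 / 2; have c0 : 0 < c by rewrite divr_gt0.
(* K1 contains the support of the mollification of phi at every scale d <= c. *)
pose K1 := (fun zz : 'rV[R]_n * 'rV[R]_n => zz.1 - zz.2) @` (K `*` corner_box c).
have cK1 : compact K1.
  apply: continuous_compact.
    apply: continuous_subspaceT => x.
    by apply: (@continuousB _ _ _ fst snd); [exact: cvg_fst|exact: cvg_snd].
  by apply: compact_setX => //; exact: compact_corner_box.
have K1U : K1 `<=` U.
  move=> _ [[x z] /= [Kx zc] <-]; apply: (d1U x) => //.
  rewrite addrAC subrr add0r normrN (le_lt_trans (corner_box_norm c0 zc))//.
  by rewrite /c; lra.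
have KK1 : K `<=` K1.
  move=> x Kx; exists (x, 0); last by rewrite /= subr0.
  by split => //= i; rewrite /= in_itv/= mxE lexx ltW.
have clK := closed_rV_compact cK.
have dphiK i x : ~ K x -> dphi i x = 0 by exact: (C1_support_deriv clK C1phi phiK).
have L1F := pflux_cutoff_L1 n0 cK1 K1U mp pm1 pP LDu.
have cdphi i : continuous (dphi i) by exact: (C1_continuous_deriv C1phi).
have L1dphi i : L1 (dphi i) by have [_] := C1_support_L1 cK C1phi phiK.
have L1phi : L1 phi by have [] := C1_support_L1 cK C1phi phiK.
have bdphi i : exists2 C : R, 0 <= C & forall x, `|dphi i x| <= C.
  by apply: (compact_support_bounded cK) => // x; exact: dphiK.
have L1Fd i : L1 (fun x => pflux (p x) (cutoff Du K1 x) ord0 i * dphi i x).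
  have [C _ hC] := bdphi i; apply: (L1_mul_bounded (L1F i) _ hC).
  exact: measurable_rV_continuous.
have FE i x : pflux (p x) (cutoff Du K x) ord0 i * dphi i x =
              pflux (p x) (cutoff Du K1 x) ord0 i * dphi i x.
  have [Kx|Kx] := pselect (K x); last by rewrite dphiK// !mulr0.
  by rewrite !cutoffT//; exact: KK1.
split; first by move=> i; apply: eq_integrable (L1Fd i) => // x _ /=; rewrite FE.
under eq_bigr do under eq_Rintegral do rewrite FE.
pose F i x := pflux (p x) (cutoff Du K1 x) ord0 i.
pose B := \sum_i \int[mu]_x `|F i x|.
have B0 : 0 <= B by apply: sumr_ge0 => i _; exact: Rintegral_ge0.
apply/eqP; rewrite -normr_eq0 eq_le normr_ge0 andbT; apply/ler_addgt0Pr => e e0; rewrite add0r.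
have eB : 0 < e / (B + 1) by rewrite divr_gt0// ltr_wpDl.
have /choice[dl Hdl] : forall i, exists d : R, 0 < d /\ forall x y, `|y - x| < d -> `|dphi i y - dphi i x| < e / (B + 1).
  by move=> i; have [d d0 Hd] := compact_support_unif_continuous cK (cdphi i) (dphiK i) eB; exists d.
have [d [d0 /ltW dc ddl]] := smaller_than_all c0 (fun i => proj1 (Hdl i)).
have L1m i : L1 (fun x => F i x * moll (mollifier d) (dphi i) x).
  have [C _ hC] := bdphi i; apply: (L1_mul_bounded (C := C) (L1F i)).
    by apply: measurable_rV_continuous; exact: continuous_moll_mollifier.
  move=> x; rewrite -[X in `|X|]subr0; apply: moll_close => // z _.
  by rewrite subr0.
have tf : test_function U (moll (mollifier d) phi).
  split; first exact: smooth_moll.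
  exists K1; split => // x K1x; apply: moll_out => // z zd; apply: phiK => Kzx; apply: K1x; exists (z + x, z); last by rewrite /= addrAC subrr add0r.
  split => //= i; have := zd i; rewrite /= !in_itv/= => /andP[-> h]; exact: le_trans dc.
have Em : \sum_i \int[mu]_x (F i x * moll (mollifier d) (dphi i) x) = 0.
  rewrite -Rintegral_sum// -[RHS](weak _ tf) [RHS]Rintegral_mkcond.
  apply: eq_Rintegral => x _; have [K1x|K1x] := pselect (K1 x).
    rewrite restrictT; last exact: K1U.
    rewrite dot_sum_delta; apply: eq_bigr => i _; rewrite /F cutoffT//; congr (_ * _).
    by have [_ E] := is_derive_moll_C1 i x d0 cK C1phi phiK; rewrite /partial E.
  have tf0 i : moll (mollifier d) (dphi i) x = 0.
    apply: moll_out => // z zd; apply: dphiK => Kzx; apply: K1x; exists (z + x, z); last by rewrite /= addrAC subrr add0r.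
    split => //= j; have := zd j; rewrite /= !in_itv/= => /andP[-> h]; exact: le_trans dc.
  rewrite big1 => [|i _]; last by rewrite tf0 mulr0.
  rewrite patchE; case: ifP => //= _; rewrite ?mulr0 /grad dot_sum_delta big1// => i _.
  by have [_ E] := is_derive_moll_C1 i x d0 cK C1phi phiK; rewrite /partial E tf0 mulr0.
rewrite -[X in `|X|]subr0 -[X in `|_ - X|]Em -sumrB.
apply: le_trans (ler_norm_sum _ _ _) _.
apply: (@le_trans _ _ (\sum_i e / (B + 1) * \int[mu]_x `|F i x|)); last first.
  rewrite -mulr_sumr -/B mulrAC ler_pdivrMr ?ltr_wpDl//; nra.
apply: ler_sum => i _; rewrite -RintegralB//; try exact: L1Fd.
apply: le_trans (le_normr_Rintegral _ _) _ => //; first by apply: L1B => //; exact: L1Fd.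
rewrite -RintegralZl//; last exact/L1_norm/L1F.
apply: le_Rintegral => //; first by apply: L1_norm; apply: L1B => //; exact: L1Fd.
  by apply: L1Z; apply: L1_norm; exact: L1F.
move=> x _; rewrite -mulrBr normrM mulrC ler_wpM2r// distrC.
apply: moll_close => // z zd; have [_ Hd] := Hdl i.
apply: ltW; apply: Hd; rewrite addrK (le_lt_trans (corner_box_norm d0 zd))//.
Qed.

End weak_form.

(** * The comparison principle *)

Section positive_square.
Context {R : realType}.

Lemma is_derive_sqr_max0 (t : R) :
  is_derive t 1 (fun s : R => Num.max 0 s ^+ 2) (2 * Num.max 0 t).
Proof.
have [t0|t0|<-] := ltgtP 0 t.
- apply: (near_eq_is_derive (f := fun s : R => s ^+ 2)).
    by near=> s; rewrite max_r// ltW//; near: s; exact: gt_nbhs.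
  have := @is_deriveX_fun _ _ id 2 t 1 1 (is_derive_id _ _).
  by rewrite /= expr1 [_%:A]mulr1.
- apply: (near_eq_is_derive (f := fun s : R => 0)).
    by near=> s; rewrite max_l ?expr0n// ltW//; near: s; exact: lt_nbhs.
  by rewrite mulr0; exact: is_derive_cst.
- rewrite mulr0; apply: (is_derive_flat (C := 1)) => // s.
  rewrite subr0 mul1r ger0_norm ?sqr_ge0//.
  by have [s0|s0] := leP 0 s; rewrite ?expr0n ?sqr_ge0//.
Unshelve. all: by end_near. Qed.

Lemma continuous_max0 : continuous (fun s : R => 2 * Num.max 0 s : R).
Proof.
move=> s; apply: (@continuousM _ _ (cst 2) (fun s : R => Num.max 0 s)).
  exact: cst_continuous.
apply: (continuous_max (f := cst 0) (g := id)); last by [].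
exact: cst_continuous.
Qed.

End positive_square.

Section comparison.
Context {R : realType} {n : nat}.
Local Notation mu := (@lebesgue_rV R n).
Local Notation L1 f := (mu.-integrable setT (EFin \o f)).
Implicit Types (x y z : 'rV[R]_n) (d : R) (f g p u v psi : 'rV[R]_n -> R) (A K O U : set 'rV[R]_n)
  (Du dv : 'rV[R]_n -> 'rV[R]_n).

(** Squaring makes the positive part of a C^1 function of class C^1. *)
Lemma C1_sqr_max0 O K psi (dpsi : 'I_n -> 'rV[R]_n -> R) : open O -> closed K -> K `<=` O ->
  C1on O psi dpsi -> (forall x, O x -> ~ K x -> psi x <= 0) ->
  C1on setT ((fun x => Num.max 0 (psi x) ^+ 2) \_ O)
    (fun i x => ((fun x => 2 * Num.max 0 (psi x)) \_ O) x * dpsi i x).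
Proof.
move=> oO cK KO C1psi psi0.
have := C1on_comp (g := fun t => Num.max 0 t ^+ 2) (dg := fun t => 2 * Num.max 0 t) C1psi.
move=> /(_ (fun x _ => is_derive_sqr_max0 (psi x)) (fun x _ => @continuous_max0 R (psi x))) C1phi.
apply: (C1on_glue oO cK KO C1phi) => [x Ox|i x Ox|x Kx|i x Kx].
- by rewrite restrictT.
- by rewrite restrictT.
- have [Ox|Ox] := pselect (O x); last by rewrite restrictF.
  by rewrite restrictT// max_l ?psi0// expr0n.
- have [Ox|Ox] := pselect (O x); last by rewrite restrictF// mul0r.
  by rewrite restrictT// max_l ?psi0// mulr0 mul0r.
Qed.

(** The weak form of - div (|dv|^(p(x) - 2) dv) >= kappa on A. *)
Definition strict_supersolution p dv A (kappa : R) :=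
  forall K phi dphi, compact K -> K `<=` A -> C1on setT phi dphi ->
    (forall x, ~ K x -> phi x = 0) -> (forall x, 0 <= phi x) ->
    (forall i, L1 (fun x => pflux (p x) (dv x) ord0 i * dphi i x)) /\
    kappa * \int[mu]_x phi x <= \sum_(i < n) \int[mu]_x (pflux (p x) (dv x) ord0 i * dphi i x).

Lemma measurable_pflux p dv i : measurable_fun setT p ->
  (forall i, measurable_fun setT (fun x => dv x ord0 i)) ->
  measurable_fun setT (fun x => pflux (p x) (dv x) ord0 i).
Proof.
move=> mp mdv; under eq_fun do rewrite mxE.
apply: measurable_funM => //; apply: measurable_powR_fun; first exact: measurable_enorm_fun.
exact: measurable_funB.
Qed.

Lemma compact_bounded_on K f : compact K -> (forall x, K x -> {for x, continuous f}) ->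
  exists2 C : R, 0 <= C & forall x, K x -> `|f x| <= C.
Proof.
move=> cK cf; have cfK : {within K, continuous f}.
  by apply: continuous_in_subspaceT => x /set_mem /cf.
have /compact_bounded[M [_ HM]] := continuous_compact cfK cK.
exists (`|M| + 1) => [|x Kx]; first by rewrite addr_ge0.
by apply: HM; [rewrite (le_lt_trans (ler_norm _))// ltrDl|exists x].
Qed.

Lemma pflux_sub_le (q pm P M : R) (a b : 'rV[R]_n) i : 1 < pm -> pm <= q <= P -> enorm b <= M ->
  `|pflux q a ord0 i - pflux q b ord0 i| <= (2 + (M + 1) `^ P) * (enorm a `^ (q - 1) + 1).
Proof.
move=> pm1 /andP[pmq qP] bM.
have q1 : 1 < q by exact: lt_le_trans pmq.
have M0 : 0 <= M by apply: le_trans bM; exact: enorm_ge0.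
have h1 : `|pflux q a ord0 i| <= enorm a `^ (q - 1).
  by rewrite -enorm_pflux// coord_le_enorm.
have h2 : `|pflux q b ord0 i| <= 1 + (M + 1) `^ P.
  apply: le_trans (coord_le_enorm _ _) _; rewrite enorm_pflux//.
  apply: le_trans (powR_pred_le q1 (enorm_ge0 _)) _; rewrite lerD2l.
  apply: (@le_trans _ _ ((M + 1) `^ q)); last by rewrite ler_powR// lerDr.
  by apply: ge0_ler_powR; rewrite ?nnegrE ?enorm_ge0//; lra.
apply: le_trans (ler_normB _ _) _.
have := powR_ge0 (enorm a) (q - 1); have := powR_ge0 (M + 1) P; nra.
Qed.

(** If u - v were positive somewhere, then phi = ((u_d - v - 2 e)_+)^2, for a
    mollification u_d of u close to u, would be a C^1 function with compact support,
    admissible in the equation of u and in the inequality of v.  Subtracting, the integral of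
    (flux of u - flux of v) . (grad u_d - grad v) 2 (u_d - v - 2 e)_+ is at most
    - kappa times the integral of phi, which stays away from 0 as d tends to 0.
    With grad u in place of grad u_d this integral is nonnegative by
    [pflux_monotone], and the error tends to 0 by [moll_pairing]: a
    contradiction. *)
Lemma comparison p U u Du v dv A U0 (kappa L' pm P : R) : (0 < n)%N -> open U ->
  measurable_fun setT p -> 1 < pm -> (forall y, pm <= p y <= P) ->
  0 <= L' -> (forall x y, `|p x - p y| <= L' * `|x - y|) ->
  distributional_gradient U u Du -> (forall i, Lp_var_loc p U (fun x => Du x ord0 i)) ->
  (forall phi, test_function U phi ->
     \int[mu]_(x in U) (enorm (Du x) `^ (p x - 2) * dot (Du x) (grad phi x)) = 0) ->
  (forall x, U x -> {for x, continuous u}) ->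
  C1on setT v (fun i x => dv x ord0 i) -> 0 < kappa -> strict_supersolution p dv A kappa ->
  open U0 -> U0 `<=` U ->
  (forall e, 0 < e -> compact [set x | U0 x /\ e <= u x - v x]) ->
  (forall x, U0 x -> 0 < u x - v x -> A x) ->
  forall x, U0 x -> u x <= v x.
Proof.
move=> n0 oU mp pm1 pP L'0 pL dg LDu weak cu C1v kappa0 superv oU0 U0U cpt inA x0 U0x0.
apply: contrapT => /negP; rewrite -ltNge -subr_gt0 => s0.
(* The excess at x0 is 4 e: the mollification costs e / 2, the truncation 2 e,
   and psi >= e must remain on a ball about x0. *)
pose e := (u x0 - v x0) / 4; have e0 : 0 < e by rewrite divr_gt0.
have ex0 : u x0 - v x0 = 4 * e by rewrite /e mulrC divfK.
have e20 : 0 < e / 2 by rewrite divr_gt0.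
have cv : continuous v by exact: (C1_continuous C1v).
have cdv i : continuous (fun x => dv x ord0 i) by exact: (C1_continuous_deriv C1v).
have cs x : U0 x -> {for x, continuous (fun x => u x - v x)}.
  by move=> /U0U Ux; apply: (@continuousB _ _ _ u v); [exact: cu|exact: cv].
have open_super c : open [set x | U0 x /\ c < u x - v x].
  rewrite openE => x [U0x cx]; have nU : \near x, U0 x by apply: open_nbhs_nbhs.
  have ns : \forall y \near x, c < u y - v y.
    exact: (cvgr_gt _ (cs x U0x) _ cx).
  exact: filterS2 nU ns.
pose K := [set x | U0 x /\ e <= u x - v x].
pose K' := [set x | U0 x /\ e / 2 <= u x - v x].
pose O := [set x | U0 x /\ e < u x - v x].
have cK : compact K by exact: cpt.
have cK' : compact K' by exact: cpt.
have OK : O `<=` K by move=> x [? ?]; split=> //; exact: ltW.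
have KK' : K `<=` K' by move=> x [? h]; split=> //; apply: le_trans h; lra.
have KA : K `<=` A by move=> x [h1 h2]; apply: inA => //; exact: lt_le_trans h2.
have KU : K `<=` U by move=> x [/U0U].
have K'U : K' `<=` U by move=> x [/U0U].
have [d1 d10 d1K'] : exists2 d1 : R, 0 < d1 & forall x y, K x -> `|y - x| < d1 -> K' y.
  have KO' : K `<=` [set x | U0 x /\ e / 2 < u x - v x].
    by move=> x [h1 h2]; split=> //; apply: lt_le_trans h2; lra.
  have [d1 d10 H] := compact_open_margin cK (open_super (e / 2)) KO'.
  by exists d1 => // x y Kx xy; have [h1 h2] := H x y Kx xy; split=> //; exact: ltW.
have [d2 d20 d2u] : exists2 d2 : R, 0 < d2 & forall x y, K x -> `|y - x| < d2 -> `|u y - u x| < e / 2.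
  by apply: heine_at e20 => // x Kx; apply: cu; exact: KU.
have [M1 M10 M1s] : exists2 C : R, 0 <= C & forall x, K x -> `|u x - v x| <= C.
  by apply: compact_bounded_on => // x [U0x _]; exact: cs.
have [M2 M20 M2v] : exists2 C : R, 0 <= C & forall x, K x -> enorm (dv x) <= C.
  have H (i : 'I_n) : exists C : R, 0 <= C /\ forall x, K x -> `|dv x ord0 i| <= C.
    have [C C0 HC] := compact_bounded_on cK (fun x _ => @cdv i x); by exists C.
  have /choice[C HC] := H; exists (\sum_i C i).
    by apply: sumr_ge0 => i _; have [] := HC i.
  move=> x Kx; apply: le_trans (enorm_le_sum _) _; apply: ler_sum => i _.
  by have [_] := HC i; apply.
have mK := measurable_rV_compact cK; have Koo := lebesgue_rV_compact cK.
have mK' := measurable_rV_compact cK'.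
have mdv i : measurable_fun setT (fun x => dv x ord0 i) by exact: measurable_rV_continuous.
pose W := cutoff Du K.
have [mW L1W] := cutoff_L1 n0 cK KU mp pm1 pP LDu.
pose Z i x := pflux (p x) (W x) ord0 i - pflux (p x) (dv x) ord0 i.
have mZ i : measurable_fun setT (Z i).
  by apply: measurable_funB; exact: measurable_pflux.
pose M := 2 * (M1 + e).
have M0 : 0 <= M by rewrite mulr_ge0// addr_ge0// ltW.
pose C := 2 + (M2 + 1) `^ P.
have C0 : 0 <= C by rewrite addr_ge0// powR_ge0.
pose Y i x := M * ((Z i) \_ K) x.
have mY i : measurable_fun setT (Y i).
  apply: measurable_funM => //; apply: (proj1 (measurable_restrictT _ mK)).
  exact: measurable_funTS.
have YK i x : ~ K x -> Y i x = 0 by move=> Kx; rewrite /Y restrictF// mulr0.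
have YC i x : `|Y i x| <= (M * C) * (enorm (W x) `^ (p x - 1) + 1).
  have pos : 0 <= C * (enorm (W x) `^ (p x - 1) + 1).
    by rewrite mulr_ge0// addr_ge0// powR_ge0.
  rewrite normrM (ger0_norm M0) -mulrA ler_wpM2l//.
  have [Kx|Kx] := pselect (K x); last by rewrite restrictF// normr0.
  by rewrite restrictT//; apply: (@pflux_sub_le (p x) pm P M2) => //; exact: M2v.
have oO : open O by exact: open_super.
have [dB dB0 dBO] : exists2 dB : R, 0 < dB & forall y, ball x0 dB y -> U0 y /\ 3 * e + e / 2 < u y - v y.
  have /nbhs_ballP[r r0 H] : nbhs x0 [set x | U0 x /\ 3 * e + e / 2 < u x - v x].
    by apply: open_nbhs_nbhs; split; [exact: open_super|split => //; rewrite ex0; lra].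
  by exists r.
pose B := ball x0 dB : set 'rV[R]_n.
have mB : measurable B by apply: measurable_rV_open; exact: ball_open.
have BK : B `<=` K by move=> y /dBO [h1 h2]; split => //; apply: le_trans (ltW h2); lra.
have Boo : (mu B < +oo)%E.
  by apply: le_lt_trans Koo; apply: le_measure; rewrite ?inE.
have B0 : 0 < \int[mu]_x (\1_B x : R).
  rewrite /Rintegral integral_indic// setIT fine_gt0// lebesgue_rV_open_gt0 ?Boo//.
    exact: ball_open.
  by exists x0; exact: ballxx.
pose c1 := kappa * (e ^+ 2 * \int[mu]_x (\1_B x : R)).
have c10 : 0 < c1 by rewrite !mulr_gt0.
pose e1 := c1 / (n%:R + 1).
have n1 : 0 < n%:R + 1 :> R by rewrite ltr_wpDl.
have e10 : 0 < e1 by rewrite divr_gt0.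
have /choice[dp Hdp] : forall i : 'I_n, exists d0 : R, 0 < d0 /\ forall d, 0 < d < d0 ->
    L1 (fun x => Y i x * (moll (mollifier d) ((fun y => Du y ord0 i) \_ K') x - ((fun y => Du y ord0 i) \_ K') x)) /\
    \int[mu]_x `|Y i x * (moll (mollifier d) ((fun y => Du y ord0 i) \_ K') x - ((fun y => Du y ord0 i) \_ K') x)| <= e1.
  move=> i; have [_ /(_ i) L1Du] := distr_L1 dg cK' K'U.
  have [mDu L1h] := Lp_var_L1 mK' mp pm1 pP (LDu i _ cK' K'U).
  have MC0 : 0 <= M * C by exact: mulr_ge0.
  have [d0 d00 H] := moll_pairing mK Koo L1Du L1h (fun y => lexx _) mp pm1 pP L'0 pL n0
    (measurable_enorm_fun mW) (fun y => enorm_ge0 _) L1W (mY i) (YK i) MC0 (YC i) e10.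
  by exists d0.
have d120 : 0 < Num.min d1 d2 by rewrite lt_min d10.
have [d [d0]] := smaller_than_all d120 (fun i => proj1 (Hdp i)).
rewrite lt_min => /andP[dd1 dd2] ddp.
pose ud := moll (mollifier d) (u \_ K').
pose dud i := moll (mollifier d) ((fun y => Du y ord0 i) \_ K').
have [cud cdud] := continuous_moll_restrict dg cK' K'U d0.
have xK' x z : K x -> corner_box d z -> K' (z + x).
  move=> Kx zd; apply: (d1K' x) => //.
  by rewrite addrK (le_lt_trans (corner_box_norm d0 zd)).
have udu x : K x -> `|ud x - u x| <= e / 2.
  move=> Kx; apply: moll_close => //; first by have [] := distr_L1 dg cK' K'U.
  move=> z zd; rewrite restrictT; last exact: xK'.
  apply/ltW/d2u => //.
  by rewrite addrK (le_lt_trans (corner_box_norm d0 zd)).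
pose psi x := ud x - v x - 2 * e.
pose dpsi i x := dud i x - dv x ord0 i.
have C1psi : C1on O psi dpsi.
  have C1ud : C1on O ud dud.
    move=> x /OK Kx; split => [|i|i]; [exact: cud| |exact: cdud].
    by apply: (is_derive_moll_distr i dg) => // z; exact: xK'.
  have := C1onB (C1onB C1ud (C1onS (@subsetT _ O) C1v)) (@C1on_cst _ _ O (2 * e)).
  by move=> /C1on_ext; apply => //; apply/funext => i; apply/funext => x; rewrite subr0.
pose K2 := K `&` [set x | 0 <= psi x].
have cpsi : continuous psi.
  move=> x; apply: (@continuousB _ _ _ (fun x => ud x - v x) (cst (2 * e))); last exact: cst_continuous.
  by apply: (@continuousB _ _ _ ud v); [exact: cud|exact: cv].
have clK2 : closed K2.
  apply: closedI; first exact: closed_rV_compact.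
  by apply: (@closed_comp _ _ psi [set t | 0 <= t]) => [x _|]; [exact: cpsi|exact: closed_ge].
have K2O : K2 `<=` O.
  move=> x [Kx /= psix]; have [U0x _] := Kx; split => //.
  have := udu x Kx; rewrite ler_norml => /andP[h1 h2]; move: e0 psix h1 h2; rewrite /psi; clear; lra.
have psiO x : O x -> ~ K2 x -> psi x <= 0.
  move=> Ox nK2; rewrite leNgt; apply/negP => h; apply: nK2.
  by split; [exact: OK|exact: ltW].
have C1phi := C1_sqr_max0 oO clK2 K2O C1psi psiO.
set phi := (X in C1on _ X _) in C1phi; set dphi := (X in C1on _ _ X) in C1phi.
have phiK x : ~ K x -> phi x = 0 by move=> Kx; rewrite /phi restrictF// => /OK.
have phi0 x : 0 <= phi x.
  by rewrite /phi patchE; case: ifP => // _; rewrite sqr_ge0.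
have [L1F EF] := weak_form_C1 n0 oU cK KU mp pm1 pP LDu weak C1phi phiK.
have [L1X EX] := superv K phi dphi cK KA C1phi phiK phi0.
pose G := (fun x => 2 * Num.max 0 (psi x)) \_ O.
have G0 x : 0 <= G x.
  by rewrite /G patchE; case: ifP => // _; rewrite mulr_ge0// le_max lexx.
have GM x : `|G x| <= M.
  rewrite ger0_norm//; have [Ox|Ox] := pselect (O x); last by rewrite /G restrictF.
  rewrite /G restrictT// /M ler_wpM2l// ge_max addr_ge0 ?(ltW e0)//=.
  have Kx := OK x Ox.
  have := udu x Kx; rewrite ler_norml => /andP[_ h2].
  have := M1s x Kx; rewrite ler_norml => /andP[_]; move: h2 e0; rewrite /psi; clear; lra.
have GK x : ~ K x -> G x = 0 by move=> Kx; rewrite /G restrictF// => /OK.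
(* On the ball B the truncation psi is at least e, for every small d. *)
have Iphi : e ^+ 2 * \int[mu]_x (\1_B x : R) <= \int[mu]_x phi x.
  rewrite -RintegralZl//; last exact: L1_indic.
  apply: le_Rintegral => //; first by apply: L1Z; exact: L1_indic.
    by have [] := C1_support_L1 cK C1phi phiK.
  move=> x _; rewrite indicE; have [Bx|Bx] := pselect (B x); last by rewrite memNset// mulr0.
  rewrite mem_set// mulr1; have [U0x sx] := dBO x Bx.
  have Ox : O x by split => //; move: sx e0; clear; lra.
  rewrite /phi restrictT// ler_pXn2r ?nnegrE ?(ltW e0)// ?le_max ?lexx//.
  have := udu x (OK x Ox); rewrite ler_norml => /andP[h2 _]; apply/orP; right; move: h2 sx; rewrite /psi; clear; lra.
have dphiE i x : dphi i x = G x * (W x ord0 i - dv x ord0 i) +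
    G x * (dud i x - ((fun y => Du y ord0 i) \_ K') x).
  rewrite /dphi -/G -mulrDr; have [Kx|Kx] := pselect (K x); last by rewrite GK// !mul0r.
  rewrite /dpsi restrictT; last exact: KK'.
  by rewrite /W cutoffT//; congr (_ * _); ring.
pose Q i x := Z i x * (G x * (dud i x - ((fun y => Du y ord0 i) \_ K') x)).
have QY i x : `|Q i x| <= `|Y i x * (dud i x - ((fun y => Du y ord0 i) \_ K') x)|.
  rewrite /Q /Y; have [Kx|Kx] := pselect (K x); last by rewrite GK// mul0r mulr0 normr0.
  by rewrite (restrictT _ Kx) mulrA normrM [leRHS]normrM ler_wpM2r// normrM [leLHS]mulrC [leRHS]normrM (ger0_norm M0) ler_wpM2r.
have mG : measurable_fun setT G.
  apply: (proj1 (measurable_restrictT _ (measurable_rV_open oO))); apply: measurable_funTS.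
  apply: measurable_rV_continuous => x.
  by apply: (@continuous_comp _ _ _ psi (fun t => 2 * Num.max 0 t)); [exact: cpsi|exact: continuous_max0].
have L1Q i : L1 (Q i) /\ \int[mu]_x `|Q i x| <= e1.
  have [_ /(_ d)] := Hdp i; rewrite d0 ddp => /(_ isT)[h1 h2].
  have L1Qi : L1 (Q i).
    apply: (L1_le _ (L1_norm h1)) => [|x]; last exact: QY.
    apply: measurable_funM => //; apply: measurable_funM => //; apply: measurable_funB.
      by apply: measurable_rV_continuous; exact: cdud.
    apply: (proj1 (measurable_restrictT _ mK')).
    by have [h _] := LDu i K' cK' K'U.
  split => //; apply: le_trans h2; apply: le_Rintegral => //; exact: L1_norm.
have L1Zd i : L1 (fun x => Z i x * dphi i x).
  by apply: eq_integrable (L1B (L1F i) (L1X i)) => // x _ /=; rewrite /Z mulrBl.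
have EZ : \sum_i \int[mu]_x (Z i x * dphi i x) <= - (kappa * \int[mu]_x phi x).
  rewrite (eq_bigr (fun i => \int[mu]_x (pflux (p x) (W x) ord0 i * dphi i x) -
     \int[mu]_x (pflux (p x) (dv x) ord0 i * dphi i x))) => [|i _].
    by rewrite sumrB EF sub0r lerN2.
  by rewrite -RintegralB//; apply: eq_Rintegral => x _; rewrite /Z mulrBl.
have mono : 0 <= \sum_i (\int[mu]_x (Z i x * dphi i x) - \int[mu]_x Q i x).
  rewrite (eq_bigr (fun i => \int[mu]_x (Z i x * dphi i x - Q i x))) => [|i _]; last first.
    by rewrite RintegralB//; have [] := L1Q i.
  rewrite -Rintegral_sum => [|i]; last by apply: L1B => //; have [] := L1Q i.
  apply: Rintegral_ge0 => x _.
  rewrite (_ : \sum_i _ = G x * dot (pflux (p x) (W x) - pflux (p x) (dv x)) (W x - dv x)).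
    rewrite mulr_ge0// pflux_monotone//.
    by have /andP[h _] := pP x; exact: lt_le_trans h.
  rewrite /dot mulr_sumr; apply: eq_bigr => i _.
  by rewrite dphiE /Q /Z !mxE; ring.
rewrite sumrB subr_ge0 in mono.
have lowQ : - (n%:R * e1) <= \sum_i \int[mu]_x Q i x.
  rewrite -[n in n%:R]card_ord mulr_natl -sumr_const -sumrN; apply: ler_sum => i _.
  have [h1 h2] := L1Q i; rewrite lerNl; apply: le_trans h2.
  apply: le_trans (le_normr_Rintegral _ h1) => //.
  by rewrite -normrN ler_norm.
have : n%:R * e1 < c1.
  by rewrite /e1 mulrCA gtr_pMr// ltr_pdivrMr// mul1r ltrDl.
have : c1 <= kappa * \int[mu]_x phi x by rewrite ler_pM2l.
by move: (le_trans lowQ (le_trans mono EZ)); clear; lra.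
Qed.

End comparison.

(** * The boundary estimate *)

Section constants.
Context {R : realType}.
Implicit Types (n : nat) (S re pm L k rho : R).

(** The constant for the radius r / aperture.  Its second term makes
    20 L rho <= pm - 1 when 10 rho = r / aperture and r < re; the value 3 keeps a
    ball of twice the radius inside the ball of radius r. *)
Definition aperture re pm L : R := 3 + 2 * re * L / (pm - 1).

(** The value of k for which the inequality of [steepness_suffices] holds with
    room to spare, using only an upper bound re for rho. *)
Definition steepness n S re pm L : R :=
  (n%:R + 2 * L * (re * (5 + `|ln S|) + 1 + re ^+ 2)) / (pm - 1) + 1.

Lemma aperture_ge3 re pm L : 0 < re -> 1 < pm -> 0 <= L -> 3 <= aperture re pm L.
Proof.
move=> re0 pm1 L0; rewrite /aperture lerDl divr_ge0 ?subr_ge0 ?(ltW pm1)// !mulr_ge0//.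
exact: ltW.
Qed.

Lemma ln_le_id (t : R) : 0 < t -> ln t <= t.
Proof.
move=> t0; have := @le_ln1Dx R (t - 1); rewrite addrCA subrr addr0 => H.
by apply: le_trans (H _) _; lra.
Qed.

Lemma mulr_normr_ln rho : 0 < rho -> rho * `|ln rho| <= 1 + rho ^+ 2.
Proof.
move=> r0; have [l0|/ltW l0] := leP 0 (ln rho).
  rewrite ger0_norm//; have := ln_le_id r0; nra.
have := @ln_le_id rho^-1; rewrite invr_gt0 lnV ?posrE// => /(_ r0) H; rewrite (ler0_norm l0).
apply: (@le_trans _ _ (rho * rho^-1)); first by rewrite ler_wpM2l// ltW.
by rewrite mulfV ?gt_eqF// lerDl sqr_ge0.
Qed.

Lemma steepness_ge1 n S re pm L : 0 < re -> 1 < pm -> 0 <= L -> 1 <= steepness n S re pm L.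
Proof.
move=> re0 pm1 L0; rewrite /steepness lerDr divr_ge0 ?subr_ge0 ?(ltW pm1)//.
by rewrite addr_ge0// mulr_ge0 ?mulr_ge0// !addr_ge0 ?sqr_ge0// mulr_ge0 ?(ltW re0)// addr_ge0.
Qed.

(** The quantity bar_Lambda itself grows like 4 k, but it is multiplied by L rho,
    which is at most (pm - 1) / 20; and rho |ln rho| is bounded, so that the
    logarithm of the slope does no harm as rho tends to 0. *)
Lemma steepness_suffices n S re pm L rho : 0 < S -> 0 < re -> 1 < pm -> 0 <= L ->
  0 < rho <= re -> 20 * (L * rho) <= pm - 1 ->
  2 * bar_Lambda rho (2 * S) (steepness n S re pm L) * L * rho + n%:R <=
    (pm - 1) * (2 * steepness n S re pm L - 1).
Proof.
move=> S0 re0 pm1 L0 /andP[r0 rre] Lr; set k := steepness n S re pm L.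
have k1 : 1 <= k by exact: steepness_ge1.
have k0 : 0 < k by exact: lt_le_trans k1.
have ln4 : `|ln (4 : R)| <= 3.
  rewrite ger0_norm; last by rewrite ln_ge0// ler1n.
  by have := @le_ln1Dx R 3; rewrite (_ : 1 + 3 = 4) => [H|]; [apply: H; lra|ring].
have lnk : `|ln k| <= k by rewrite ger0_norm ?ln_ge0// ln_le_id.
have Lam : bar_Lambda rho (2 * S) k <= 5 + `|ln S| + 4 * k + `|ln rho|.
  rewrite /bar_Lambda (_ : 2 * (2 * S) * k = 4 * (S * k)); last by ring.
  rewrite ln_div ?posrE ?mulr_gt0// lnM ?posrE ?mulr_gt0// lnM ?posrE//.
  have h1 := ler_normB (ln 4 + (ln S + ln k)) (ln rho).
  have h2 := ler_normD (ln (4 : R)) (ln S + ln k); have h3 := ler_normD (ln S) (ln k).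
  by move: h1 h2 h3 ln4 lnk; clear; lra.
have rlnr := mulr_normr_ln r0.
have kE : (pm - 1) * k = n%:R + 2 * L * (re * (5 + `|ln S|) + 1 + re ^+ 2) + (pm - 1).
  by rewrite /k /steepness mulrDr mulr1 mulrC divfK// gt_eqF// subr_gt0.
have rr : rho ^+ 2 <= re ^+ 2 by rewrite ler_pXn2r ?nnegrE// ltW.
have H1 : 2 * bar_Lambda rho (2 * S) k * L * rho <=
    2 * (L * (rho * (5 + `|ln S|))) + 8 * k * (L * rho) + 2 * (L * (rho * `|ln rho|)).
  apply: (@le_trans _ _ (2 * (5 + `|ln S| + 4 * k + `|ln rho|) * L * rho)).
    by rewrite ler_wpM2r ?(ltW r0)// ler_wpM2r// ler_wpM2l.
  by rewrite le_eqVlt; apply/orP; left; apply/eqP; ring.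
have H2 : L * (rho * (5 + `|ln S|)) <= L * (re * (5 + `|ln S|)).
  by rewrite ler_wpM2l// ler_wpM2r// addr_ge0.
have H3 : L * (rho * `|ln rho|) <= L * (1 + re ^+ 2).
  by rewrite ler_wpM2l// (le_trans rlnr)// lerD2l.
have H4 : 20 * (k * (L * rho)) <= (pm - 1) * k.
  by rewrite mulrCA [leRHS]mulrC ler_wpM2l// ltW.
have H5 : 0 <= L * (re * (5 + `|ln S|)) + L * (1 + re ^+ 2).
  by rewrite addr_ge0// ?mulr_ge0// ?addr_ge0 ?sqr_ge0// ltW.
move: H1 H2 H3 H4 H5 kE pm1 (ler0n R n); clear.
set a := L * (re * _); set b := L * (1 + _).
rewrite (_ : 2 * L * (re * (5 + `|ln S|) + 1 + re ^+ 2) = 2 * (a + b)); last by rewrite /a /b; ring.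
move=> H1 H2 H3 H4 H5 kE pm1 nn.
have -> : (pm - 1) * (2 * k - 1) = 2 * ((pm - 1) * k) - (pm - 1) by ring.
lra.
Qed.

End constants.

Section geometry.
Context {R : realType} {n : nat}.
Implicit Types (x y w eta : 'rV[R]_n) (Omega A : set 'rV[R]_n) (f : 'rV[R]_n -> R) (r c : R).

Lemma boundary_open Omega x : open Omega -> boundary Omega x -> closure Omega x /\ ~ Omega x.
Proof. by move=> oO [cx nx]; split => //; rewrite -(proj1 (interior_id _) oO). Qed.

Lemma closure_ge A f c y : continuous f -> (forall x, A x -> c <= f x) -> closure A y -> c <= f y.
Proof.
move=> cf Af Ay; rewrite leNgt; apply/negP => yc.
by have [x [/Af Ax /= /lt_geF]] := Ay _ (cvgr_lt _ (cf y) _ yc); rewrite Ax.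
Qed.

Lemma boundary_eball eta w r : boundary (eball eta r) w -> enorm (w - eta) = r.
Proof.
move=> /(boundary_open (@open_eball R n eta r))[clw nw].
apply/eqP; rewrite eq_le [X in _ && X]leNgt; apply/andP; split; last exact/negP.
rewrite -lerN2; apply: (closure_ge (f := fun x => - enorm (x - eta)) _ _ clw).
  by move=> x; apply: (@continuousN _ _ _ (fun x => enorm (x - eta))); exact: continuous_enormB.
by move=> x /ltW; rewrite lerN2.
Qed.

(** The smaller ball has its centre on the segment from w to eta, hence is
    internally tangent to the larger one at w. *)
Lemma shrink_ball eta w r (rho : R) : enorm (w - eta) = r -> 0 < rho <= r ->
  exists2 y0, enorm (w - y0) = rho & eball y0 rho `<=` eball eta r.
Proof.
move=> wr /andP[rho0 rhor]; have r0 : 0 < r by exact: lt_le_trans rhor.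
exists (w - (rho / r) *: (w - eta)).
  rewrite subKr enormZ wr gtr0_norm ?divr_gt0//.
  by rewrite divfK// gt_eqF.
move=> x /= xy; rewrite /eball/=.
apply: le_lt_trans (enorm_triangle (w - (rho / r) *: (w - eta)) _ _) _.
have -> : w - (rho / r) *: (w - eta) - eta = (1 - rho / r) *: (w - eta).
  by rewrite addrAC scalerBl scale1r.
rewrite enormZ wr ger0_norm; last first.
  by rewrite subr_ge0 ler_pdivrMr// mul1r.
rewrite mulrBl divfK ?gt_eqF// mul1r.
by move: xy; rewrite /eball/=; lra.
Qed.

Lemma compact_superlevel K f c : compact K -> {within K, continuous f} ->
  compact (K `&` [set x | c <= f x]).
Proof.
move=> cK /continuous_closedP cf.
have /closed_subspaceP[V cV E] := cf _ (@closed_ge R c).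
rewrite (_ : _ `&` _ = K `&` V); first exact: compact_closedI.
by rewrite [RHS]setIC E setIC.
Qed.

End geometry.

Section barrier_bounds.
Context {R : realType} {n : nat}.
Variables (y0 : 'rV[R]_n) (rho a k : R).
Hypotheses (rho0 : 0 < rho) (a0 : 0 < a) (k1 : 1 <= k).
Local Notation v := (barrier y0 rho a k).

Let k0 : 0 < k. Proof. exact: lt_le_trans k1. Qed.

Lemma sqd_enorm x : sqd y0 x = enorm (x - y0) ^+ 2.
Proof. by rewrite enorm_sqr. Qed.

Lemma barrier_ge0 x : rho <= enorm (x - y0) -> 0 <= v x.
Proof.
move=> xr; rewrite mulr_ge0 ?(ltW a0)// subr_ge0 -[leRHS]expR0 ler_expR oppr_le0.
rewrite mulr_ge0 ?(ltW k0)// subr_ge0 /bar_ratio sqd_enorm ler_pdivlMr ?exprn_gt0// mul1r.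
by rewrite ler_pXn2r ?nnegrE ?enorm_ge0// ltW.
Qed.

(** Here 1 - exp (- 3 k) >= 1 / 2. *)
Lemma barrier_half x : enorm (x - y0) = 2 * rho -> a / 2 <= v x.
Proof.
move=> xr; rewrite ler_wpM2l ?(ltW a0)// /bar_ratio sqd_enorm xr exprMn mulfK; last first.
  by rewrite gt_eqF// exprn_gt0.
have : expR (- (k * (2 ^+ 2 - 1))) <= 2^-1.
  rewrite expRN lef_pV2 ?posrE ?expR_gt0//.
  apply: le_trans (expR_ge1Dx _); have := k1; rewrite expr2; lra.
lra.
Qed.

(** From 1 - exp (- t) <= t and (rho + d)^2 - rho^2 <= 3 rho d for d <= rho. *)
Lemma barrier_le x d : 0 <= d <= rho -> enorm (x - y0) <= rho + d -> v x <= 3 * a * k * (d / rho).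
Proof.
move=> /andP[d0 dr] xd.
have -> : 3 * a * k * (d / rho) = a * (k * (3 * (d / rho))) by ring.
rewrite ler_wpM2l ?(ltW a0)//.
apply: (@le_trans _ _ (k * (bar_ratio y0 rho x - 1))).
  by have := expR_ge1Dx (- (k * (bar_ratio y0 rho x - 1))); lra.
rewrite ler_wpM2l ?(ltW k0)// lerBlDr /bar_ratio sqd_enorm ler_pdivrMr ?exprn_gt0//.
have -> : (3 * (d / rho) + 1) * rho ^+ 2 = 3 * d * rho + rho ^+ 2.
  by field; rewrite gt_eqF.
apply: (@le_trans _ _ ((rho + d) ^+ 2)); last by nra.
by rewrite ler_pXn2r ?nnegrE ?enorm_ge0// addr_ge0// ltW.
Qed.

End barrier_bounds.

Section estimate.
Context {R : realType} {n : nat}.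
Local Notation mu := (@lebesgue_rV R n).
Implicit Types (x y : 'rV[R]_n) (Omega U : set 'rV[R]_n) (p u : 'rV[R]_n -> R).

(** On the boundary of Omega inside the ball u vanishes and the barrier does not
    become negative; on the sphere of radius 2 rho the barrier is at least S.
    Hence the sets where u exceeds the barrier by e are compact, as [comparison]
    requires. *)
Lemma barrier_estimate Omega U p (Dp : 'rV[R]_n -> 'rV[R]_n) u (y0 : 'rV[R]_n) (L pm P rho S k : R) :
  (0 < n)%N -> open Omega -> open U -> p_harmonic p U u ->
  measurable_fun setT p -> elipschitz p -> 1 < pm -> (forall x, pm <= p x <= P) ->
  distributional_gradient setT p Dp -> 0 <= L -> {ae mu, forall x, enorm (Dp x) <= L} ->
  0 < rho -> 0 < S -> 1 <= k ->
  2 * bar_Lambda rho (2 * S) k * L * rho + n%:R <= (pm - 1) * (2 * k - 1) ->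
  (forall x, Omega x -> rho <= enorm (x - y0)) ->
  Omega `&` eball y0 (2 * rho) `<=` U ->
  let Q := closure Omega `&` [set x | enorm (x - y0) <= 2 * rho] in
  {within Q, continuous u} ->
  (forall x, Q x -> ~ Omega x -> u x = 0) ->
  (forall x, Q x -> Omega x -> u x <= S) ->
  forall x, Omega x -> eball y0 (2 * rho) x -> u x <= barrier y0 rho (2 * S) k x.
Proof.
move=> n0 oO oU [cu [Du [dg _ LDu] weak]] mp lip pm1 pP dgp L0 aeD rho0 S0 k1 Hk Or OU Q cQ u0 uS.
have [L' L'0 pL] := elipschitz_norm lip.
have a0 : 0 < 2 * S by rewrite mulr_gt0.
have cO x : closure Omega x -> rho <= enorm (x - y0).
  move=> clx; apply: (closure_ge (f := fun x => enorm (x - y0)) _ Or clx).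
  exact: continuous_enormB.
pose v := barrier y0 rho (2 * S) k.
have C1v : C1on setT v (fun i x => bar_grad y0 rho (2 * S) k x ord0 i) by exact: C1_barrier.
have cv : continuous v by exact: (C1_continuous C1v).
pose A := [set x : 'rV[R]_n | rho ^+ 2 <= sqd y0 x <= 4 * rho ^+ 2].
have superv : strict_supersolution p (bar_grad y0 rho (2 * S) k) A (bar_kappa rho (2 * S) k P).
  move=> K phi dphi cK KA C1phi phiK phi0.
  exact: (barrier_supersolution rho0 a0 k1 dgp pL L'0 aeD L0 pm1 pP Hk cK KA).
have rho2 : 0 <= 2 * rho by rewrite mulr_ge0// ltW.
pose U0 := Omega `&` eball y0 (2 * rho).
have U0Q : U0 `<=` Q.
  by move=> x [Ox /ltW xr]; split => //; exact: subset_closure.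
have cptQ : compact Q.
  by rewrite /Q setIC; apply: compact_closedI; [exact: compact_ceball|exact: closed_closure].
have cuv : {within Q, continuous (fun x => u x - v x)}.
  move=> x; apply: (@continuousB _ _ _ (u : subspace Q -> R) (v : subspace Q -> R)).
    exact: cQ.
  exact: (continuous_subspaceT cv).
move=> x Ox xr; apply: (@comparison R n p U u Du v (bar_grad y0 rho (2 * S) k) A U0
  (bar_kappa rho (2 * S) k P) L' pm P) => //.
- by move=> y Uy; move: cu; rewrite continuous_open_subspace// => /(_ y); rewrite inE; apply.
- exact: bar_kappa_gt0.
- by apply: openI => //; exact: open_eball.
- move=> e e0; rewrite (_ : [set _ | _] = Q `&` [set x | e <= u x - v x]).
    exact: compact_superlevel.
  apply/seteqP; split=> y; first by move=> [/U0Q].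
  move=> [Qy /= ey]; split=> //; have [cly yr] := Qy.
  have vy : 0 <= v y by apply: barrier_ge0 => //; exact: cO.
  have Oy : Omega y.
    by apply: contrapT => nOy; move: ey; rewrite u0// sub0r; lra.
  split=> //; rewrite /eball/= lt_neqAle yr andbT; apply/eqP => yE.
  have := @barrier_half R n y0 rho (2 * S) k rho0 a0 k1 y yE.
  have := uS y Qy Oy; rewrite -/v; lra.
- move=> y [Oy yr] _; rewrite /A/= sqd_enorm; apply/andP; split.
    by rewrite ler_pXn2r ?nnegrE ?enorm_ge0 ?(ltW rho0)// Or.
  have -> : 4 * rho ^+ 2 = (2 * rho) ^+ 2 by ring.
  by rewrite ler_pXn2r ?nnegrE ?enorm_ge0// ltW.
Qed.

End estimate.

(* ct takes the values of r_e, p^- and |grad p|_oo; c takes the values of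
   n, sup u, r_e, p^+, p^- and |grad p|_oo.  The bound 2 < ct ensures that u is
   defined and bounded on Omega `&` eball w (2 * rt), so that S is a genuine
   supremum. *)
Theorem lemma5p3 (R : realType) :
  exists (ct : R -> R -> R -> R) (c : nat -> R -> R -> R -> R -> R -> R),
  forall (n : nat) (Omega : set 'rV[R]_n) (re : R) (w : 'rV[R]_n) (r : R)
    (p : 'rV[R]_n -> R) (Dp : 'rV[R]_n -> 'rV[R]_n) (u : 'rV[R]_n -> R),
  (2 <= n)%N ->
  domain Omega ->
  exterior_ball_condition Omega re ->
  boundary Omega w ->
  0 < r < re ->
  bounded_exponent p ->
  elipschitz p ->
  distributional_gradient setT p Dp ->
  p_harmonic p (Omega `&` eball w r) u ->
  (forall x, Omega x -> eball w r x -> 0 < u x) ->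
  vanishes_continuously Omega (eball w r) u ->
  let pm := fine (pminus p) in
  let pp := fine (pplus p) in
  let L := fine (Linfty_norm Dp) in
  let rt := r / ct re pm L in
  let S := sup [set u x | x in eball w (2 * rt) `&` Omega] in
  2 < ct re pm L /\
  forall x, Omega x -> eball w rt x ->
    u x <= c n S re pp pm L * (edist_set x (boundary Omega) / r).
Proof.
(* 60 = 6 * 10: the factor 6 S k comes from [barrier_le] with a = 2 S, and the
   factor 10 from rho = rt / 10. *)
exists aperture, (fun n S re _ pm L => 60 * S * steepness n S re pm L * aperture re pm L).
move=> n Omega re w r p Dp u n2 [_ oO _] [re0 ext] bw /andP[r0 rre] bp lip dgp harm upos [cu u0].
move=> pm pp L rt S.
have n0 : (0 < n)%N by exact: leq_trans n2.
have [L' L'0 pL] := elipschitz_norm lip.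
have [pm1 pP] := bounded_exponentP bp (lipschitz_continuous pL).
have [L0 aeD] := Linfty_norm_ae n0 pL L'0 dgp.
rewrite -/pm -/pp -/L in pm1 pP L0 aeD.
have ct3 : 3 <= aperture re pm L by exact: aperture_ge3.
have ct0 : 0 < aperture re pm L by apply: lt_le_trans ct3.
split; first by apply: lt_le_trans ct3; rewrite ltr_nat.
have rt0 : 0 < rt by rewrite divr_gt0.
have rtr : rt * aperture re pm L = r by rewrite /rt divfK// gt_eqF.
have rt3 : 3 * rt <= r by rewrite -rtr mulrC ler_wpM2l// ltW.
have [clw nOw] := boundary_open oO bw.
have rt2 (x : 'rV[R]_n) : enorm (x - w) <= 2 * rt -> eball w r x.
  by rewrite /eball/=; lra.
pose D := closure Omega `&` [set x | enorm (x - w) <= 2 * rt].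
have cD : {within D, continuous u}.
  by apply: continuous_subspaceW cu => x [clx xr]; split => //; exact: rt2.
have cptD : compact D.
  by rewrite /D setIC; apply: compact_closedI; [exact: compact_ceball|exact: closed_closure].
have uS x : Omega x -> enorm (x - w) < 2 * rt -> u x <= S.
  move=> Ox xr; apply: ub_le_sup; last by exists x.
  have /compact_bounded[M [_ HM]] := continuous_compact cD cptD.
  exists (`|M| + 1) => _ [y [yr Oy] <-]; apply: le_trans (ler_norm _) _.
  apply: HM; first by rewrite (le_lt_trans (ler_norm _))// ltrDl.
  by exists y => //; split; [exact: subset_closure|exact: ltW].
have S0 : 0 < S.
  have rt20 : 0 < 2 * rt by rewrite mulr_gt0.
  have nw : nbhs w (eball w (2 * rt)).
    apply: open_nbhs_nbhs; split; first exact: open_eball.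
    by rewrite /eball/= subrr enorm0.
  have [y [Oy yr]] := clw _ nw.
  apply: lt_le_trans (uS y Oy yr); apply: upos => //.
  by apply: rt2; exact: ltW.
set k := steepness n S re pm L.
have k1 : 1 <= k by exact: steepness_ge1.
(* With 10 rho = rt all the balls of radius 2 rho used below stay in the ball of
   radius 2 rt about w, where u <= S. *)
pose rho := rt / 10; have rho0 : 0 < rho by rewrite divr_gt0.
have rt10 : rt = 10 * rho by rewrite /rho; field.
have rhore : rho <= re by lra.
have Lrho : 20 * (L * rho) <= pm - 1.
  have ctL : 2 * re * L <= aperture re pm L * (pm - 1).
    rewrite /aperture [leRHS]mulrDl divfK ?gt_eqF ?subr_gt0// lerDr mulr_ge0// subr_ge0.
    exact: ltW.
  have h : 2 * L * r <= 2 * re * L by rewrite mulrAC ler_wpM2r// ler_wpM2l// ltW.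
  have h2 : (aperture re pm L) * (20 * (L * rho)) <= aperture re pm L * (pm - 1).
    apply: le_trans ctL; apply: le_trans h; rewrite -rtr rt10 le_eqVlt; apply/orP; left.
    by apply/eqP; ring.
  by rewrite ler_pM2l in h2.
have Hk : 2 * bar_Lambda rho (2 * S) k * L * rho + n%:R <= (pm - 1) * (2 * k - 1).
  by apply: steepness_suffices => //; rewrite rho0.
move=> x0 Ox0 x0w.
have [mp _ _] := bp.
(* For w0 at distance at least rho from x0, the bound u <= S is enough. *)
have key w0 : boundary Omega w0 -> u x0 <= 6 * S * k * (enorm (x0 - w0) / rho).
  move=> bw0; have [far|near] := leP rho (enorm (x0 - w0)).
    apply: le_trans (uS x0 Ox0 _) _; first by apply: lt_trans x0w _; lra.
    have h1 : 1 <= enorm (x0 - w0) / rho by rewrite ler_pdivlMr// mul1r.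
    have h2 : S <= 6 * S * k by nra.
    apply: le_trans h2 _; rewrite ler_peMr// !mulr_ge0 ?(ltW S0) ?(le_trans ler01 k1)//.
  have [eta [nOe bO bE]] := ext w0 bw0.
  have bw0e : boundary (eball eta re) w0.
    by have [] : (boundary (eball eta re) `&` boundary Omega) w0 by rewrite bE.
  have rhor : 0 < rho <= re by rewrite rho0.
  have [y0 w0y y0b] := shrink_ball (boundary_eball bw0e) rhor.
  have Or x : Omega x -> rho <= enorm (x - y0).
    by move=> Ox; rewrite leNgt; apply/negP => xy; apply: (bO x) => //; exact: y0b.
  have wy x : enorm (x - y0) <= 2 * rho -> enorm (x - w) < 2 * rt.
    move=> xy; have := enorm_triangle y0 x w; have := enorm_triangle w0 y0 w.
    have := enorm_triangle x0 w0 w; rewrite (enormB w0 x0) (enormB y0 w0) w0y.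
    by move: x0w near xy rho0; rewrite /eball/= rt10; lra.
  have x0y : enorm (x0 - y0) <= rho + enorm (x0 - w0).
    by rewrite -w0y [leRHS]addrC enorm_triangle.
  have OU : Omega `&` eball y0 (2 * rho) `<=` Omega `&` eball w r.
    by move=> x [Ox /ltW xy]; split => //; apply: rt2; apply/ltW/wy.
  apply: (@le_trans _ _ (barrier y0 rho (2 * S) k x0)).
    apply: (barrier_estimate n0 oO _ harm mp lip pm1 pP dgp L0 aeD rho0 S0 k1 Hk Or OU) => //.
    - by apply: openI => //; exact: open_eball.
    - by apply: continuous_subspaceW cD => x [clx /wy/ltW xr]; split.
    - move=> x [clx /wy xr] nOx; apply: u0; last by apply: rt2; exact: ltW.
      by split => //; rewrite (proj1 (interior_id _) oO).
    - by move=> x [_ /wy xr] Ox; exact: uS.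
    - by rewrite /eball/=; lra.
  have dr : 0 <= enorm (x0 - w0) <= rho by rewrite enorm_ge0 ltW.
  have a0 : 0 < 2 * S by rewrite mulr_gt0.
  apply: le_trans (barrier_le rho0 a0 k1 dr x0y) _.
  by rewrite le_eqVlt; apply/orP; left; apply/eqP; ring.
have c0 : 0 < 6 * S * k / rho.
  by rewrite divr_gt0// !mulr_gt0//; exact: lt_le_trans k1.
have : u x0 / (6 * S * k / rho) <= edist_set x0 (boundary Omega).
  apply: lb_le_inf; first by exists (enorm (x0 - w)), w.
  move=> _ [w0 bw0 <-]; rewrite ler_pdivrMr// (le_trans (key w0 bw0))//.
  by rewrite le_eqVlt; apply/orP; left; apply/eqP; ring.
rewrite ler_pdivrMr// => /le_trans; apply.
rewrite le_eqVlt; apply/orP; left; apply/eqP; rewrite -rtr rt10; field.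
by rewrite !gt_eqF.
Qed.
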